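(* In $U'_q(\mathfrak{sl}_3)[[t]]$ put $e_{1+2}=e_1e_2-q\,e_2e_1$, $W=\exp_{q^{-2}}\!\big(-\frac{t}{1-q^2}\,e_{1+2}L_1\big)$, $\mathcal J=(W\otimes W)\Delta(W^{-1})$, and $$V=\exp_{q^{-2}}\!\Big(-\frac{q^{-1}t^2}{(1-q^2)^2}\,e_1L_1^2L_2^{-2}\Big)\cdot\exp_{q^2}\!\Big(\frac{t}{1-q^2}\,f_2\Big).$$ Then the element $$F_q=(WV\otimes WV)\,\exp_{q^{-2}}\!\Big(\frac{q^{-3}t^3}{(1-q^2)^2}\,f_2\otimes e_1\Big)\,\Delta(V^{-1})\,(W^{-1}\otimes W^{-1})$$ restricts to a twist in $\hat U_q^{\prime\,\mathcal J}(\mathfrak{sl}_3)[[t]]$; that is, $F_q\in\big(\hat U'_q(\mathfrak{sl}_3)\otimes_{\mathcal A}\hat U'_q(\mathfrak{sl}_3)\big)[[t]]$ and $F_q$ is a twist with respect to the coproduct $\Delta_{\mathcal J}(a)=\mathcal J\Delta(a)\mathcal J^{-1}$.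
   Context: **Twists.** For a Hopf algebra $H$ with coproduct $\Delta$ and counit $\varepsilon$ (here a $t$-adically completed one; $H=H_0[[t]]$, with $H\otimes H$ understood as $(H_0\otimes H_0)[[t]]$), a twist in $H$ is an element $\mathcal F\in H\otimes H$ with $\mathcal F^{12}(\Delta\otimes\mathrm{id})(\mathcal F)=\mathcal F^{23}(\mathrm{id}\otimes\Delta)(\mathcal F)$ and $(\varepsilon\otimes\mathrm{id})(\mathcal F)=(\mathrm{id}\otimes\varepsilon)(\mathcal F)=1$. **$q$-exponential.** $\exp_p(x)=\sum_{n\ge0}\frac{x^n}{(n)_p!}$, $(n)_p!=(1)_p(2)_p\cdots(n)_p$, $(k)_p=\frac{1-p^k}{1-p}$. **The Hopf algebra $U'_q(\mathfrak{sl}_3)$.** It is the algebra over $\mathbb C(q)$ generated by $e_i,f_i,L_i^{\pm1}$, $i=1,2$, the $L_i$ commuting, with relations $L_ie_jL_i^{-1}=q^{\delta_{ij}}e_j$, $L_if_jL_i^{-1}=q^{-\delta_{ij}}f_j$, $e_if_j-f_je_i=\delta_{ij}\frac{k_i-k_i^{-1}}{q-q^{-1}}$ where $k_1=L_1^2L_2^{-1}$, $k_2=L_1^{-1}L_2^2$, and the quantum Serre relations $e_i^2e_j-(q+q^{-1})e_ie_je_i+e_je_i^2=0$, $f_i^2f_j-(q+q^{-1})f_if_jf_i+f_jf_i^2=0$ for $i\ne j$. The coproduct is $\Delta(L_i)=L_i\otimes L_i$, $\Delta(e_1)=L_1^{-2}L_2^2\otimes e_1+e_1\otimes1$, $\Delta(e_2)=L_1L_2^{-2}\otimes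 e_2+e_2\otimes L_1$, $\Delta(f_1)=f_1\otimes L_1^2L_2^{-1}+L_2^{-1}\otimes f_1$, $\Delta(f_2)=f_2\otimes L_1^{-2}L_2^2+1\otimes f_2$; the counit is $\varepsilon(L_i)=1$, $\varepsilon(e_i)=\varepsilon(f_i)=0$. **Regular form.** $\mathcal A=\mathbb C[q,q^{-1}]_{(q-1)}$ is the ring of rational functions in $q$ regular at $q=1$, and $\hat U'_q(\mathfrak{sl}_3)$ is the $\mathcal A$-subalgebra of $U'_q(\mathfrak{sl}_3)$ generated by $L_i^{-1},\frac{L_i-1}{q-1},e_i,f_i$ ($i=1,2$). The element $\mathcal J$ is a twist in $U'_q(\mathfrak{sl}_3)[[t]]$ lying in $\big(\hat U'_q(\mathfrak{sl}_3)\otimes_{\mathcal A}\hat U'_q(\mathfrak{sl}_3)\big)[[t]]$; $\hat U_q^{\prime\,\mathcal J}(\mathfrak{sl}_3)[[t]]$ denotes the algebra $\hat U'_q(\mathfrak{sl}_3)[[t]]$ with coproduct $\Delta_{\mathcal J}$ and the same counit. *)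

(* Defs.v *)
From HB Require Import structures.
From mathcomp Require Import all_boot all_order all_algebra zify ring ssrAC.
From mathcomp Require Import fraction generic_quotient.
From mathcomp Require Import boolp classical_sets reals.
From mathcomp.real_closed Require Import complex.

Set Implicit Arguments.
Unset Strict Implicit.
Unset Printing Implicit Defensive.

Import Order.TTheory GRing.Theory Num.Theory.
Local Open Scope ring_scope.
Local Open Scope quotient_scope.

(** * Tensor product of two algebras over a field *)

(** An element of [tensor A B] is a class of formal sums [a_1 (x) b_1 + ...]
    represented by the list of the pairs [(a_i, b_i)]. *)
Section TensorType.
Variables (K : fieldType) (A B : algType K).

Inductive tensor_eq : seq (A * B) -> seq (A * B) -> Prop :=
| tensor_eq_refl s : tensor_eq s s
| tensor_eq_sym s s' : tensor_eq s s' -> tensor_eq s' s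
| tensor_eq_trans s s' s'' :
    tensor_eq s s' -> tensor_eq s' s'' -> tensor_eq s s''
| tensor_eq_cat s s' r r' :
    tensor_eq s s' -> tensor_eq r r' -> tensor_eq (s ++ r) (s' ++ r')
| tensor_eq_catC s r : tensor_eq (s ++ r) (r ++ s)
| tensor_eqDl a a' b : tensor_eq [:: (a + a', b)] [:: (a, b); (a', b)]
| tensor_eqDr a b b' : tensor_eq [:: (a, b + b')] [:: (a, b); (a, b')]
| tensor_eqZ c a b : tensor_eq [:: (c *: a, b)] [:: (a, c *: b)]
| tensor_eq0 b : tensor_eq [:: (0, b)] [::].

Definition tensor_eqb : rel (seq (A * B)) := fun s r => `[< tensor_eq s r >].

Lemma tensor_eqb_refl : reflexive tensor_eqb.
Proof. by move=> s; apply/asboolP/tensor_eq_refl. Qed.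

Lemma tensor_eqb_sym : symmetric tensor_eqb.
Proof. by move=> s r; apply/asboolP/asboolP => /tensor_eq_sym. Qed.

Lemma tensor_eqb_trans : transitive tensor_eqb.
Proof.
move=> s r t /asboolP h1 /asboolP h2.
by apply/asboolP; exact: tensor_eq_trans h1 h2.
Qed.

Canonical tensor_equiv :=
  EquivRel tensor_eqb tensor_eqb_refl tensor_eqb_sym tensor_eqb_trans.

Definition tensor := {eq_quot tensor_eqb}.
HB.instance Definition _ := Choice.on tensor.
HB.instance Definition _ : EqQuotient _ tensor_eqb tensor :=
  EqQuotient.on tensor.

Lemma pi_tensorP (s r : seq (A * B)) :
  \pi_tensor s = \pi_tensor r <-> tensor_eq s r.
Proof. by split=> [/eqquotP/asboolP //|h]; apply/eqquotP/asboolP. Qed.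

Lemma tensor_repr (s : seq (A * B)) : tensor_eq (repr (\pi_tensor s)) s.
Proof. by apply/pi_tensorP; rewrite reprK. Qed.

Lemma pi_tensor_surj (x : tensor) : exists s, x = \pi_tensor s.
Proof. by exists (repr x); rewrite reprK. Qed.

Definition tpure (a : A) (b : B) : tensor := \pi_tensor [:: (a, b)].

Definition tadd (x y : tensor) : tensor := \pi_tensor (repr x ++ repr y).

Lemma taddE s r : tadd (\pi_tensor s) (\pi_tensor r) = \pi_tensor (s ++ r).
Proof.
apply/pi_tensorP; apply: tensor_eq_cat; apply: tensor_repr.
Qed.

Lemma taddA : associative tadd.
Proof.
move=> x y z; have [s ->] := pi_tensor_surj x.
have [r ->] := pi_tensor_surj y; have [t ->] := pi_tensor_surj z.
by rewrite !taddE catA.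
Qed.

Lemma taddC : commutative tadd.
Proof.
move=> x y; have [s ->] := pi_tensor_surj x.
have [r ->] := pi_tensor_surj y; rewrite !taddE.
by apply/pi_tensorP; exact: tensor_eq_catC.
Qed.

Lemma tadd0 : left_id (\pi_tensor [::]) tadd.
Proof. by move=> x; have [s ->] := pi_tensor_surj x; rewrite taddE. Qed.

HB.instance Definition _ := GRing.isNmodule.Build tensor taddA taddC tadd0.

Lemma pi_cat s r : \pi_tensor (s ++ r) = \pi_tensor s + \pi_tensor r.
Proof. by rewrite -taddE. Qed.

Lemma pi_tensorE s : \pi_tensor s = \sum_(p <- s) tpure p.1 p.2.
Proof.
elim: s => [|[a b] s IHs]; first by rewrite big_nil.
by rewrite -cat1s pi_cat IHs big_cons.
Qed.

Lemma tpureDl a a' b : tpure (a + a') b = tpure a b + tpure a' b.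
Proof.
by rewrite -[RHS]pi_cat; apply/pi_tensorP; exact: tensor_eqDl.
Qed.

Lemma tpureDr a b b' : tpure a (b + b') = tpure a b + tpure a b'.
Proof.
by rewrite -[RHS]pi_cat; apply/pi_tensorP; exact: tensor_eqDr.
Qed.

Lemma tpure_bal c a b : tpure (c *: a) b = tpure a (c *: b).
Proof. by apply/pi_tensorP; exact: tensor_eqZ. Qed.

Lemma tpure0l b : tpure 0 b = 0.
Proof. by apply/pi_tensorP; exact: tensor_eq0. Qed.

Lemma tensorP (x : tensor) :
  exists s : seq (A * B), x = \sum_(p <- s) tpure p.1 p.2.
Proof. by have [s ->] := pi_tensor_surj x; exists s; exact: pi_tensorE. Qed.

Section Lift.
Variable M : nmodType.
Implicit Type f : A -> B -> M.

Definition balanced f : Prop :=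
  [/\ forall a a' b, f (a + a') b = f a b + f a' b,
      forall a b b', f a (b + b') = f a b + f a b',
      forall c a b, f (c *: a) b = f a (c *: b) &
      forall b, f 0 b = 0].

(** The linear map out of the tensor product induced by a bilinear map [f];
    it does not depend on representatives when [f] is [balanced]. *)
Definition tlift f (x : tensor) : M := \sum_(p <- repr x) f p.1 p.2.

Lemma tlift_pi f s : balanced f ->
  tlift f (\pi_tensor s) = \sum_(p <- s) f p.1 p.2.
Proof.
case=> fDl fDr fZ f0; rewrite /tlift.
suff h u v : tensor_eq u v -> \sum_(p <- u) f p.1 p.2 = \sum_(p <- v) f p.1 p.2.
  exact: h (tensor_repr s).
elim=> {s u v} //.
- by move=> s s' s'' _ -> _ ->.
- by move=> s s' r r' _ IH _ IH'; rewrite !big_cat IH IH'.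
- by move=> s r; rewrite !big_cat /= addrC.
- by move=> a a' b; rewrite !big_cons !big_nil !addr0 fDl.
- by move=> a b b'; rewrite !big_cons !big_nil !addr0 fDr.
- by move=> c a b; rewrite !big_cons !big_nil !addr0 fZ.
- by move=> b; rewrite !big_cons !big_nil !addr0 f0.
Qed.

Lemma tlift_pure f a b : balanced f -> tlift f (tpure a b) = f a b.
Proof. by move=> fb; rewrite tlift_pi // big_seq1. Qed.

Lemma tliftD f x y : balanced f -> tlift f (x + y) = tlift f x + tlift f y.
Proof.
move=> fb; have [s ->] := pi_tensor_surj x.
have [r ->] := pi_tensor_surj y; rewrite -pi_cat !tlift_pi //.
by rewrite big_cat.
Qed.

Lemma tlift0 f : balanced f -> tlift f 0 = 0.
Proof. by move=> fb; rewrite [LHS](tlift_pi [::] fb) big_nil. Qed.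

Lemma tlift_sum f (I : Type) (r : seq I) (F : I -> tensor) : balanced f ->
  tlift f (\sum_(i <- r) F i) = \sum_(i <- r) tlift f (F i).
Proof.
move=> fb; elim: r => [|i r IHr]; first by rewrite !big_nil tlift0.
by rewrite !big_cons tliftD // IHr.
Qed.

End Lift.

Definition topp : tensor -> tensor := tlift (fun a b => tpure (- a) b).

Lemma topp_bal : balanced (fun a b => tpure (- a) b).
Proof.
split=> [a a' b|a b b'|c a b|b].
- by rewrite opprD tpureDl.
- by rewrite tpureDr.
- by rewrite -scalerN tpure_bal.
- by rewrite oppr0 tpure0l.
Qed.

Lemma taddN : left_inverse (0 : tensor) topp +%R.
Proof.
move=> x; have [s ->] := tensorP x; rewrite /topp tlift_sum; last exact: topp_bal.
rewrite -big_split big1 //= => -[a b] _ /=.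
by rewrite tlift_pure; [rewrite -tpureDl addNr tpure0l | exact: topp_bal].
Qed.

HB.instance Definition _ := GRing.Nmodule_isZmodule.Build tensor taddN.

Definition tscale (c : K) : tensor -> tensor :=
  tlift (fun a b => tpure (c *: a) b).

Lemma tscale_bal c : balanced (fun a b => tpure (c *: a) b).
Proof.
split=> [a a' b|a b b'|c' a b|b].
- by rewrite scalerDr tpureDl.
- by rewrite tpureDr.
- by rewrite scalerA mulrC -scalerA tpure_bal.
- by rewrite scaler0 tpure0l.
Qed.

Lemma tscaleE c s : tscale c (\sum_(p <- s) tpure p.1 p.2) =
  \sum_(p <- s) tpure (c *: p.1) p.2.
Proof.
rewrite /tscale tlift_sum; last exact: tscale_bal.
by apply: eq_bigr => p _; rewrite tlift_pure //; exact: tscale_bal.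
Qed.

Lemma tscaleA a b v : tscale a (tscale b v) = tscale (a * b) v.
Proof.
have [s ->] := tensorP v; rewrite !tscaleE.
rewrite [LHS](_ : _ = tscale a (\sum_(p <- [seq (b *: p.1, p.2) | p <- s])
  tpure p.1 p.2)); last by rewrite big_map.
by rewrite tscaleE big_map; apply: eq_bigr => p _; rewrite /= scalerA.
Qed.

Lemma tscale1 : left_id 1 tscale.
Proof.
move=> x; have [s ->] := tensorP x; rewrite tscaleE.
by apply: eq_bigr => p _; rewrite scale1r.
Qed.

Lemma tscaleDr : right_distributive tscale +%R.
Proof. by move=> c x y; rewrite /tscale tliftD //; exact: tscale_bal. Qed.

Lemma tscaleDl v : {morph tscale^~ v : a b / a + b}.
Proof.
move=> a b; have [s ->] := tensorP v; rewrite !tscaleE -big_split.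
by apply: eq_bigr => p _; rewrite scalerDl tpureDl.
Qed.

HB.instance Definition _ := GRing.Zmodule_isLmodule.Build K tensor
  tscaleA tscale1 tscaleDr tscaleDl.

Lemma tpureZl c a b : tpure (c *: a) b = c *: tpure a b.
Proof. by rewrite [RHS]tlift_pure //; exact: tscale_bal. Qed.

Lemma tpureZr c a b : tpure a (c *: b) = c *: tpure a b.
Proof. by rewrite -tpure_bal tpureZl. Qed.

Lemma tpure0r a : tpure a 0 = 0.
Proof. by rewrite -(scale0r 0) tpureZr scale0r. Qed.

Lemma tpureNl a b : tpure (- a) b = - tpure a b.
Proof. by rewrite -scaleN1r tpureZl scaleN1r. Qed.

Lemma tpureNr a b : tpure a (- b) = - tpure a b.
Proof. by rewrite -scaleN1r tpureZr scaleN1r. Qed.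

Lemma tpure_balanced : balanced tpure.
Proof.
split; [exact: tpureDl|exact: tpureDr|exact: tpure_bal|exact: tpure0l].
Qed.

Lemma tlift_pureE x : tlift tpure x = x.
Proof. by rewrite /tlift -pi_tensorE reprK. Qed.

Lemma tensor_ind (P : tensor -> Prop) :
  P 0 -> (forall x y, P x -> P y -> P (x + y)) ->
  (forall a b, P (tpure a b)) -> forall x, P x.
Proof.
move=> P0 PD Pp x; have [s ->] := tensorP x.
by elim/big_rec: _ => // p y _ Py; apply: PD.
Qed.

Definition tmul_pure (a : A) (b : B) : tensor -> tensor :=
  tlift (fun a' b' => tpure (a * a') (b * b')).

Definition tmul (x y : tensor) : tensor :=
  tlift (fun a b => tmul_pure a b y) x.

Lemma tmul_pure_bal a b : balanced (fun a' b' => tpure (a * a') (b * b')).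
Proof.
split=> [a' a'' b'|a' b' b''|c a' b'|b'].
- by rewrite mulrDr tpureDl.
- by rewrite mulrDr tpureDr.
- by rewrite -!scalerAr tpure_bal.
- by rewrite mulr0 tpure0l.
Qed.

Lemma tmul_pureE a b a' b' :
  tmul_pure a b (tpure a' b') = tpure (a * a') (b * b').
Proof. by rewrite /tmul_pure tlift_pure //; exact: tmul_pure_bal. Qed.

Lemma tmul_pureD a b : {morph tmul_pure a b : x y / x + y}.
Proof. by move=> x y; rewrite /tmul_pure tliftD //; exact: tmul_pure_bal. Qed.

Lemma tmul_pure0 a b : tmul_pure a b 0 = 0.
Proof. by rewrite /tmul_pure tlift0 //; exact: tmul_pure_bal. Qed.

Lemma tmul_bal y : balanced (fun a b => tmul_pure a b y).
Proof.
split; elim/tensor_ind: y => [||a0 b0].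
- by move=> *; rewrite !tmul_pure0 addr0.
- by move=> x y IHx IHy a a' b; rewrite !tmul_pureD IHx IHy addrACA.
- by move=> a a' b; rewrite !tmul_pureE mulrDl tpureDl.
- by move=> *; rewrite !tmul_pure0 addr0.
- by move=> x y IHx IHy a b b'; rewrite !tmul_pureD IHx IHy addrACA.
- by move=> a b b'; rewrite !tmul_pureE mulrDl tpureDr.
- by move=> *; rewrite !tmul_pure0.
- by move=> x y IHx IHy c a b; rewrite !tmul_pureD IHx IHy.
- by move=> c a b; rewrite !tmul_pureE -!scalerAl tpure_bal.
- by move=> *; rewrite !tmul_pure0.
- by move=> x y IHx IHy b; rewrite !tmul_pureD IHx IHy addr0.
- by move=> b; rewrite !tmul_pureE mul0r tpure0l.
Qed.

Lemma tmulE a b y : tmul (tpure a b) y = tmul_pure a b y.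
Proof. by rewrite /tmul tlift_pure //; exact: tmul_bal. Qed.

Lemma tmulDl : left_distributive tmul +%R.
Proof. by move=> x y z; rewrite /tmul tliftD //; exact: tmul_bal. Qed.

Lemma tmul0l y : tmul 0 y = 0.
Proof. by rewrite /tmul tlift0 //; exact: tmul_bal. Qed.

Lemma tmulDr : right_distributive tmul +%R.
Proof.
move=> x y z; elim/tensor_ind: x => [|x x' IH IH'|a b].
- by rewrite !tmul0l addr0.
- by rewrite !tmulDl IH IH' addrACA.
- by rewrite !tmulE tmul_pureD.
Qed.

Lemma tmul0r x : tmul x 0 = 0.
Proof.
elim/tensor_ind: x => [|x x' IH IH'|a b]; first by rewrite tmul0l.
- by rewrite tmulDl IH IH' addr0.
- by rewrite tmulE tmul_pure0.
Qed.

Lemma tmulA : associative tmul.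
Proof.
move=> x y z; elim/tensor_ind: x => [|x x' IH IH'|a b].
- by rewrite !tmul0l.
- by rewrite !tmulDl IH IH'.
elim/tensor_ind: y => [|y y' IH IH'|a' b'].
- by rewrite tmul0l tmul0r tmul0l.
- by rewrite tmulDl !tmulDr IH IH' tmulDl.
elim/tensor_ind: z => [|z z' IH IH'|a'' b''].
- by rewrite !tmul0r.
- by rewrite !tmulDr IH IH'.
by rewrite !(tmulE, tmul_pureE) !mulrA.
Qed.

Lemma tmul1l : left_id (tpure 1 1) tmul.
Proof.
elim/tensor_ind => [|x x' IH IH'|a b]; first by rewrite tmul0r.
- by rewrite tmulDr IH IH'.
- by rewrite tmulE tmul_pureE !mul1r.
Qed.

Lemma tmul1r : right_id (tpure 1 1) tmul.
Proof.
elim/tensor_ind => [|x x' IH IH'|a b]; first by rewrite tmul0l.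
- by rewrite tmulDl IH IH'.
- by rewrite tmulE tmul_pureE !mulr1.
Qed.

End TensorType.

Section LinearFunctional.
Variables (K : fieldType) (V : lmodType K).

Lemma exists_linear_functional (v : V) : v != 0 ->
  exists phi : V -> K^o, linear phi /\ phi v = 1.
Proof.
move=> v0.
pose P (S : set V) :=
  (forall a x y, S x -> S y -> S (a *: x + y)) /\ ~ S v.
have [F FP Ftot|M [[Mlin Mv] Mmax]] := @Zorn_bigcup V P.
  split=> [a x y [X FX Xx] [Y FY Yy]|[X FX Xv]]; last by case: (FP _ FX).
  have [XY|YX] := Ftot _ _ FX FY.
  - by exists Y => //; apply: (FP _ FY).1 => //; exact: XY.
  - by exists X => //; apply: (FP _ FX).1 => //; exact: YX.
have M0 : M 0.
  apply: contrapT => M0.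
  apply: (Mmax [set 0]%classic); last first.
    split=> [a x y -> ->|/= e]; first by rewrite scaler0 addr0.
    by rewrite e eqxx in v0.
  split; last by move/(_ 0 erefl).
  by move=> x Mx; case: M0; rewrite -(addNr x) -scaleN1r; exact: Mlin.
have MZ a x : M x -> M (a *: x) by move=> Mx; rewrite -[_ *: _]addr0; exact: Mlin.
have dec x : exists c, M (x - c *: v).
  have [Mx|Mx] := pselect (M x); first by exists 0; rewrite scale0r subr0.
  pose N : set V := fun y => exists m c, M m /\ y = m + c *: x.
  have NM : (M `<` N)%classic.
    split; first by move=> m Mm; exists m, 0; rewrite scale0r addr0.
    by move/(_ x); case/(_ _)/Mx; exists 0, 1; rewrite scale1r add0r.
  have Nv : N v.
    apply: contrapT => Nv; apply: (Mmax _ NM); split=> // a y z.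
    move=> [m [c [Mm ->]]] [m' [c' [Mm' ->]]].
    exists (a *: m + m'), (a * c + c'); split; first exact: Mlin.
    by rewrite scalerDr scalerA scalerDl addrACA.
  have [m [c [Mm vE]]] := Nv.
  have c0 : c != 0.
    by apply/eqP => c0; apply: Mv; rewrite vE c0 scale0r addr0.
  exists c^-1; rewrite vE scalerDr scalerA mulVf // scale1r opprD.
  by rewrite addrCA subrr addr0 -scaleNr; exact: MZ.
have uniq x c c' : M (x - c *: v) -> M (x - c' *: v) -> c = c'.
  move=> h h'; apply/eqP; rewrite -subr_eq0; apply/negP => /negP cc'.
  apply: Mv; have -> : v = (c' - c)^-1 *: (((-1) *: (x - c' *: v)) + (x - c *: v)).
    rewrite scaleN1r opprB addrA subrK -scalerBl scalerA mulVf ?scale1r //.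
    by rewrite -opprB oppr_eq0.
  by apply: MZ; exact: Mlin.
pose phi x := projT1 (cid (dec x)).
have phiP x : M (x - phi x *: v) by rewrite /phi; case: cid.
exists phi; split=> [a x y|]; last first.
  by apply: (uniq v); rewrite ?scale1r ?subrr.
apply: (uniq (a *: x + y)) => //.
have -> : a *: x + y - (a * phi x + phi y) *: v =
   a *: (x - phi x *: v) + (y - phi y *: v).
  by rewrite scalerBr scalerA scalerDl opprD addrACA.
exact: Mlin.
Qed.

End LinearFunctional.

Section TensorAlgebra.
Variables (K : fieldType) (A B : algType K).
Local Notation T := (tensor A B).

Lemma tensor_oner_neq0 : tpure 1 1 != 0 :> T.
Proof.
have [f [flin f1]] := exists_linear_functional (oner_neq0 A).
have [g [glin g1]] := exists_linear_functional (oner_neq0 B).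
have fD a a' : f (a + a') = f a + f a'.
  by have := flin 1 a a'; rewrite !scale1r.
have gD a a' : g (a + a') = g a + g a'.
  by have := glin 1 a a'; rewrite !scale1r.
have f0 : f 0 = 0 by apply: (addrI (f 0)); rewrite -fD !addr0.
have g0 : g 0 = 0 by apply: (addrI (g 0)); rewrite -gD !addr0.
have fZ c a : f (c *: a) = c *: f a.
  by have := flin c a 0; rewrite f0 !addr0.
have gZ c a : g (c *: a) = c *: g a.
  by have := glin c a 0; rewrite g0 !addr0.
have fg : balanced (fun a b => f a * g b : K).
  split=> [a a' b|a b b'|c a b|b].
  - by rewrite fD mulrDl.
  - by rewrite gD mulrDr.
  - by rewrite fZ gZ -scalerAl -scalerAr.
  - by rewrite f0 mul0r.
apply/eqP => /(congr1 (tlift (fun a b => f a * g b : K))).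
rewrite tlift_pure // tlift0 // f1 g1 mulr1 => /eqP.
by rewrite oner_eq0.
Qed.

HB.instance Definition _ := GRing.Zmodule_isNzRing.Build T
  (@tmulA K A B) (@tmul1l K A B) (@tmul1r K A B) (@tmulDl K A B)
  (@tmulDr K A B) tensor_oner_neq0.

Lemma tpureM a b a' b' :
  tpure a b * tpure a' b' = tpure (a * a') (b * b') :> T.
Proof. by rewrite [LHS]tmulE tmul_pureE. Qed.

Lemma tscalerAl (c : K) (x y : T) : c *: (x * y) = (c *: x) * y.
Proof.
elim/tensor_ind: x => [|x x' IH IH'|a b].
- by rewrite mul0r !scaler0 mul0r.
- by rewrite mulrDl !scalerDr IH IH' mulrDl.
elim/tensor_ind: y => [|y y' IH IH'|a' b'].
- by rewrite !mulr0 scaler0.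
- by rewrite !mulrDr scalerDr IH IH'.
by rewrite -tpureZl !tpureM -tpureZl scalerAl.
Qed.

HB.instance Definition _ := GRing.Lmodule_isLalgebra.Build K T tscalerAl.

Lemma tscalerAr (c : K) (x y : T) : c *: (x * y) = x * (c *: y).
Proof.
elim/tensor_ind: x => [|x x' IH IH'|a b].
- by rewrite !mul0r scaler0.
- by rewrite !mulrDl scalerDr IH IH'.
elim/tensor_ind: y => [|y y' IH IH'|a' b'].
- by rewrite mulr0 !scaler0 mulr0.
- by rewrite mulrDr !scalerDr IH IH' mulrDr.
by rewrite -tpureZl !tpureM -tpureZl scalerAr.
Qed.

HB.instance Definition _ := GRing.Lalgebra_isAlgebra.Build K T tscalerAr.

End TensorAlgebra.

(** * Power series in a central variable [t] over an algebra *)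

Record fps (A : Type) : Type := Fps { fcoef : nat -> A }.

HB.instance Definition _ (A : Type) := gen_eqMixin (fps A).
HB.instance Definition _ (A : Type) := gen_choiceMixin (fps A).

Lemma fpsP (A : Type) (f g : fps A) : (forall n, fcoef f n = fcoef g n) <-> f = g.
Proof.
by case: f g => f [g]; split=> [/= fg|[->] //]; congr Fps; exact/funext.
Qed.

Section FpsAlgebra.
Variables (K : fieldType) (A : algType K).
Implicit Types f g h : fps A.

Definition fps_add f g := Fps (fun n => fcoef f n + fcoef g n).
Definition fps_opp f := Fps (fun n => - fcoef f n).
Definition fps_zero : fps A := Fps (fun=> 0).

Lemma fps_addA : associative fps_add.
Proof. by move=> f g h; apply/fpsP => n /=; rewrite addrA. Qed.
Lemma fps_addC : commutative fps_add.
Proof. by move=> f g; apply/fpsP => n /=; rewrite addrC. Qed.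
Lemma fps_add0 : left_id fps_zero fps_add.
Proof. by move=> f; apply/fpsP => n /=; rewrite add0r. Qed.
Lemma fps_addN : left_inverse fps_zero fps_opp fps_add.
Proof. by move=> f; apply/fpsP => n /=; rewrite addNr. Qed.

HB.instance Definition _ :=
  GRing.isZmodule.Build (fps A) fps_addA fps_addC fps_add0 fps_addN.

Definition fps_one : fps A := Fps (fun n => if n == 0%N then 1 else 0).
Definition fps_mul f g :=
  Fps (fun n => \sum_(i < n.+1) fcoef f i * fcoef g (n - i)%N).

(* The truncation of a series as a polynomial; the ring axioms are inherited
   from those of polynomials. *)
Let trunc n f : {poly A} := \poly_(i < n.+1) fcoef f i.

Let trunc_mul n i f g : (i <= n)%N ->
  (trunc n f * trunc n g)`_i = fcoef (fps_mul f g) i.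
Proof.
move=> lin; rewrite coefM; apply: eq_bigr => j _.
rewrite !coef_poly !ltnS (leq_trans _ lin) ?(leq_trans (leq_subr _ _) lin) //.
by rewrite -ltnS.
Qed.

Let coefM_trunc (p p' r r' : {poly A}) n :
  (forall i, (i <= n)%N -> p`_i = p'`_i) -> (forall i, (i <= n)%N -> r`_i = r'`_i) ->
  (p * r)`_n = (p' * r')`_n.
Proof.
move=> pp' rr'; rewrite !coefM; apply: eq_bigr => j _.
by rewrite pp' ?rr' ?leq_subr // -ltnS.
Qed.

Let coef_trunc n i f : (i <= n)%N -> (trunc n f)`_i = fcoef f i.
Proof. by move=> lin; rewrite coef_poly ltnS lin. Qed.

Lemma fps_mulA : associative fps_mul.
Proof.
move=> f g h; apply/fpsP => n; rewrite -!(@trunc_mul n n) //.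
transitivity ((trunc n f * (trunc n g * trunc n h))`_n).
  by apply: coefM_trunc => // i lin; rewrite coef_trunc // trunc_mul.
rewrite mulrA.
by apply: coefM_trunc => // i lin; rewrite coef_trunc // trunc_mul.
Qed.

Lemma fps_mul1l : left_id fps_one fps_mul.
Proof.
move=> f; apply/fpsP => n /=; rewrite big_ord_recl mul1r subn0 big1 ?addr0 //.
by move=> i _; rewrite mul0r.
Qed.

Lemma fps_mul1r : right_id fps_one fps_mul.
Proof.
move=> f; apply/fpsP => n /=; rewrite big_ord_recr /= subnn mulr1 big1 ?add0r //.
by move=> i _; rewrite subn_eq0 leqNgt ltn_ord mulr0.
Qed.

Lemma fps_mulDl : left_distributive fps_mul +%R.
Proof.
move=> f g h; apply/fpsP => n /=; rewrite -big_split.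
by apply: eq_bigr => i _; rewrite mulrDl.
Qed.

Lemma fps_mulDr : right_distributive fps_mul +%R.
Proof.
move=> f g h; apply/fpsP => n /=; rewrite -big_split.
by apply: eq_bigr => i _; rewrite mulrDr.
Qed.

Lemma fps_oner_neq0 : fps_one != 0.
Proof. by apply/eqP => /fpsP /(_ 0%N) /eqP; rewrite oner_eq0. Qed.

HB.instance Definition _ := GRing.Zmodule_isNzRing.Build (fps A)
  fps_mulA fps_mul1l fps_mul1r fps_mulDl fps_mulDr fps_oner_neq0.

Definition fps_scale (c : K) f := Fps (fun n => c *: fcoef f n).

Lemma fps_scaleA a b f : fps_scale a (fps_scale b f) = fps_scale (a * b) f.
Proof. by apply/fpsP => n /=; rewrite scalerA. Qed.
Lemma fps_scale1 : left_id 1 fps_scale.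
Proof. by move=> f; apply/fpsP => n /=; rewrite scale1r. Qed.
Lemma fps_scaleDr : right_distributive fps_scale +%R.
Proof. by move=> c f g; apply/fpsP => n /=; rewrite scalerDr. Qed.
Lemma fps_scaleDl f : {morph fps_scale^~ f : a b / a + b}.
Proof. by move=> a b; apply/fpsP => n /=; rewrite scalerDl. Qed.

HB.instance Definition _ := GRing.Zmodule_isLmodule.Build K (fps A)
  fps_scaleA fps_scale1 fps_scaleDr fps_scaleDl.

Lemma fps_scalerAl (c : K) f g : c *: (f * g) = (c *: f) * g.
Proof.
apply/fpsP => n /=; rewrite scaler_sumr.
by apply: eq_bigr => i _; rewrite scalerAl.
Qed.

HB.instance Definition _ := GRing.Lmodule_isLalgebra.Build K (fps A) fps_scalerAl.

Lemma fps_scalerAr (c : K) f g : c *: (f * g) = f * (c *: g).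
Proof.
apply/fpsP => n /=; rewrite scaler_sumr.
by apply: eq_bigr => i _; rewrite scalerAr.
Qed.

HB.instance Definition _ := GRing.Lalgebra_isAlgebra.Build K (fps A) fps_scalerAr.

Definition fps_unit : pred (fps A) :=
  fun f => `[< exists g, g * f = 1 /\ f * g = 1 >].

Definition fps_inv f : fps A :=
  if pselect (exists g, g * f = 1 /\ f * g = 1) is left e
  then projT1 (cid e) else f.

Lemma fps_mulVr : {in fps_unit, left_inverse 1 fps_inv *%R}.
Proof.
move=> f /asboolP fu; rewrite /fps_inv.
by case: pselect => // e; case: cid => g [].
Qed.

Lemma fps_divrr : {in fps_unit, right_inverse 1 fps_inv *%R}.
Proof.
move=> f /asboolP fu; rewrite /fps_inv.
by case: pselect => // e; case: cid => g [].
Qed.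

Lemma fps_unitrP f g : g * f = 1 /\ f * g = 1 -> fps_unit f.
Proof. by move=> fg; apply/asboolP; exists g. Qed.

Lemma fps_invr_out : {in [predC fps_unit], fps_inv =1 id}.
Proof.
move=> f /asboolP fu; rewrite /fps_inv.
by case: pselect.
Qed.

HB.instance Definition _ := GRing.NzRing_hasMulInverse.Build (fps A)
  fps_mulVr fps_divrr fps_unitrP fps_invr_out.

Lemma fcoefD f g n : fcoef (f + g) n = fcoef f n + fcoef g n.
Proof. by []. Qed.

Lemma fcoefN f n : fcoef (- f) n = - fcoef f n.
Proof. by []. Qed.

Lemma fcoefZ (c : K) f n : fcoef (c *: f) n = c *: fcoef f n.
Proof. by []. Qed.

Lemma fcoef0 n : fcoef (0 : fps A) n = 0.
Proof. by []. Qed.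

Lemma fcoef1 n : fcoef (1 : fps A) n = if n == 0%N then 1 else 0.
Proof. by []. Qed.

Lemma fcoefM f g n :
  fcoef (f * g) n = \sum_(i < n.+1) fcoef f i * fcoef g (n - i)%N.
Proof. by []. Qed.

Lemma fcoef_sum (I : Type) (r : seq I) (P : pred I) (F : I -> fps A) n :
  fcoef (\sum_(i <- r | P i) F i) n = \sum_(i <- r | P i) fcoef (F i) n.
Proof. by elim/big_rec2: _ => // i x y _ <-. Qed.

Lemma fcoefX_lt f k n : fcoef f 0%N = 0 -> (n < k)%N -> fcoef (f ^+ k) n = 0.
Proof.
move=> f0; elim: k n => // k IHk n lnk; rewrite exprS fcoefM big1 // => -[i lin] _.
rewrite /=; case: i lin => [|i] lin; first by rewrite f0 mul0r.
by rewrite IHk ?mulr0 // subnS -ltnS; case: n lin lnk => // n; lia.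
Qed.

Lemma fps_unit_coef0 f : fcoef f 0%N = 1 -> f \is a GRing.unit.
Proof.
move=> f0; pose u := 1 - f.
have u0 : fcoef u 0%N = 0 by rewrite fcoefD fcoefN f0 fcoef1 subrr.
pose g := Fps (fun n => \sum_(k < n.+1) fcoef (u ^+ k) n).
have gE n i : (i <= n)%N -> fcoef g i = fcoef (\sum_(k < n.+1) u ^+ k) i.
  move=> lin; rewrite fcoef_sum /= (@big_ord_widen _ _ _ i.+1 n.+1 (fun k => fcoef (u ^+ k) i) lin).
  rewrite big_mkcond; apply: eq_bigr => k _; case: ltnP => // lik.
  by rewrite fcoefX_lt.
have fE : f = 1 - u by rewrite opprB addrCA subrr addr0.
apply/unitrP; exists g; split; apply/fpsP => n.
- transitivity (fcoef ((\sum_(k < n.+1) u ^+ k) * f) n).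
    rewrite !fcoefM; apply: eq_bigr => i _; congr (_ * _).
    by apply: gE; rewrite -ltnS.
  rewrite fE mulrBr mulr1 mulr_suml.
  under [X in _ - X]eq_bigr do rewrite -exprSr.
  rewrite big_ord_recl [X in _ - X]big_ord_recr /=.
  rewrite [X in _ - X]addrC opprD addrACA.
  rewrite [X in _ + X](_ : _ = 0) ?addr0 ?fcoefX_lt ?subr0 //.
  exact: subrr.
- transitivity (fcoef (f * (\sum_(k < n.+1) u ^+ k)) n).
    rewrite !fcoefM; apply: eq_bigr => i _; congr (_ * _).
    by apply: gE; rewrite leq_subr.
  rewrite fE mulrBl mul1r mulr_sumr.
  under [X in _ - X]eq_bigr do rewrite -exprS.
  rewrite big_ord_recl [X in _ - X]big_ord_recr /=.
  rewrite [X in _ - X]addrC opprD addrACA.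
  rewrite [X in _ + X](_ : _ = 0) ?addr0 ?fcoefX_lt ?subr0 //.
  exact: subrr.
Qed.

End FpsAlgebra.

Section FpsOperations.
Variables (K : fieldType) (A B : algType K).

(** [fps_mono n a] is [a t^n]. *)
Definition fps_mono (n : nat) (a : A) : fps A :=
  Fps (fun k => if k == n then a else 0).

Definition fps_map (phi : A -> B) (f : fps A) : fps B :=
  Fps (fun n => phi (fcoef f n)).

(** The continuous [K[[t]]]-linear extension of a [K]-linear map
    [phi : A -> B[[t]]], that is, [sum_n f_n t^n |-> sum_n phi(f_n) t^n]. *)
Definition fps_ext (phi : A -> fps B) (f : fps A) : fps B :=
  Fps (fun n => \sum_(i < n.+1) fcoef (phi (fcoef f i)) (n - i)%N).

Definition fps_tensor (f : fps A) (g : fps B) : fps (tensor A B) :=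
  Fps (fun n => \sum_(i < n.+1) tpure (fcoef f i) (fcoef g (n - i)%N)).

Definition qint (p : K) (k : nat) : K := (1 - p ^+ k) / (1 - p).

Definition qfact (p : K) (n : nat) : K := \prod_(1 <= k < n.+1) qint p k.

(** [sum_n x^n / (n)_p!] for [x] in [t A[[t]]]: the powers [x^k] with [n < k]
    do not contribute to the coefficient of [t^n] ([fcoefX_lt]). *)
Definition qexp (p : K) (x : fps A) : fps A :=
  Fps (fun n => \sum_(k < n.+1) (qfact p k)^-1 *: fcoef (x ^+ k) n).

Lemma qexp_unit (p : K) (x : fps A) : qexp p x \is a GRing.unit.
Proof.
apply: fps_unit_coef0; rewrite /= big_ord1 /qfact big_geq //.
by rewrite invr1 scale1r expr0.
Qed.

End FpsOperations.

Notation "a ⊗ b" := (tpure a b) (at level 40, left associativity).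
Notation "f ⊗t g" := (fps_tensor f g) (at level 40, left associativity).

(** * Twists *)

Section Twist.
Variables (K : fieldType) (A : algType K).
Local Notation A2 := (tensor A A).
Local Notation A3 := (tensor A2 A).

(** [A (x) A (x) A] is encoded as [(A (x) A) (x) A]; [tassoc] is the
    identification of [A (x) (A (x) A)] with it. *)
Definition tassoc : tensor A A2 -> A3 :=
  tlift (fun a => tlift (fun b c => (a ⊗ b) ⊗ c)).

Lemma tassoc_balr a : balanced (fun b c => (a ⊗ b) ⊗ c : A3).
Proof.
split=> [b b' c|b c c'|k b c|c].
- by rewrite tpureDr tpureDl.
- by rewrite tpureDr.
- by rewrite tpureZr tpure_bal.
- by rewrite tpure0r tpure0l.
Qed.

Lemma tassoc_bal :
  balanced (fun a => tlift (fun b c => (a ⊗ b) ⊗ c) : A2 -> A3).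
Proof.
have liftE a b c : tlift (fun b c => (a ⊗ b) ⊗ c : A3) (b ⊗ c) = (a ⊗ b) ⊗ c.
  by rewrite tlift_pure //; exact: tassoc_balr.
have liftD a x y : tlift (fun b c => (a ⊗ b) ⊗ c : A3) (x + y) =
    tlift (fun b c => (a ⊗ b) ⊗ c) x + tlift (fun b c => (a ⊗ b) ⊗ c) y.
  by rewrite tliftD //; exact: tassoc_balr.
have lift0 a : tlift (fun b c => (a ⊗ b) ⊗ c : A3) 0 = 0.
  by rewrite tlift0 //; exact: tassoc_balr.
split.
- move=> a a'; elim/tensor_ind => [|x y IHx IHy|b c].
  + by rewrite !lift0 addr0.
  + by rewrite !liftD IHx IHy addrACA.
  + by rewrite !liftE !tpureDl.
- by move=> a x y; rewrite liftD.
- move=> k a; elim/tensor_ind => [|x y IHx IHy|b c].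
  + by rewrite scaler0 !lift0.
  + by rewrite scalerDr !liftD IHx IHy.
  + by rewrite -tpureZl !liftE tpure_bal.
- elim/tensor_ind => [|x y IHx IHy|b c].
  + by rewrite lift0.
  + by rewrite liftD IHx IHy addr0.
  + by rewrite liftE !tpure0l.
Qed.

Lemma tassocE a b c : tassoc (a ⊗ (b ⊗ c)) = (a ⊗ b) ⊗ c.
Proof.
by rewrite /tassoc !tlift_pure //; [exact: tassoc_balr|exact: tassoc_bal].
Qed.

Definition leg12 (x : A2) : A3 := x ⊗ 1.

Definition leg23 (x : A2) : A3 := tassoc (1 ⊗ x).

(** A coproduct on [A[[t]]] is a [K[[t]]]-linear continuous map
    [D : A[[t]] -> (A (x) A)[[t]]], hence is determined by its values on the
    constant series [fps_mono 0 a]. *)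
Definition cop_id (D : fps A -> fps A2) : fps A2 -> fps A3 :=
  fps_ext (tlift (fun a b => D (fps_mono 0 a) ⊗t fps_mono 0 b)).

Definition id_cop (D : fps A -> fps A2) : fps A2 -> fps A3 :=
  fps_ext (tlift (fun a b =>
    fps_map tassoc (fps_mono 0 a ⊗t D (fps_mono 0 b)))).

Definition counit_id (e : A -> K) : fps A2 -> fps A :=
  fps_map (tlift (fun a b => e a *: b)).

Definition id_counit (e : A -> K) : fps A2 -> fps A :=
  fps_map (tlift (fun a b => e b *: a)).

Definition is_twist (D : fps A -> fps A2) (e : A -> K) (F : fps A2) : Prop :=
  [/\ fps_map leg12 F * cop_id D F = fps_map leg23 F * id_cop D F,
      counit_id e F = 1 & id_counit e F = 1].

End Twist.

(** * Algebras presented by generators and relations *)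

Section Presentation.
Variables (K : fieldType) (G : Type).

(** Noncommutative polynomial expressions in the generators. *)
Inductive pterm : Type :=
| PGen of G
| PSca of K
| PAdd of pterm & pterm
| PMul of pterm & pterm.

HB.instance Definition _ := gen_eqMixin pterm.
HB.instance Definition _ := gen_choiceMixin pterm.

Variable rel : pterm -> pterm -> Prop.

(** The smallest congruence which contains [rel] and makes the quotient
    an associative unital [K]-algebra. *)
Inductive pcong : pterm -> pterm -> Prop :=
| pcong_refl x : pcong x x
| pcong_sym x y : pcong x y -> pcong y x
| pcong_trans x y z : pcong x y -> pcong y z -> pcong x z
| pcong_add x x' y y' : pcong x x' -> pcong y y' -> pcong (PAdd x y) (PAdd x' y')
| pcong_mul x x' y y' : pcong x x' -> pcong y y' -> pcong (PMul x y) (PMul x' y')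
| pcong_addA x y z : pcong (PAdd x (PAdd y z)) (PAdd (PAdd x y) z)
| pcong_addC x y : pcong (PAdd x y) (PAdd y x)
| pcong_add0 x : pcong (PAdd (PSca 0) x) x
| pcong_mulA x y z : pcong (PMul x (PMul y z)) (PMul (PMul x y) z)
| pcong_mul1 x : pcong (PMul (PSca 1) x) x
| pcong_mulDl x y z :
    pcong (PMul (PAdd x y) z) (PAdd (PMul x z) (PMul y z))
| pcong_mulDr x y z :
    pcong (PMul x (PAdd y z)) (PAdd (PMul x y) (PMul x z))
| pcong_scaD a b : pcong (PSca (a + b)) (PAdd (PSca a) (PSca b))
| pcong_scaM a b : pcong (PSca (a * b)) (PMul (PSca a) (PSca b))
| pcong_scaC a x : pcong (PMul (PSca a) x) (PMul x (PSca a))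
| pcong_sca0 x : pcong (PMul (PSca 0) x) (PSca 0)
| pcong_rel x y : rel x y -> pcong x y.

Definition pcongb : ssrbool.rel pterm := fun x y => `[< pcong x y >].

Lemma pcongb_refl : reflexive pcongb.
Proof. by move=> x; apply/asboolP/pcong_refl. Qed.

Lemma pcongb_sym : symmetric pcongb.
Proof. by move=> x y; apply/asboolP/asboolP => /pcong_sym. Qed.

Lemma pcongb_trans : transitive pcongb.
Proof.
move=> x y z /asboolP h1 /asboolP h2.
by apply/asboolP; exact: pcong_trans h1 h2.
Qed.

Canonical pcong_equiv := EquivRel pcongb pcongb_refl pcongb_sym pcongb_trans.

Definition presented := {eq_quot pcongb}.
HB.instance Definition _ := Choice.on presented.
HB.instance Definition _ : EqQuotient _ pcongb presented :=
  EqQuotient.on presented.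

Lemma pi_presP (x y : pterm) : \pi_presented x = \pi_presented y <-> pcong x y.
Proof. by split=> [/eqquotP/asboolP //|h]; apply/eqquotP/asboolP. Qed.

Lemma pi_pres_surj (u : presented) : exists x, u = \pi_presented x.
Proof. by exists (repr u); rewrite reprK. Qed.

Lemma repr_pres (x : pterm) : pcong (repr (\pi_presented x)) x.
Proof. by apply/pi_presP; rewrite reprK. Qed.

Definition pres_add (u v : presented) : presented :=
  \pi_presented (PAdd (repr u) (repr v)).
Definition pres_mul (u v : presented) : presented :=
  \pi_presented (PMul (repr u) (repr v)).

Lemma pres_addE x y :
  pres_add (\pi_presented x) (\pi_presented y) = \pi_presented (PAdd x y).
Proof. by apply/pi_presP; apply: pcong_add; apply: repr_pres. Qed.

Lemma pres_mulE x y :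
  pres_mul (\pi_presented x) (\pi_presented y) = \pi_presented (PMul x y).
Proof. by apply/pi_presP; apply: pcong_mul; apply: repr_pres. Qed.

Definition pres_opp (u : presented) : presented :=
  pres_mul (\pi_presented (PSca (-1))) u.
Definition pres_zero : presented := \pi_presented (PSca 0).
Definition pres_one : presented := \pi_presented (PSca 1).
Definition pres_scale (c : K) (u : presented) : presented :=
  pres_mul (\pi_presented (PSca c)) u.

Lemma pres_addA : associative pres_add.
Proof.
move=> u v w; have [x ->] := pi_pres_surj u.
have [y ->] := pi_pres_surj v; have [z ->] := pi_pres_surj w.
by rewrite !pres_addE; apply/pi_presP; exact: pcong_addA.
Qed.

Lemma pres_addC : commutative pres_add.
Proof.
move=> u v; have [x ->] := pi_pres_surj u; have [y ->] := pi_pres_surj v.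
by rewrite !pres_addE; apply/pi_presP; exact: pcong_addC.
Qed.

Lemma pres_add0 : left_id pres_zero pres_add.
Proof.
move=> u; have [x ->] := pi_pres_surj u.
by rewrite pres_addE; apply/pi_presP; exact: pcong_add0.
Qed.

Lemma pres_mulDl : left_distributive pres_mul pres_add.
Proof.
move=> u v w; have [x ->] := pi_pres_surj u.
have [y ->] := pi_pres_surj v; have [z ->] := pi_pres_surj w.
by rewrite !(pres_addE, pres_mulE); apply/pi_presP; exact: pcong_mulDl.
Qed.

Lemma pres_mulDr : right_distributive pres_mul pres_add.
Proof.
move=> u v w; have [x ->] := pi_pres_surj u.
have [y ->] := pi_pres_surj v; have [z ->] := pi_pres_surj w.
by rewrite !(pres_addE, pres_mulE); apply/pi_presP; exact: pcong_mulDr.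
Qed.

Lemma pres_mulA : associative pres_mul.
Proof.
move=> u v w; have [x ->] := pi_pres_surj u.
have [y ->] := pi_pres_surj v; have [z ->] := pi_pres_surj w.
by rewrite !pres_mulE; apply/pi_presP; exact: pcong_mulA.
Qed.

Lemma pres_mul1l : left_id pres_one pres_mul.
Proof.
move=> u; have [x ->] := pi_pres_surj u.
by rewrite pres_mulE; apply/pi_presP; exact: pcong_mul1.
Qed.

Lemma pres_scaC c u :
  pres_mul (\pi_presented (PSca c)) u = pres_mul u (\pi_presented (PSca c)).
Proof.
have [x ->] := pi_pres_surj u.
by rewrite !pres_mulE; apply/pi_presP; exact: pcong_scaC.
Qed.

Lemma pres_mul1r : right_id pres_one pres_mul.
Proof. by move=> u; rewrite -pres_scaC; exact: pres_mul1l. Qed.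

Lemma pres_scaD a b : \pi_presented (PSca (a + b)) =
  pres_add (\pi_presented (PSca a)) (\pi_presented (PSca b)).
Proof. by rewrite pres_addE; apply/pi_presP; exact: pcong_scaD. Qed.

Lemma pres_scaM a b : \pi_presented (PSca (a * b)) =
  pres_mul (\pi_presented (PSca a)) (\pi_presented (PSca b)).
Proof. by rewrite pres_mulE; apply/pi_presP; exact: pcong_scaM. Qed.

Lemma pres_addN : left_inverse pres_zero pres_opp pres_add.
Proof.
move=> u; rewrite /pres_opp -[X in pres_add _ X]pres_mul1l -pres_mulDl.
rewrite -pres_scaD addNr; have [x ->] := pi_pres_surj u.
by rewrite pres_mulE; apply/pi_presP; exact: pcong_sca0.
Qed.

HB.instance Definition _ := GRing.isZmodule.Build presented
  pres_addA pres_addC pres_add0 pres_addN.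
HB.instance Definition _ := GRing.Zmodule_isPzRing.Build presented
  pres_mulA pres_mul1l pres_mul1r pres_mulDl pres_mulDr.

Lemma pres_scaleA a b u :
  pres_scale a (pres_scale b u) = pres_scale (a * b) u.
Proof. by rewrite /pres_scale pres_mulA -pres_scaM. Qed.

Lemma pres_scaleDl u : {morph pres_scale^~ u : a b / a + b}.
Proof. by move=> a b; rewrite /pres_scale pres_scaD pres_mulDl. Qed.

HB.instance Definition _ := GRing.Zmodule_isLmodule.Build K presented
  pres_scaleA pres_mul1l (fun c => pres_mulDr (\pi_presented (PSca c)))
  pres_scaleDl.

Lemma pres_scalerAl c (u v : presented) : c *: (u * v) = (c *: u) * v.
Proof. exact: pres_mulA. Qed.

Lemma pres_scalerAr c (u v : presented) : c *: (u * v) = u * (c *: v).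
Proof.
rewrite pres_scalerAl [u * _]pres_mulA; congr (_ * v).
exact: pres_scaC.
Qed.

Definition pgen (g : G) : presented := \pi_presented (PGen g).

Section Lift.
Variables (A : algType K) (phi : G -> A).

Fixpoint peval (x : pterm) : A :=
  match x with
  | PGen g => phi g
  | PSca c => c *: 1
  | PAdd x y => peval x + peval y
  | PMul x y => peval x * peval y
  end.

(** The algebra morphism that maps the generator [g] to [phi g]; it does not
    depend on representatives when [phi] satisfies the relations. *)
Definition plift (u : presented) : A := peval (repr u).

Hypothesis phi_rel : forall x y, rel x y -> peval x = peval y.

Lemma peval_cong x y : pcong x y -> peval x = peval y.
Proof.
elim=> {x y} //=.
- by move=> x y z _ -> _ ->.
- by move=> x x' y y' _ -> _ ->.
- by move=> x x' y y' _ -> _ ->.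
- by move=> *; rewrite addrA.
- by move=> *; rewrite addrC.
- by move=> *; rewrite scale0r add0r.
- by move=> *; rewrite mulrA.
- by move=> *; rewrite scale1r mul1r.
- by move=> *; rewrite mulrDl.
- by move=> *; rewrite mulrDr.
- by move=> *; rewrite scalerDl.
- by move=> *; rewrite -scalerAl mul1r scalerA.
- by move=> *; rewrite -scalerAl mul1r -scalerAr mulr1.
- by move=> *; rewrite !scale0r mul0r.
Qed.

Lemma plift_pi x : plift (\pi_presented x) = peval x.
Proof. by apply: peval_cong; apply: repr_pres. Qed.

Lemma plift_gen g : plift (pgen g) = phi g.
Proof. exact: plift_pi. Qed.

Lemma pliftD : {morph plift : u v / u + v}.
Proof.
move=> u v; have [x ->] := pi_pres_surj u; have [y ->] := pi_pres_surj v.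
by rewrite [\pi_presented x + _]pres_addE !plift_pi.
Qed.

Lemma pliftM : {morph plift : u v / u * v}.
Proof.
move=> u v; have [x ->] := pi_pres_surj u; have [y ->] := pi_pres_surj v.
by rewrite [\pi_presented x * _]pres_mulE !plift_pi.
Qed.

Lemma plift1 : plift 1 = 1.
Proof. by rewrite [LHS]plift_pi /= scale1r. Qed.

Lemma plift0 : plift 0 = 0.
Proof. by rewrite [LHS]plift_pi /= scale0r. Qed.

Lemma pliftZ c : {morph plift : u / c *: u}.
Proof.
move=> u; have [x ->] := pi_pres_surj u.
by rewrite [c *: \pi_presented x]pres_mulE !plift_pi /= -scalerAl mul1r.
Qed.

End Lift.

End Presentation.

(** * The Hopf algebra U'_q(sl_3) *)

Definition i1 : 'I_2 := ord0.
Definition i2 : 'I_2 := ord_max.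

Lemma ord2P (i : 'I_2) : i = i1 \/ i = i2.
Proof.
by case: i => [[|[|//]] lti]; [left|right]; apply: val_inj.
Qed.

Inductive uq_gen : Type :=
| Ge of 'I_2 | Gf of 'I_2 | GL of 'I_2 | GLinv of 'I_2.

Section UqRelations.
Variables (K : fieldType) (q : K).
Local Notation term := (pterm K uq_gen).

Local Notation "x +' y" := (PAdd x y) (at level 50, left associativity).
Local Notation "x *' y" := (PMul x y) (at level 40, left associativity).
Local Notation "c *:' x" := (PMul (PSca _ c) x) (at level 40).
Local Notation "x -' y" := (x +' ((- 1) *:' y)) (at level 50, left associativity).
Local Notation e := (fun i => PGen K (Ge i)).
Local Notation f := (fun i => PGen K (Gf i)).
Local Notation L := (fun i => PGen K (GL i)).
Local Notation L' := (fun i => PGen K (GLinv i)).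

(** [k_i = L_i^2 L_j^-1], with [j] the index other than [i]. *)
Definition kterm (i : 'I_2) : term := L i *' L i *' L' (rev_ord i).
Definition kinvterm (i : 'I_2) : term := L' i *' L' i *' L (rev_ord i).

Definition serre_term (x y : term) : term :=
  x *' x *' y -' (q + q^-1) *:' (x *' y *' x) +' y *' x *' x.

Inductive uq_rel : term -> term -> Prop :=
| uq_LL i j : uq_rel (L i *' L j) (L j *' L i)
| uq_LLinv i : uq_rel (L i *' L' i) (PSca _ 1)
| uq_LinvL i : uq_rel (L' i *' L i) (PSca _ 1)
| uq_Le i j : uq_rel (L i *' e j *' L' i) (q ^+ (i == j) *:' e j)
| uq_Lf i j : uq_rel (L i *' f j *' L' i) (q ^- (i == j) *:' f j)
| uq_ef i j : uq_rel (e i *' f j -' f j *' e i)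
    (((i == j)%:R / (q - q^-1)) *:' (kterm i -' kinvterm i))
| uq_serre_e i j : i != j -> uq_rel (serre_term (e i) (e j)) (PSca _ 0)
| uq_serre_f i j : i != j -> uq_rel (serre_term (f i) (f j)) (PSca _ 0).

Definition Uq : Type := presented uq_rel.
HB.instance Definition _ := GRing.PzRing.on Uq.
HB.instance Definition _ := GRing.Lmodule.on Uq.

Definition counit_gen (g : uq_gen) : K^o :=
  match g with Ge _ | Gf _ => 0 | GL _ | GLinv _ => 1 end.

Lemma counit_rel x y :
  uq_rel x y -> peval counit_gen x = peval counit_gen y.
Proof.
case=> {x y} *; rewrite /= ?(mulr0, mul0r, mulr1, mul1r, subrr, addr0,
  scaler0, scale1r, scale0r) //.
by rewrite -scalerAl mul1r scaleN1r subrr scaler0.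
Qed.

Lemma Uq_oner_neq0 : (1 : Uq) != 0.
Proof.
apply/eqP => /(congr1 (plift counit_gen)).
rewrite (plift1 counit_rel) (plift0 counit_rel) => /eqP.
by rewrite oner_eq0.
Qed.

HB.instance Definition _ := GRing.PzSemiRing_isNonZero.Build Uq Uq_oner_neq0.
HB.instance Definition _ := GRing.Lmodule_isLalgebra.Build K Uq
  (@pres_scalerAl K uq_gen uq_rel).
HB.instance Definition _ := GRing.Lalgebra_isAlgebra.Build K Uq
  (@pres_scalerAr K uq_gen uq_rel).

End UqRelations.

Section UqTheory.
Variables (K : fieldType) (q : K).
Local Notation U := (Uq q).
Local Notation UU := (tensor U U).

Definition ue (i : 'I_2) : U := pgen (uq_rel q) (Ge i).
Definition uf (i : 'I_2) : U := pgen (uq_rel q) (Gf i).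
Definition uL (i : 'I_2) : U := pgen (uq_rel q) (GL i).
Definition uLinv (i : 'I_2) : U := pgen (uq_rel q) (GLinv i).
Definition uk (i : 'I_2) : U := uL i ^+ 2 * uLinv (rev_ord i).
Definition ukinv (i : 'I_2) : U := uLinv i ^+ 2 * uL (rev_ord i).

Lemma pi_Uq (x : pterm K uq_gen) :
  \pi_(presented (uq_rel q)) x = peval (pgen (uq_rel q) : uq_gen -> U) x :> U.
Proof.
elim: x => [g|c|x IHx y IHy|x IHx y IHy] //=.
- by rewrite -[LHS](@pres_mul1r K uq_gen (uq_rel q)).
- by rewrite -IHx -IHy -(@pres_addE K uq_gen (uq_rel q)).
- by rewrite -IHx -IHy -(@pres_mulE K uq_gen (uq_rel q)).
Qed.

Lemma Uq_rel x y : uq_rel q x y ->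
  peval (pgen (uq_rel q) : uq_gen -> U) x =
  peval (pgen (uq_rel q) : uq_gen -> U) y.
Proof. by move=> xy; rewrite -!pi_Uq; apply/pi_presP; exact: pcong_rel. Qed.

Lemma uLL i j : uL i * uL j = uL j * uL i.
Proof. exact: (Uq_rel (uq_LL q i j)). Qed.

Lemma uLLinv i : uL i * uLinv i = 1.
Proof. by have := Uq_rel (uq_LLinv q i); rewrite /= scale1r. Qed.

Lemma uLinvL i : uLinv i * uL i = 1.
Proof. by have := Uq_rel (uq_LinvL q i); rewrite /= scale1r. Qed.

Lemma uLe i j : uL i * ue j * uLinv i = q ^+ (i == j) *: ue j.
Proof. by have := Uq_rel (uq_Le q i j); rewrite /= -scalerAl mul1r. Qed.

Lemma uLf i j : uL i * uf j * uLinv i = q ^- (i == j) *: uf j.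
Proof. by have := Uq_rel (uq_Lf q i j); rewrite /= -scalerAl mul1r. Qed.

Lemma uef i j : ue i * uf j - uf j * ue i =
  ((i == j)%:R / (q - q^-1)) *: (uk i - ukinv i).
Proof.
have := Uq_rel (uq_ef q i j).
by rewrite /= -!scalerAl !mul1r !scaleN1r /uk /ukinv !expr2.
Qed.

Lemma userre_e i j : i != j -> ue i ^+ 2 * ue j
  - (q + q^-1) *: (ue i * ue j * ue i) + ue j * ue i ^+ 2 = 0.
Proof.
move=> ij; have := Uq_rel (uq_serre_e q ij).
by rewrite /= -!scalerAl !mul1r !scaleN1r scale0r !expr2 !mulrA.
Qed.

Lemma userre_f i j : i != j -> uf i ^+ 2 * uf j
  - (q + q^-1) *: (uf i * uf j * uf i) + uf j * uf i ^+ 2 = 0.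
Proof.
move=> ij; have := Uq_rel (uq_serre_f q ij).
by rewrite /= -!scalerAl !mul1r !scaleN1r scale0r !expr2 !mulrA.
Qed.

Definition counit : U -> K := plift (counit_gen K).

Definition cop_gen (g : uq_gen) : UU :=
  match g with
  | Ge i =>
      if i == i1 then (uLinv i1 ^+ 2 * uL i2 ^+ 2) ⊗ ue i1 + ue i1 ⊗ 1
      else (uL i1 * uLinv i2 ^+ 2) ⊗ ue i2 + ue i2 ⊗ uL i1
  | Gf i =>
      if i == i1 then uf i1 ⊗ (uL i1 ^+ 2 * uLinv i2) + uLinv i2 ⊗ uf i1
      else uf i2 ⊗ (uLinv i1 ^+ 2 * uL i2 ^+ 2) + 1 ⊗ uf i2
  | GL i => uL i ⊗ uL i
  | GLinv i => uLinv i ⊗ uLinv i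
  end.

(** Well defined for [q != 0] by [cop_rel] below. *)
Definition coproduct : U -> UU := plift cop_gen.

End UqTheory.

Section QCommutation.
Variable K : fieldType.

Definition qcomm (A : algType K) (c : K) (x y : A) : Prop :=
  x * y = c *: (y * x).

Section Basic.
Variable A : algType K.
Implicit Types x y z w : A.

Lemma qcomm_eq c c' x y : qcomm c x y -> c = c' -> qcomm c' x y.
Proof. by move=> h <-. Qed.

Lemma qcomm1l x : qcomm 1 1 x.
Proof. by rewrite /qcomm mul1r mulr1 scale1r. Qed.

Lemma qcomm1r x : qcomm 1 x 1.
Proof. by rewrite /qcomm mul1r mulr1 scale1r. Qed.

Lemma qcommMl c d x x' y : qcomm c x y -> qcomm d x' y ->
  qcomm (c * d) (x * x') y.
Proof.
rewrite /qcomm => xy x'y.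
by rewrite -(mulrA x x') x'y -scalerAr (mulrA x) xy -scalerAl scalerA -(mulrA y x)
  [c * d]mulrC.
Qed.

Lemma qcommMr c d x y y' : qcomm c x y -> qcomm d x y' ->
  qcomm (c * d) x (y * y').
Proof.
rewrite /qcomm => xy xy'.
by rewrite (mulrA x) xy -scalerAl -(mulrA y x) xy' -scalerAr scalerA (mulrA y).
Qed.

Lemma qcomm_sym c x y : c != 0 -> qcomm c x y -> qcomm c^-1 y x.
Proof. by rewrite /qcomm => c0 ->; rewrite scalerA mulVf // scale1r. Qed.

Lemma qcomm_conj c x x' y : x' * x = 1 -> x * y * x' = c *: y -> qcomm c x y.
Proof.
by move=> x'x xyx'; rewrite /qcomm scalerAl -xyx' -(mulrA (x * y)) x'x mulr1.
Qed.

Lemma qcomm_inv c x x' y : c != 0 -> x * x' = 1 -> x' * x = 1 ->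
  qcomm c x y -> qcomm c^-1 x' y.
Proof.
rewrite /qcomm => c0 xx' x'x xy.
have -> : y * x' = c *: (x' * y).
  by rewrite -[y in LHS]mul1r -x'x -[x' * x * y]mulrA xy -scalerAr -scalerAl
    -!mulrA xx' mulr1.
by rewrite scalerA mulVf // scale1r.
Qed.

Definition serre (q : K) x z : A :=
  x ^+ 2 * z - (q + q^-1) *: (x * z * x) + z * x ^+ 2.

Lemma serreDr (q : K) x z w : serre q x (z + w) = serre q x z + serre q x w.
Proof.
rewrite /serre !mulrDr !mulrDl scalerDr opprD.
by rewrite (AC (2*2*2) ((1*3*5)*(2*4*6))).
Qed.

Definition serre_mixed (q : K) x y z : A :=
  (x * y + y * x) * z - (q + q^-1) *: (x * z * y + y * z * x)
  + z * (x * y + y * x).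

Lemma serreDl (q : K) x y z :
  serre q (x + y) z = serre q x z + serre q y z + serre_mixed q x y z.
Proof.
have E : (x + y) ^+ 2 = x ^+ 2 + y ^+ 2 + (x * y + y * x).
  by rewrite expr2 mulrDl !mulrDr -!expr2 (AC (2*2) ((1*4)*(2*3))).
have E' : (x + y) * z * (x + y) =
    x * z * x + y * z * y + (x * z * y + y * z * x).
  by rewrite !mulrDl !mulrDr (AC (2*2) ((1*4)*(2*3))).
rewrite /serre E E' /serre_mixed.
rewrite [in LHS](mulrDl (x ^+ 2 + y ^+ 2)) [in LHS](mulrDr z (x ^+ 2 + y ^+ 2)).
rewrite [in LHS](mulrDl (x ^+ 2)) [in LHS](mulrDr z (x ^+ 2)).
rewrite [in LHS](scalerDr _ (x * z * x + _)) [in LHS](scalerDr _ (x * z * x)).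
by rewrite !opprD (AC (3*3*3) ((1*4*7)*(2*5*8)*(3*6*9))).
Qed.

Lemma serre_qcommr (q : K) x z : q != 0 -> qcomm q x z -> serre q x z = 0.
Proof.
move=> q0 xz; have x2z : qcomm (q ^+ 2) (x ^+ 2) z.
  by rewrite !expr2; exact: qcommMl.
rewrite /serre x2z xz -scalerAl -mulrA -expr2 scalerA.
rewrite -scaleNr -scalerDl -[X in _ + X]scale1r -scalerDl.
by rewrite (_ : _ + 1 = 0) ?scale0r //; field.
Qed.

Lemma serre_qcommVr (q : K) x z : q != 0 -> qcomm q^-1 x z -> serre q x z = 0.
Proof.
move=> q0 xz; have x2z : qcomm (q ^- 2) (x ^+ 2) z.
  by rewrite -exprVn !expr2; exact: qcommMl.
rewrite /serre x2z xz -scalerAl -mulrA -expr2 scalerA.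
rewrite -scaleNr -scalerDl -[X in _ + X]scale1r -scalerDl.
by rewrite (_ : _ + 1 = 0) ?scale0r //; field.
Qed.

Lemma serre_mixedl (q : K) x y z : q != 0 ->
  qcomm (q ^- 2) x y -> qcomm q^-1 y z -> serre_mixed q x y z = 0.
Proof.
move=> q0 xy yz; have zy : qcomm q z y.
  by rewrite -[q]invrK; apply: qcomm_sym; rewrite ?invr_eq0.
have e1 : x * y * z = q ^- 2 *: (y * x * z) by rewrite xy -scalerAl.
have e2 : x * z * y = q^-1 *: (y * x * z).
  rewrite -mulrA zy -scalerAr mulrA xy -scalerAl scalerA; congr (_ *: _).
  by field.
have e3 : z * (x * y) = q^-1 *: (y * z * x).
  rewrite xy -scalerAr mulrA zy -scalerAl scalerA; congr (_ *: _).
  by field.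
have e4 : z * (y * x) = q *: (y * z * x) by rewrite mulrA zy -scalerAl.
rewrite /serre_mixed mulrDl mulrDr e1 e2 e3 e4.
have lin2 c1 c2 c3 c4 c5 (m n : A) :
    c1 *: m + m - c2 *: (c3 *: m + n) + (c4 *: n + c5 *: n) =
    (c1 + 1 - c2 * c3) *: m + (c4 + c5 - c2) *: n.
  rewrite !scalerBl !scalerDl scale1r scalerDr scalerA opprD.
  by rewrite (AC (2*2*2) ((1*2*3)*(5*6*4))).
rewrite lin2 (_ : _ - _ = 0) ?scale0r ?add0r; last by field.
by rewrite (_ : _ - _ = 0) ?scale0r //; field.
Qed.

Lemma serre_mixedr (q : K) x y w : q != 0 ->
  qcomm (q ^- 2) x y -> qcomm q x w -> serre_mixed q x y w = 0.
Proof.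
move=> q0 xy xw; have wx : qcomm q^-1 w x by exact: qcomm_sym.
have e1 : x * y * w = q ^- 2 *: (y * x * w) by rewrite xy -scalerAl.
have e2 : y * w * x = q^-1 *: (y * x * w).
  by rewrite -mulrA wx -scalerAr mulrA.
have e3 : w * (y * x) = q ^+ 2 *: (w * (x * y)).
  by rewrite xy -scalerAr scalerA divff ?scale1r // expf_neq0.
have e4 : x * w * y = q *: (w * (x * y)) by rewrite xw -scalerAl mulrA.
rewrite /serre_mixed mulrDl mulrDr e1 e2 e3 e4.
have lin2 c1 c2 c3 c4 c5 (m n : A) :
    c1 *: m + m - c2 *: (c3 *: n + c4 *: m) + (n + c5 *: n) =
    (c1 + 1 - c2 * c4) *: m + (1 + c5 - c2 * c3) *: n.
  rewrite !scalerBl !scalerDl !scale1r scalerDr !scalerA opprD.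
  by rewrite (AC (2*2*2) ((1*2*4)*(5*6*3))).
rewrite lin2 (_ : _ - _ = 0) ?scale0r ?add0r; last by field.
by rewrite (_ : _ - _ = 0) ?scale0r //; field.
Qed.

Lemma serreD (q : K) x y z w : q != 0 ->
  serre q x z = 0 -> serre q y w = 0 ->
  qcomm (q ^- 2) x y -> qcomm q^-1 y z -> qcomm q x w ->
  serre q (x + y) (z + w) = 0.
Proof.
move=> q0 sxz syw xy yz xw; rewrite serreDr !serreDl sxz syw.
rewrite (serre_qcommr q0 xw) (serre_qcommVr q0 yz).
by rewrite (serre_mixedl q0 xy yz) (serre_mixedr q0 xy xw) !addr0.
Qed.

Lemma comm_sum (x y z w : A) : x * z = z * x -> y * w = w * y ->
  (x + y) * (z + w) - (z + w) * (x + y) = (x * w - w * x) + (y * z - z * y).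
Proof.
move=> xz yw; rewrite !mulrDl !mulrDr xz yw !opprD.
rewrite (AC ((2*2)*(2*2)) ((1*5)*(4*8)*((2*7)*(3*6)))).
by rewrite /= !subrr !add0r.
Qed.

End Basic.

Lemma qcomm_tensor (A B : algType K) c d (a a' : A) (b b' : B) :
  qcomm c a a' -> qcomm d b b' -> qcomm (c * d) (a ⊗ b) (a' ⊗ b').
Proof.
by rewrite /qcomm !tpureM => -> ->; rewrite tpureZl tpureZr scalerA.
Qed.

End QCommutation.

Section CoproductWellDefined.
Variables (K : fieldType) (q : K).
Hypothesis q0 : q != 0.
Local Notation U := (Uq q).
Local Notation UU := (tensor U U).
Local Notation e := (ue q).
Local Notation f := (uf q).
Local Notation L := (uL q).
Local Notation L' := (uLinv q).

Lemma qLL i j : qcomm 1 (L i) (L j).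
Proof. by rewrite /qcomm scale1r uLL. Qed.

Lemma qLinvL i j : qcomm 1 (L' i) (L j).
Proof.
apply: (qcomm_eq (qcomm_inv _ (uLLinv q i) (uLinvL q i) (qLL i j))).
  exact: oner_neq0.
by rewrite invr1.
Qed.

Lemma qLLinv i j : qcomm 1 (L i) (L' j).
Proof. by rewrite -[1]invr1; apply: qcomm_sym (qLinvL j i); exact: oner_neq0. Qed.

Lemma qLinvLinv i j : qcomm 1 (L' i) (L' j).
Proof.
apply: (qcomm_eq (qcomm_inv _ (uLLinv q i) (uLinvL q i) (qLLinv i j))).
  exact: oner_neq0.
by rewrite invr1.
Qed.

Lemma qLe i j : qcomm (q ^+ (i == j)) (L i) (e j).
Proof. exact: qcomm_conj (uLinvL q i) (uLe q i j). Qed.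

Lemma qLf i j : qcomm (q ^- (i == j)) (L i) (f j).
Proof. exact: qcomm_conj (uLinvL q i) (uLf q i j). Qed.

Lemma qLinve i j : qcomm (q ^- (i == j)) (L' i) (e j).
Proof.
by apply: qcomm_inv (qLe i j); rewrite ?uLLinv ?uLinvL ?expf_neq0.
Qed.

Lemma qLinvf i j : qcomm (q ^+ (i == j)) (L' i) (f j).
Proof.
rewrite -[q ^+ _]invrK.
by apply: qcomm_inv (qLf i j); rewrite ?uLLinv ?uLinvL ?invr_eq0 ?expf_neq0.
Qed.

Lemma qcommXl (A : algType K) c (x y : A) n :
  qcomm c x y -> qcomm (c ^+ n) (x ^+ n) y.
Proof.
move=> xy; elim: n => [|n IHn]; first exact: qcomm1l.
by rewrite !exprS; exact: qcommMl.
Qed.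

Let qcomm_symr (A : algType K) c (x y : A) :
  qcomm c y x -> c != 0 -> qcomm c^-1 x y.
Proof. by move=> xy c0; exact: qcomm_sym. Qed.

Ltac qcomm_rec := lazymatch goal with
  | |- qcomm _ (tpure _ _) (tpure _ _) =>
      eapply qcomm_tensor; [qcomm_rec|qcomm_rec]
  | |- qcomm _ (_ * _) _ => eapply qcommMl; [qcomm_rec|qcomm_rec]
  | |- qcomm _ (_ ^+ _) _ => eapply qcommXl; qcomm_rec
  | |- qcomm _ 1 _ => apply: qcomm1l
  | |- qcomm _ (ue _ _) _ => eapply qcomm_symr; [qcomm_rec|]
  | |- qcomm _ (uf _ _) _ => eapply qcomm_symr; [qcomm_rec|]
  | |- qcomm _ _ (_ * _) => eapply qcommMr; [qcomm_rec|qcomm_rec]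
  | |- qcomm _ _ (_ ^+ 2) => rewrite expr2; eapply qcommMr; [qcomm_rec|qcomm_rec]
  | |- qcomm _ _ 1 => apply: qcomm1r
  | |- qcomm _ (uL _ _) (uL _ _) => apply: qLL
  | |- qcomm _ (uL _ _) (uLinv _ _) => apply: qLLinv
  | |- qcomm _ (uLinv _ _) (uL _ _) => apply: qLinvL
  | |- qcomm _ (uLinv _ _) (uLinv _ _) => apply: qLinvLinv
  | |- qcomm _ (uL _ _) (ue _ _) => apply: qLe
  | |- qcomm _ (uL _ _) (uf _ _) => apply: qLf
  | |- qcomm _ (uLinv _ _) (ue _ _) => apply: qLinve
  | |- qcomm _ (uLinv _ _) (uf _ _) => apply: qLinvf
  end.

Ltac nz := repeat first [exact: q0 | exact: oner_neq0 | apply: mulf_neq0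
  | apply: invr_neq0 | apply: expf_neq0].
Ltac qcomm_tac :=
  eapply qcomm_eq; [qcomm_rec; nz | rewrite /= ?expr0 ?expr1; field;
    rewrite ?q0 ?oner_eq0 //].

(* The elements with [Delta(e_i) = X_i (x) e_i + e_i (x) Y_i] and
   [Delta(f_i) = f_i (x) Z_i + T_i (x) f_i] *)
Let X i := if i == i1 then L' i1 ^+ 2 * L i2 ^+ 2 else L i1 * L' i2 ^+ 2.
Let Y i := if i == i1 then 1 else L i1.
Let Z i := if i == i1 then L i1 ^+ 2 * L' i2 else L' i1 ^+ 2 * L i2 ^+ 2.
Let T i := if i == i1 then L' i2 else 1.

Let cop_e i : cop_gen q (Ge i) = X i ⊗ e i + e i ⊗ Y i.
Proof. by case: (ord2P i) => ->. Qed.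

Let cop_f i : cop_gen q (Gf i) = f i ⊗ Z i + T i ⊗ f i.
Proof. by case: (ord2P i) => ->. Qed.

Let XX i j : qcomm 1 (X i) (X j).
Proof. by case: (ord2P i) => ->; case: (ord2P j) => ->; rewrite /X /=; qcomm_tac. Qed.

Let YY i j : qcomm 1 (Y i) (Y j).
Proof. by case: (ord2P i) => ->; case: (ord2P j) => ->; rewrite /Y /=; qcomm_tac. Qed.

Let ZZ i j : qcomm 1 (Z i) (Z j).
Proof. by case: (ord2P i) => ->; case: (ord2P j) => ->; rewrite /Z /=; qcomm_tac. Qed.

Let TT i j : qcomm 1 (T i) (T j).
Proof. by case: (ord2P i) => ->; case: (ord2P j) => ->; rewrite /T /=; qcomm_tac. Qed.

Let serre_tensorr (A B : algType K) (a c : A) (b d : B) :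
  qcomm 1 a c -> serre q b d = 0 -> serre q (a ⊗ b) (c ⊗ d) = 0.
Proof.
rewrite /serre /qcomm scale1r => ac bd; rewrite !expr2 !tpureM.
have -> : a * c * a = a * a * c by rewrite -mulrA -ac mulrA.
have -> : c * (a * a) = a * a * c by rewrite mulrA -ac -mulrA -ac mulrA.
by rewrite -tpureZr -tpureNr -!tpureDr -!expr2 bd tpure0r.
Qed.

Let serre_tensorl (A B : algType K) (a c : A) (b d : B) :
  qcomm 1 b d -> serre q a c = 0 -> serre q (a ⊗ b) (c ⊗ d) = 0.
Proof.
rewrite /serre /qcomm scale1r => bd ac; rewrite !expr2 !tpureM.
have -> : b * d * b = b * b * d by rewrite -mulrA -bd mulrA.
have -> : d * (b * b) = b * b * d by rewrite mulrA -bd -mulrA -bd mulrA.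
by rewrite -tpureZl -tpureNl -!tpureDl -!expr2 ac tpure0l.
Qed.

Lemma cop_serre_e i j : i != j ->
  serre q (cop_gen q (Ge i)) (cop_gen q (Ge j)) = 0.
Proof.
move=> ij; rewrite !cop_e; apply: serreD => //.
- by apply: serre_tensorr; [exact: XX|exact: (userre_e q ij)].
- by apply: serre_tensorl; [exact: YY|exact: (userre_e q ij)].
- by case: (ord2P i) => ->; rewrite /X /Y /=; qcomm_tac.
- by move: ij; case: (ord2P i) => ->; case: (ord2P j) => -> // _;
    rewrite /X /Y /=; qcomm_tac.
- by move: ij; case: (ord2P i) => ->; case: (ord2P j) => -> // _;
    rewrite /X /Y /=; qcomm_tac.
Qed.

Lemma cop_serre_f i j : i != j ->
  serre q (cop_gen q (Gf i)) (cop_gen q (Gf j)) = 0.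
Proof.
move=> ij; rewrite !cop_f; apply: serreD => //.
- by apply: serre_tensorl; [exact: ZZ|exact: (userre_f q ij)].
- by apply: serre_tensorr; [exact: TT|exact: (userre_f q ij)].
- by case: (ord2P i) => ->; rewrite /Z /T /=; qcomm_tac.
- by move: ij; case: (ord2P i) => ->; case: (ord2P j) => -> // _;
    rewrite /Z /T /=; qcomm_tac.
- by move: ij; case: (ord2P i) => ->; case: (ord2P j) => -> // _;
    rewrite /Z /T /=; qcomm_tac.
Qed.

Let comm1 (A : algType K) (x y : A) : qcomm 1 x y -> x * y = y * x.
Proof. by rewrite /qcomm scale1r. Qed.

Let XT i : X i * T i = ukinv q i.
Proof.
case: (ord2P i) => ->; rewrite /X /T /ukinv /=.
  have -> : rev_ord i1 = i2 by exact: val_inj.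
  by rewrite -mulrA expr2 -[_ * _ * L' i2]mulrA uLLinv mulr1.
have -> : rev_ord i2 = i1 by exact: val_inj.
by rewrite mulr1; apply: comm1; qcomm_tac.
Qed.

Let YZ i : Y i * Z i = uk q i.
Proof.
case: (ord2P i) => ->; rewrite /Y /Z /uk /=.
  have -> : rev_ord i1 = i2 by exact: val_inj.
  by rewrite mul1r.
have -> : rev_ord i2 = i1 by exact: val_inj.
rewrite mulrA [L' i1 ^+ 2]expr2 mulrA uLLinv mul1r.
by apply: comm1; qcomm_tac.
Qed.

Let copk i : uk q i ⊗ uk q i =
  (L i ⊗ L i) * (L i ⊗ L i) * (L' (rev_ord i) ⊗ L' (rev_ord i)).
Proof. by rewrite !tpureM -!expr2. Qed.

Let copkinv i : ukinv q i ⊗ ukinv q i =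
  (L' i ⊗ L' i) * (L' i ⊗ L' i) * (L (rev_ord i) ⊗ L (rev_ord i)).
Proof. by rewrite !tpureM -!expr2. Qed.

Lemma cop_ef i j :
  cop_gen q (Ge i) * cop_gen q (Gf j) - cop_gen q (Gf j) * cop_gen q (Ge i) =
  ((i == j)%:R / (q - q^-1)) *: (uk q i ⊗ uk q i - ukinv q i ⊗ ukinv q i).
Proof.
rewrite !cop_e !cop_f comm_sum.
- rewrite !tpureM.
  have XTc : X i * T j = T j * X i.
    by apply: comm1; case: (ord2P i) => ->; case: (ord2P j) => ->;
       rewrite /X /T /=; qcomm_tac.
  have YZc : Y i * Z j = Z j * Y i.
    by apply: comm1; case: (ord2P i) => ->; case: (ord2P j) => ->;
       rewrite /Y /Z /=; qcomm_tac.
  rewrite -XTc -YZc -[X in _ + (_ + X)]tpureNl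
    -[X in _ + X + (_ + _)]tpureNr -tpureDr -tpureDl uef.
  have [<-|ij] := eqVneq i j; last first.
    by rewrite mul0r !scale0r tpure0r tpure0l addr0.
  rewrite XT YZ tpureZl tpureZr -scalerDr; congr (_ *: _).
  by rewrite tpureDl tpureDr tpureNl tpureNr addrC addrA subrK.
- by apply: comm1; case: (ord2P i) => ->; case: (ord2P j) => ->;
       rewrite /X /Z /=; qcomm_tac.
- by apply: comm1; case: (ord2P i) => ->; case: (ord2P j) => ->;
       rewrite /Y /T /=; qcomm_tac.
Qed.

Let LL1 i : (L i ⊗ L i) * (L' i ⊗ L' i) = 1.
Proof. by rewrite tpureM uLLinv. Qed.

Let LL2 i : (L' i ⊗ L' i) * (L i ⊗ L i) = 1.
Proof. by rewrite tpureM uLinvL. Qed.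

Let qcomm_conjK (A : algType K) c (x x' y : A) :
  x * x' = 1 -> qcomm c x y -> x * y * x' = c *: y.
Proof. by move=> xx' xy; rewrite xy -scalerAl -mulrA xx' mulr1. Qed.

Lemma cop_Le i j : (L i ⊗ L i) * cop_gen q (Ge j) * (L' i ⊗ L' i) =
  q ^+ (i == j) *: cop_gen q (Ge j).
Proof.
apply: qcomm_conjK => //; rewrite cop_e /qcomm mulrDr mulrDl scalerDr.
by congr (_ + _); case: (ord2P i) => ->; case: (ord2P j) => ->;
  rewrite /X /Y /= -/(qcomm _ _ _); qcomm_tac.
Qed.

Lemma cop_Lf i j : (L i ⊗ L i) * cop_gen q (Gf j) * (L' i ⊗ L' i) =
  q ^- (i == j) *: cop_gen q (Gf j).
Proof.
apply: qcomm_conjK => //; rewrite cop_f /qcomm mulrDr mulrDl scalerDr.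
by congr (_ + _); case: (ord2P i) => ->; case: (ord2P j) => ->;
  rewrite /Z /T /= -/(qcomm _ _ _); qcomm_tac.
Qed.

Lemma cop_rel x y :
  uq_rel q x y -> peval (cop_gen q) x = peval (cop_gen q) y.
Proof.
have gL i : L i ⊗ L i = cop_gen q (GL i) by [].
have gL' i : L' i ⊗ L' i = cop_gen q (GLinv i) by [].
have LL i j : (L i ⊗ L i) * (L j ⊗ L j) = (L j ⊗ L j) * (L i ⊗ L i).
  by rewrite !tpureM uLL.
move=> xy; case: xy LL LL1 LL2 cop_Le cop_Lf cop_ef cop_serre_e cop_serre_f
  => {x y} [i j|i|i|i j|i j|i j|i j ij|i j ij] ELL EL1 EL2 ELe ELf Eef Ee Ef.
- by move: (ELL i j); rewrite !gL; move: (cop_gen q).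
- by move: (EL1 i); rewrite gL gL'; move: (cop_gen q) => g E; rewrite /= scale1r.
- by move: (EL2 i); rewrite gL gL'; move: (cop_gen q) => g E; rewrite /= scale1r.
- move: (ELe i j); rewrite gL gL'; move: (cop_gen q) => g E.
  by rewrite /= -scalerAl mul1r.
- move: (ELf i j); rewrite gL gL'; move: (cop_gen q) => g E.
  by rewrite /= -scalerAl mul1r.
- move: (Eef i j); rewrite copk copkinv !gL !gL'; move: (cop_gen q) => g E.
  by rewrite /= -!scalerAl !mul1r !scaleN1r.
- move: (Ee i j ij); move: (cop_gen q) => g E.
  by rewrite /= -!scalerAl !mul1r !scaleN1r scale0r -E /serre !expr2 !mulrA.
- move: (Ef i j ij); move: (cop_gen q) => g E.
  by rewrite /= -!scalerAl !mul1r !scaleN1r scale0r -E /serre !expr2 !mulrA.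
Qed.

Lemma coproduct_gen g : coproduct (pgen (uq_rel q) g : U) = cop_gen q g.
Proof. exact: plift_gen cop_rel g. Qed.

Lemma coproductD : {morph @coproduct K q : u v / u + v}.
Proof. exact: pliftD cop_rel. Qed.

Lemma coproductM : {morph @coproduct K q : u v / u * v}.
Proof. exact: pliftM cop_rel. Qed.

Lemma coproductZ c : {morph @coproduct K q : u / c *: u}.
Proof. exact: pliftZ cop_rel c. Qed.

Lemma coproduct1 : coproduct (1 : U) = 1.
Proof. exact: plift1 cop_rel. Qed.

End CoproductWellDefined.

(** * The base field C(q) and the regular form *)

Local Notation "x %:F" := (@FracField.tofrac _ x).

Section RegularForm.
Variable R : realType.

Definition Cq : fieldType := {fraction {poly R[i]}}.
Definition qvar : Cq := ('X : {poly R[i]})%:F.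

Lemma qvar_neq0 : qvar != 0.
Proof. by rewrite tofrac_eq0 polyX_eq0. Qed.

(** The subring of the rational functions in [q] that are regular at [q = 1]. *)
Definition regular_at1 (x : Cq) : Prop :=
  exists p r : {poly R[i]}, r.[1] != 0 /\ x = p%:F / r%:F.

Local Notation U := (Uq qvar).
Local Notation UU := (tensor U U).

(** The subalgebra, over the ring of the functions regular at [1], generated by
    [L_i^-1], [(L_i - 1)/(q - 1)], [e_i] and [f_i]. *)
Inductive Uhat : U -> Prop :=
| Uhat_Linv i : Uhat (uLinv qvar i)
| Uhat_h i : Uhat ((qvar - 1)^-1 *: (uL qvar i - 1))
| Uhat_e i : Uhat (ue qvar i)
| Uhat_f i : Uhat (uf qvar i)
| Uhat_1 : Uhat 1
| Uhat_D x y : Uhat x -> Uhat y -> Uhat (x + y)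
| Uhat_M x y : Uhat x -> Uhat y -> Uhat (x * y)
| Uhat_Z c x : regular_at1 c -> Uhat x -> Uhat (c *: x).

(** The image of the tensor square of [Uhat], over the ring of the functions
    regular at [1], in [U (x) U]; the canonical map to [U (x) U] is injective
    because [Uhat] is torsion-free over that discrete valuation ring. *)
Definition Uhat2 (x : UU) : Prop :=
  exists s : seq (U * U),
    (forall p, p \in s -> Uhat p.1 /\ Uhat p.2) /\
    x = \sum_(p <- s) p.1 ⊗ p.2.

End RegularForm.

(* Main.v *)
(** Gauge equivalence. For every twist [Phi] and invertible [X],
    [(X (x) X) Phi Delta(X^-1)] is again a twist, and dividing it by the twist [J] gives a twist for [Delta_J]. The
    middle factor of [F_q] is a twist for [Delta] by the addition theorem
    [exp_p(x + y) = exp_p(x) exp_p(y)] when [y x = p x y], and [F_q J] is its gauge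
    transform by [X = W V].

    Regularity. Put [E = e_(1+2) L_1], [g = e_1 L_1^2 L_2^-2], [K = L_1^-2 L_2^2] and
    let [A], [B] be the two factors of [V]. Since [K] commutes with [W], the
    [q]-exponential identities collapse [F_q] to a product
      [(W A B (x) 1) exp(- u f_2 (x) K) exp(- v g (x) K^-1)^-1 (W^-1 (x) 1)],
    with [exp = exp_(q^-2)], [u = t/(1-q^2)] and [v = q^-1 u^2].
    The only element that occurs in the second tensor factor is [K], so every
    coefficient in [t] is a Laurent polynomial in [K].
    Replacing [K] by [k = q^(2m)] gives a series [Y(k)] with [Y(1) = 1] and
    [Y(k) = Y(q^2 k) Z(k)], where
    [Z(k) = 1 - t k f_2 + t^2 (q k - q^-3 k^-1)/(1-q^2) g (1 - t E)^-1]
    is regular at [q = 1] and invertible. Hence all values [Y(q^(2m))] are regular, and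
    Newton interpolation in the [q]-binomial basis, whose members are regular when
    evaluated at [K], yields the regularity of [F_q]. *)
Require Import Defs.
From HB Require Import structures.
From mathcomp Require Import all_boot all_order all_algebra zify ring fraction.
From mathcomp Require Import boolp reals.
From mathcomp.real_closed Require Import complex.

Set Implicit Arguments.
Unset Strict Implicit.
Unset Printing Implicit Defensive.

Import Order.TTheory GRing.Theory Num.Theory.
Local Open Scope ring_scope.

(** * Power series and q-exponentials *)

Section PowerSeries.
Variables (K : fieldType) (A : algType K).
Implicit Types (f g x y z : fps A) (a b : A).

(** Congruence modulo t^N. Identities between q-exponentials, which are infinite sums, are proved on
    finite partial sums, one [N] at a time. *)
Definition fps_eqmod N f g := forall n, (n < N)%N -> fcoef f n = fcoef g n.

Lemma fps_eqmodP f g : (forall N, fps_eqmod N f g) -> f = g.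
Proof. by move=> fg; apply/fpsP => n; exact: (fg n.+1). Qed.

Lemma fps_eqmod_trans N f g h :
  fps_eqmod N f g -> fps_eqmod N g h -> fps_eqmod N f h.
Proof. by move=> fg gh n nN; rewrite fg ?gh. Qed.

Lemma fps_eqmod_sym N f g : fps_eqmod N f g -> fps_eqmod N g f.
Proof. by move=> fg n nN; rewrite fg. Qed.

Lemma fps_eqmodD N f f' g g' :
  fps_eqmod N f f' -> fps_eqmod N g g' -> fps_eqmod N (f + g) (f' + g').
Proof. by move=> ff gg n nN; rewrite !fcoefD ff ?gg. Qed.

Lemma fps_eqmodM N f f' g g' :
  fps_eqmod N f f' -> fps_eqmod N g g' -> fps_eqmod N (f * g) (f' * g').
Proof.
move=> ff gg n nN; rewrite !fcoefM; apply: eq_bigr => i _.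
by rewrite ff ?gg //; have := ltn_ord i; lia.
Qed.

Lemma fcoefM0 f g : fcoef (f * g) 0 = fcoef f 0 * fcoef g 0.
Proof. by rewrite fcoefM big_ord1. Qed.

Lemma fcoefM_lt f g m k n : (forall i, (i < m)%N -> fcoef f i = 0) ->
  (forall i, (i < k)%N -> fcoef g i = 0) -> (n < m + k)%N -> fcoef (f * g) n = 0.
Proof.
move=> fm gk nmk; rewrite fcoefM big1 // => i _.
have [im|mi] := ltnP i m; first by rewrite fm ?mul0r.
by rewrite gk ?mulr0 //; have := ltn_ord i; lia.
Qed.

Lemma fps_monoM n m a b : fps_mono n a * fps_mono m b = fps_mono (n + m) (a * b).
Proof.
apply/fpsP => k; rewrite fcoefM /=.
have [kE|knm] := eqVneq k (n + m)%N.
  have nk : (n < k.+1)%N by lia.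
  rewrite (bigD1 (Ordinal nk)) //= eqxx (_ : (k - n == m)%N); last by lia.
  rewrite big1 ?addr0 // => i /eqP/val_eqP /= /negPf ->; exact: mul0r.
rewrite big1 // => i _; case: eqP => [iE|]; last by rewrite mul0r.
by case: eqP => [|_]; rewrite ?mulr0 //; have := ltn_ord i; lia.
Qed.

Lemma fps_monoD n a b : fps_mono n (a + b) = fps_mono n a + fps_mono n b.
Proof. by apply/fpsP => k; rewrite fcoefD /=; case: eqP; rewrite ?addr0. Qed.

Lemma fps_monoZ n c a : fps_mono n (c *: a) = c *: fps_mono n a.
Proof. by apply/fpsP => k; rewrite fcoefZ /=; case: eqP; rewrite ?scaler0. Qed.

Lemma fps_monoN n a : fps_mono n (- a) = - fps_mono n a.
Proof. by rewrite -!scaleN1r fps_monoZ. Qed.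

Lemma fps_mono_0 n : fps_mono n (0 : A) = 0.
Proof. by rewrite -(scale0r 0) fps_monoZ scale0r. Qed.

Lemma fps_mono_qcomm n m c a b :
  qcomm c a b -> qcomm c (fps_mono n a) (fps_mono m b).
Proof. by rewrite /qcomm !fps_monoM addnC => ->; rewrite fps_monoZ. Qed.

(** Product of two t-adically convergent sums. Since [a k] and [b k] have order at least [k], the
    pairs with k + j >= N vanish modulo t^N, and the remaining ones are grouped by the total s = k +
    j. *)
Lemma fps_eqmod_sumM N (a b : nat -> fps A) :
  (forall k i, (i < k)%N -> fcoef (a k) i = 0) ->
  (forall k i, (i < k)%N -> fcoef (b k) i = 0) ->
  fps_eqmod N ((\sum_(k < N) a k) * (\sum_(k < N) b k))
    (\sum_(s < N) \sum_(k < s.+1) a k * b (s - k)%N).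
Proof.
move=> ak bj n nN.
rewrite big_distrlr !fcoef_sum.
have E k : fcoef (\sum_(j < N) a k * b j) n =
    \sum_(s < N | (k <= s)%N) fcoef (a k * b (s - k)%N) n.
  rewrite fcoef_sum.
  have far j : (N <= k + j)%N -> fcoef (a k * b j) n = 0.
    move=> Nkj; apply: (@fcoefM_lt (a k) (b j) k j); last by lia.
    - by move=> i; exact: ak.
    - by move=> i; exact: bj.
  have [Nk|kN] := leqP N k.
    rewrite [RHS]big1 => [|j kj]; last by exfalso; have := ltn_ord j; lia.
    by rewrite big1 // => j _; apply: far; lia.
  rewrite -(big_mkord (leq k) (fun s => fcoef (a k * b (s - k)%N) n)).
  rewrite -(big_mkord xpredT (fun j => fcoef (a k * b j) n)).
  rewrite (big_cat_nat (n := (N - k)%N)) //=; last by lia.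
  rewrite [X in _ + X]big_nat_cond [X in _ + X]big1 ?addr0; last first.
    by move=> j; rewrite andbT => /andP[Nkj _]; apply: far; lia.
  rewrite [RHS](big_cat_nat (n := k)) //=; last by lia.
  rewrite [X in _ = X + _]big_nat_cond [X in _ = X + _]big1 ?add0r; last first.
    by move=> j; lia.
  (* Reindexing by j = s - k. *)
  have -> (G : nat -> A) : \sum_(k <= s < N | (k <= s)%N) G s =
      \sum_(0 <= j < N - k) G (j + k)%N.
    rewrite -{1}[k]add0n big_addn; apply: eq_bigl => j; exact: leq_addl.
  by apply: eq_bigr => j _; rewrite addnK.
under eq_bigr => k _ do rewrite E.
rewrite (exchange_big_dep xpredT) //; apply: eq_bigr => s _.
rewrite fcoef_sum.
by rewrite (big_ord_widen N (fun k => fcoef (a k * b (s - k)%N) n)).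
Qed.

End PowerSeries.

(** * q-integers and q-factorials when [p] is not a root of unity *)

Section QNumbers.
Variables (K : fieldType) (p : K).
Hypothesis p_free : forall n, p ^+ n.+1 != 1.

Lemma subr1X_neq0 n : 1 - p ^+ n.+1 != 0.
Proof. by rewrite subr_eq0 eq_sym. Qed.

Lemma subr1_neq0 : 1 - p != 0.
Proof. exact: (subr1X_neq0 0). Qed.

Lemma qint0 : qint p 0 = 0.
Proof. by rewrite /qint expr0 subrr mul0r. Qed.

Lemma qint_neq0 n : qint p n.+1 != 0.
Proof. by rewrite mulf_neq0 ?invr_neq0 ?subr1_neq0 ?subr1X_neq0. Qed.

Lemma qintS n : qint p n.+1 = 1 + p * qint p n.
Proof. by rewrite /qint exprS; field; exact: subr1_neq0. Qed.

Lemma qintD n m : qint p (n + m) = qint p n + p ^+ n * qint p m.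
Proof. by rewrite /qint exprD; field; exact: subr1_neq0. Qed.

Lemma qfact0 : qfact p 0 = 1.
Proof. by rewrite /qfact big_geq. Qed.

Lemma qfactS n : qfact p n.+1 = qint p n.+1 * qfact p n.
Proof. by rewrite /qfact big_nat_recr //= mulrC. Qed.

Lemma qfact_neq0 n : qfact p n != 0.
Proof.
by elim: n => [|n IHn]; rewrite ?qfact0 ?oner_neq0 // qfactS mulf_neq0 ?qint_neq0.
Qed.

Lemma qint_qfactV n : qint p n.+1 * (qfact p n.+1)^-1 = (qfact p n)^-1.
Proof. by rewrite qfactS invfM mulrA divff ?mul1r ?qint_neq0. Qed.

End QNumbers.

Lemma inv_free (K : fieldType) (p : K) :
  (forall n, p ^+ n.+1 != 1) -> forall n, p^-1 ^+ n.+1 != 1.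
Proof. by move=> pf n; rewrite exprVn invr_eq1. Qed.

(** * Addition theorem and q-difference equation of the q-exponential *)

Section QExponential.
Variables (K : fieldType) (p : K) (A : algType K).
Hypotheses (p_free : forall n, p ^+ n.+1 != 1).
Implicit Types x y z h : fps A.

(** The q-divided power, general term of the q-exponential. With the q-factorial divided out,
    multiplication by [x] only produces a q-integer. *)
Definition divpow x n : fps A := (qfact p n)^-1 *: x ^+ n.

Lemma divpow0 x : divpow x 0 = 1.
Proof. by rewrite /divpow qfact0 invr1 scale1r. Qed.

Lemma divpow_lt x k n : fcoef x 0 = 0 -> (n < k)%N -> fcoef (divpow x k) n = 0.
Proof. by move=> x0 nk; rewrite fcoefZ fcoefX_lt ?scaler0. Qed.

Lemma divpowS x n : qint p n.+1 *: divpow x n.+1 = x * divpow x n.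
Proof. by rewrite /divpow scalerA qint_qfactV // exprS scalerAr. Qed.

Lemma divpowSr x n : qint p n.+1 *: divpow x n.+1 = divpow x n * x.
Proof. by rewrite /divpow scalerA qint_qfactV // exprSr scalerAl. Qed.

Lemma qexp_mod x N : fcoef x 0 = 0 ->
  fps_eqmod N (qexp p x) (\sum_(k < N) divpow x k).
Proof.
move=> x0 n nN; rewrite fcoef_sum /=.
rewrite (big_ord_widen N (fun k => (qfact p k)^-1 *: fcoef (x ^+ k) n)) //.
rewrite big_mkcond /=; apply: eq_bigr => k _; case: ifP => // /negbT.
by rewrite -leqNgt => kn; rewrite -fcoefZ -/(divpow x k) divpow_lt.
Qed.

Lemma qexp0 : qexp p (0 : fps A) = 1.
Proof.
apply/fpsP => n /=; rewrite big_ord_recl qfact0 invr1 scale1r /= big1 ?addr0 //.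
by move=> i _; rewrite expr0n scaler0.
Qed.

(* Conjugation by [h], stated so that [h] need not be invertible. *)
Lemma qexp_intertwine h x y : fcoef x 0 = 0 -> fcoef y 0 = 0 ->
  h * x = y * h -> h * qexp p x = qexp p y * h.
Proof.
move=> x0 y0 hxy; apply: fps_eqmodP => N.
apply: (@fps_eqmod_trans _ _ _ _ (h * \sum_(k < N) divpow x k)).
  by apply: fps_eqmodM => //; exact: qexp_mod.
apply: (@fps_eqmod_trans _ _ _ _ ((\sum_(k < N) divpow y k) * h)); last first.
  by apply/fps_eqmod_sym/fps_eqmodM => //; exact: qexp_mod.
rewrite mulr_sumr mulr_suml (eq_bigr (fun k : 'I_N => divpow y k * h)) //.
move=> k _; rewrite /divpow -scalerAr -scalerAl; congr (_ *: _).
elim: {k}(k : nat) => [|k IHk]; first by rewrite !expr0 mulr1 mul1r.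
by rewrite !exprS mulrA hxy -mulrA IHk mulrA.
Qed.

(** The q-binomial theorem. After multiplication by (n+1)_p, write (n+1)_p = (k)_p + p^k (n+1-k)_p:
    the first summand comes from a factor [x] in front, the second from moving [y] past x^k. *)
Lemma divpowD x y n : qcomm p y x ->
  divpow (x + y) n = \sum_(k < n.+1) divpow x k * divpow y (n - k)%N.
Proof.
move=> yx; elim: n => [|n IHn]; first by rewrite big_ord1 !divpow0 mulr1.
apply: (scalerI (qint_neq0 p_free n)).
have yxk k : y * divpow x k = p ^+ k *: (divpow x k * y).
  rewrite -scalerAr -!scalerAl scalerA mulrC -scalerA; congr (_ *: _).
  elim: k => [|k IHk]; first by rewrite !expr0 mulr1 mul1r scale1r.
  by rewrite !exprSr mulrA IHk -scalerAl -mulrA yx -scalerAr scalerA mulrA.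
rewrite divpowS IHn mulrDl scaler_sumr.
under [RHS]eq_bigr => k _.
  have -> : qint p n.+1 = qint p k + p ^+ k * qint p (n.+1 - k).
    by rewrite -qintD // subnKC // -ltnS.
  rewrite scalerDl; over.
rewrite big_split /= [X in _ = X + _]big_ord_recl /= qint0 scale0r add0r.
rewrite [X in _ = _ + X]big_ord_recr /= subnn qint0 mulr0 scale0r addr0.
rewrite !mulr_sumr; congr (_ + _); apply: eq_bigr => k _.
  by rewrite mulrA -divpowS -scalerAl.
rewrite mulrA yxk -scalerAl -mulrA -divpowS -scalerAr scalerA subSn //.
by rewrite -ltnS.
Qed.

Lemma qexpD x y : fcoef x 0 = 0 -> fcoef y 0 = 0 -> qcomm p y x ->
  qexp p (x + y) = qexp p x * qexp p y.
Proof.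
move=> x0 y0 yx; apply: fps_eqmodP => N.
have xy0 : fcoef (x + y) 0 = 0 by rewrite fcoefD x0 y0 addr0.
apply: (fps_eqmod_trans (qexp_mod (N := N) xy0)).
apply/fps_eqmod_sym/(fps_eqmod_trans
  (fps_eqmodM (qexp_mod (N := N) x0) (qexp_mod (N := N) y0))).
under [X in fps_eqmod _ _ X]eq_bigr => k _ do rewrite divpowD //.
by apply: fps_eqmod_sumM => k i; exact: divpow_lt.
Qed.

(** The q-difference equation of exp_p. Since (1-p) x sends the k-th divided power to 1 - p^(k+1)
    times the next one, the difference of the two sides telescopes. *)
Lemma qexp_shift x : fcoef x 0 = 0 ->
  qexp p (p *: x) = (1 - (1 - p) *: x) * qexp p x.
Proof.
move=> x0; have px0 : fcoef (p *: x) 0 = 0 by rewrite fcoefZ x0 scaler0.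
apply: fps_eqmodP => N; apply: (fps_eqmod_trans (qexp_mod (N := N) px0)).
apply: fps_eqmod_sym.
apply: (fps_eqmod_trans (fps_eqmodM (fun _ _ => erefl) (qexp_mod (N := N) x0))) => n nN.
have -> : \sum_(k < N) divpow (p *: x) k = \sum_(k < N) p ^+ k *: divpow x k.
  by apply: eq_bigr => k _; rewrite /divpow exprZn !scalerA mulrC.
rewrite mulrBl mul1r -scalerAl mulr_sumr scaler_sumr.
pose h k := (1 - p ^+ k) *: divpow x k.
under [X in fcoef (_ - X)]eq_bigr => k _.
  rewrite -divpowS scalerA mulrC /qint divfK ?subr1_neq0 // -/(h k.+1); over.
(* Here h 0 = 0, and the other boundary term [h N] has order at least [N], so it vanishes modulo
   t^N. *)
have tel : \sum_(k < N) h k.+1 = \sum_(k < N) h k + h N.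
  rewrite -[RHS]addrC; apply/eqP; rewrite -subr_eq -sumrB.
  rewrite -(big_mkord xpredT (fun k => h k.+1 - h k)) telescope_sumr //.
  by rewrite /h expr0 subrr scale0r subr0.
rewrite tel opprD addrA -sumrB fcoefD fcoefN [fcoef (h N) n]fcoefZ divpow_lt //.
rewrite scaler0 subr0; congr (fcoef _ n); apply: eq_bigr => k _.
by rewrite /h scalerBl scale1r opprB addrC subrK.
Qed.

End QExponential.

(** * Inverse of the q-exponential and its commutation past an element [y] with x y = y x + z *)

Section QExponentialInverse.
Variables (K : fieldType) (p : K) (A : algType K).
Hypotheses (p0 : p != 0) (p_free : forall n, p ^+ n.+1 != 1).
Implicit Types x y : fps A.

Let pV_free := inv_free p_free.

Lemma qintV n : qint p n.+1 = p ^+ n * qint p^-1 n.+1.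
Proof.
have p1 := p_free 0; rewrite expr1 in p1.
rewrite /qint exprVn exprS; field.
by rewrite expf_neq0 // p0 !subr_eq0 p1 eq_sym p1.
Qed.

Lemma divpow_shift n x : qint p n.+1 *: divpow p^-1 (- x) n.+1 =
  - (p ^+ n *: (x * divpow p^-1 (- x) n)).
Proof. by rewrite qintV -scalerA divpowS // mulNr scalerN. Qed.

(** The part [c k.+1] of degree k+1 in [x] vanishes: multiplied by (k+1)_p = (k+1-i)_p + p^(k+1-i)
    (i)_p, it becomes two sums that cancel term by term after a shift of the index, the sign and the
    power of p coming from [divpow_shift]. *)
Lemma qexp_inv x : fcoef x 0 = 0 -> qexp p x * qexp p^-1 (- x) = 1.
Proof.
move=> x0; have nx0 : fcoef (- x) 0 = 0 by rewrite fcoefN x0 oppr0.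
pose c k := \sum_(i < k.+1) divpow p x i * divpow p^-1 (- x) (k - i)%N.
have cS k : c k.+1 = 0.
  apply: (scalerI (qint_neq0 p_free k)); rewrite scaler0 scaler_sumr.
  under eq_bigr => i _.
    have -> : qint p k.+1 = qint p (k.+1 - i) + p ^+ (k.+1 - i) * qint p i.
      by rewrite -qintD // subnK // -ltnS.
    rewrite scalerDl; over.
  rewrite big_split big_ord_recr /= subnn qint0 scale0r addr0.
  rewrite [X in _ + X]big_ord_recl /= qint0 mulr0 scale0r add0r.
  rewrite -big_split big1 // => i _ /=; have ik : (i <= k)%N by rewrite -ltnS.
  rewrite /bump leq0n add1n subSS -scalerA [X in _ + _ *: X]scalerAl divpowSr //.
  by rewrite subSn // [X in X + _]scalerAr divpow_shift mulrN -scalerAr mulrA addNr.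
apply: fps_eqmodP => N.
apply: (fps_eqmod_trans
  (fps_eqmodM (@qexp_mod K p A x N x0) (@qexp_mod K p^-1 A (- x) N nx0))).
apply: fps_eqmod_trans; first apply: fps_eqmod_sumM => k i; try exact: divpow_lt.
case: N => [|N] n nN //.
rewrite (eq_bigr (fun s : 'I_N.+1 => c s)) // big_ord_recl [c _]big_ord1.
rewrite !divpow0 mulr1 big1 ?addr0 // => i _; exact: cS.
Qed.

(** Moving [y] to the left through the n+1 factors of x^(n+1) produces one [z] per factor. Each [z]
    then crosses the factors on its left at the cost of p^-1, and the powers of p add up to a
    q-integer, which the q-factorial absorbs. *)
Lemma qexp_commutator x y z : fcoef x 0 = 0 -> x * y = y * x + z ->
  qcomm p^-1 x z -> qexp p x * y = y * qexp p x + z * qexp p (p^-1 *: x).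
Proof.
move=> x0 xy xz; have px0 : fcoef (p^-1 *: x) 0 = 0 by rewrite fcoefZ x0 scaler0.
have dpz n : divpow p (p^-1 *: x) n = p^-1 ^+ n *: divpow p x n.
  by rewrite /divpow exprZn !scalerA mulrC.
have dS n : divpow p x n.+1 * y =
    y * divpow p x n.+1 + p^-1 ^+ n *: (z * divpow p x n).
  elim: n => [|n IHn].
    by rewrite expr0 scale1r !divpow0 mulr1 /divpow qfactS qfact0 mulr1 /qint
      expr1 divff ?subr1_neq0 // invr1 !scale1r.
  apply: (scalerI (qint_neq0 p_free n.+1)).
  rewrite fps_scalerAl divpowS // -mulrA IHn mulrDr mulrA xy mulrDl -mulrA -divpowS //.
  rewrite -[x * _]fps_scalerAr [x * _]mulrA xz -fps_scalerAl -[z * _ * _]mulrA.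
  rewrite -divpowS // -!fps_scalerAr -addrA.
  rewrite scalerDr; congr (_ + _); set d := _^-1 *: (z * _).
  rewrite -{1}[d]scale1r !scalerA -scalerDl; congr (_ *: _).
  (* The scalar identity left is 1 + p^-(n+1) (n+1)_p = p^-(n+1) (n+2)_p. *)
  have q1 : qint p 1 = 1 by rewrite /qint expr1 divff ?subr1_neq0.
  rewrite -[n.+2]addn1 qintD // q1 !exprVn exprS; field.
  by rewrite p0 expf_neq0 ?qfact_neq0.
apply: fps_eqmodP => N.
have yE : fps_eqmod N (qexp p x * y) ((1 + \sum_(k < N) divpow p x k.+1) * y).
  apply: fps_eqmodM => // n nN; rewrite (@qexp_mod _ p _ _ N.+1) ?leqW //.
  by rewrite big_ord_recl divpow0.
apply: (fps_eqmod_trans yE); apply: fps_eqmod_sym.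
have yE' : fps_eqmod N (y * qexp p x) (y * (1 + \sum_(k < N) divpow p x k.+1)).
  apply: fps_eqmodM => // n nN; rewrite (@qexp_mod _ p _ _ N.+1) ?leqW //.
  by rewrite big_ord_recl divpow0.
apply: (fps_eqmod_trans (fps_eqmodD yE'
  (fps_eqmodM (fun _ _ => erefl) (@qexp_mod K p A _ N px0)))) => n nN.
rewrite mulrDl mulrDr mulr1 mul1r -addrA; congr (fcoef (_ + _) n).
rewrite mulr_suml !mulr_sumr -big_split; apply: eq_bigr => k _.
by rewrite /= dS dpz -[z * _]fps_scalerAr.
Qed.

End QExponentialInverse.

(** * Morphisms of tensor products and of power series *)

Section FpsMorphism.
Variables (K : fieldType) (A B : algType K) (phi : {lrmorphism A -> B}).
Implicit Types f g : fps A.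

Fact fps_map_nmod : nmod_morphism (fps_map phi).
Proof.
by split=> [|f g]; apply/fpsP => n; rewrite /fps_map /= ?rmorph0 ?rmorphD.
Qed.

Fact fps_map_monoid : monoid_morphism (fps_map phi).
Proof.
split=> [|f g]; apply/fpsP => n.
  by rewrite /=; case: eqP => _; rewrite ?rmorph1 ?rmorph0.
rewrite fcoefM -[LHS]/(phi (fcoef (f * g) n)) fcoefM rmorph_sum.
by apply: eq_bigr => i _; rewrite rmorphM.
Qed.

Fact fps_map_scalable : scalable (fps_map phi).
Proof. by move=> c f; apply/fpsP => n; rewrite /= linearZ. Qed.

HB.instance Definition _ :=
  GRing.isNmodMorphism.Build (fps A) (fps B) (fps_map phi) fps_map_nmod.
HB.instance Definition _ :=
  GRing.isMonoidMorphism.Build (fps A) (fps B) (fps_map phi) fps_map_monoid.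
HB.instance Definition _ :=
  GRing.isScalable.Build K (fps A) (fps B) *:%R (fps_map phi) fps_map_scalable.

Lemma fps_mapM f g : fps_map phi (f * g) = fps_map phi f * fps_map phi g.
Proof. exact: rmorphM. Qed.

Lemma fps_mapD f g : fps_map phi (f + g) = fps_map phi f + fps_map phi g.
Proof. exact: rmorphD. Qed.

Lemma fps_map1 : fps_map phi 1 = 1.
Proof. exact: rmorph1. Qed.

Lemma fps_map_unit f : f \is a GRing.unit -> fps_map phi f \is a GRing.unit.
Proof. exact: rmorph_unit. Qed.

Lemma fps_mapV f : f \is a GRing.unit -> fps_map phi f^-1 = (fps_map phi f)^-1.
Proof. exact: rmorphV. Qed.

Lemma fps_map_mono n a : fps_map phi (fps_mono n a) = fps_mono n (phi a).
Proof. by apply/fpsP => k /=; case: eqP; rewrite ?rmorph0. Qed.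

Lemma fps_map_qexp p f : fps_map phi (qexp p f) = qexp p (fps_map phi f).
Proof.
apply/fpsP => n /=; rewrite rmorph_sum; apply: eq_bigr => k _ /=.
by rewrite linearZ_LR -rmorphXn.
Qed.

End FpsMorphism.

(** As t is central, commutation of coefficients suffices; reversing the Cauchy sum exchanges the
    two factors. *)
Lemma fps_map_comm (K : fieldType) (A B C : algType K) (phi : A -> C)
    (psi : B -> C) (f : fps A) (g : fps B) :
  (forall a b, phi a * psi b = psi b * phi a) ->
  fps_map phi f * fps_map psi g = fps_map psi g * fps_map phi f.
Proof.
move=> comm; apply/fpsP => n; rewrite !fcoefM (reindex_inj rev_ord_inj).
apply: eq_bigr => i _ /=; rewrite comm subSS; congr (psi (fcoef g _) * _).
by rewrite subKn // -ltnS.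
Qed.

Section TensorMorphism.
Variables (K : fieldType) (A B C : algType K) (f : A -> B -> C).

(** The conditions under which a bilinear map induces an algebra morphism out of the tensor product.
    The multiplicativity clause contains the commutation of f a 1 with f 1 b. *)
Record bimorphism : Prop := Bimorphism {
  bimorphDl : forall a a' b, f (a + a') b = f a b + f a' b;
  bimorphDr : forall a b b', f a (b + b') = f a b + f a b';
  bimorphZl : forall c a b, f (c *: a) b = c *: f a b;
  bimorphZr : forall c a b, f a (c *: b) = c *: f a b;
  bimorph1 : f 1 1 = 1;
  bimorphM : forall a a' b b', f (a * a') (b * b') = f a b * f a' b' }.

Hypothesis fP : bimorphism.

Lemma bimorphism_balanced : balanced f.
Proof.
split; [exact: bimorphDl fP|exact: bimorphDr fP| |].
- by move=> c a b; rewrite (bimorphZl fP) (bimorphZr fP).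
- by move=> b; rewrite -(scale0r 0) (bimorphZl fP) scale0r.
Qed.

Let fb := bimorphism_balanced.

Lemma tliftZ c x : tlift f (c *: x) = c *: tlift f x.
Proof.
elim/tensor_ind: x => [|x y IHx IHy|a b].
- by rewrite scaler0 tlift0 // scaler0.
- by rewrite scalerDr !tliftD // IHx IHy scalerDr.
- by rewrite -tpureZl !tlift_pure // (bimorphZl fP).
Qed.

Lemma tliftM x y : tlift f (x * y) = tlift f x * tlift f y.
Proof.
elim/tensor_ind: x => [|x x' IH IH'|a b].
- by rewrite mul0r tlift0 // mul0r.
- by rewrite mulrDl !tliftD // IH IH' mulrDl.
elim/tensor_ind: y => [|y y' IH IH'|a' b'].
- by rewrite mulr0 tlift0 // mulr0.
- by rewrite mulrDr !tliftD // IH IH' mulrDr.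
by rewrite tpureM !tlift_pure // (bimorphM fP).
Qed.

Lemma tlift1 : tlift f 1 = 1.
Proof. by rewrite [LHS]tlift_pure // (bimorph1 fP). Qed.

End TensorMorphism.

Section TensorMaps.
Variables (K : fieldType).

Definition tinl (A B : algType K) (a : A) : tensor A B := a ⊗ 1.
Definition tinr (A B : algType K) (b : B) : tensor A B := 1 ⊗ b.
Arguments tinl {A} B a.
Arguments tinr A {B} b.

Section Injections.
Variables (A B : algType K).

Fact tinl_nmod : nmod_morphism (@tinl A B).
Proof. by split=> [|a a']; rewrite /tinl ?tpure0l ?tpureDl. Qed.
Fact tinl_monoid : monoid_morphism (@tinl A B).
Proof. by split=> [|a a']; rewrite /tinl ?tpureM ?mulr1. Qed.
Fact tinl_scalable : scalable (@tinl A B).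
Proof. by move=> c a; rewrite /tinl tpureZl. Qed.
HB.instance Definition _ :=
  GRing.isNmodMorphism.Build A (tensor A B) (@tinl A B) tinl_nmod.
HB.instance Definition _ :=
  GRing.isMonoidMorphism.Build A (tensor A B) (@tinl A B) tinl_monoid.
HB.instance Definition _ :=
  GRing.isScalable.Build K A (tensor A B) *:%R (@tinl A B) tinl_scalable.

Fact tinr_nmod : nmod_morphism (@tinr A B).
Proof. by split=> [|a a']; rewrite /tinr ?tpure0r ?tpureDr. Qed.
Fact tinr_monoid : monoid_morphism (@tinr A B).
Proof. by split=> [|a a']; rewrite /tinr ?tpureM ?mulr1. Qed.
Fact tinr_scalable : scalable (@tinr A B).
Proof. by move=> c a; rewrite /tinr tpureZr. Qed.
HB.instance Definition _ :=
  GRing.isNmodMorphism.Build B (tensor A B) (@tinr A B) tinr_nmod.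
HB.instance Definition _ :=
  GRing.isMonoidMorphism.Build B (tensor A B) (@tinr A B) tinr_monoid.
HB.instance Definition _ :=
  GRing.isScalable.Build K B (tensor A B) *:%R (@tinr A B) tinr_scalable.

Lemma tinlr_comm a b : tinl B a * tinr A b = tinr A b * tinl B a.
Proof. by rewrite !tpureM !mul1r !mulr1. Qed.

Lemma tinlrE a b : a ⊗ b = tinl B a * tinr A b.
Proof. by rewrite tpureM mul1r mulr1. Qed.

(** Replaces the tensor product of series by a product of images under two algebra morphisms with
    commuting ranges, the form used in all later computations. *)
Lemma fps_tensorE (f : fps A) (g : fps B) :
  f ⊗t g = fps_map (tinl B) f * fps_map (tinr A) g.
Proof. by apply/fpsP => n; rewrite fcoefM; apply: eq_bigr => i _; rewrite tinlrE. Qed.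

End Injections.

Section Map.
Variables (A A' B B' : algType K).
Variables (phi : {lrmorphism A -> A'}) (psi : {lrmorphism B -> B'}).

Definition tmap : tensor A B -> tensor A' B' := tlift (fun a b => phi a ⊗ psi b).

Fact tmap_bimorphism : bimorphism (fun a b => phi a ⊗ psi b).
Proof.
split=> *; rewrite ?(rmorphD, rmorph1, rmorphM, linearZ_LR) //=.
- exact: tpureDl.
- exact: tpureDr.
- exact: tpureZl.
- exact: tpureZr.
- by rewrite tpureM.
Qed.

Fact tmap_nmod : nmod_morphism tmap.
Proof.
have bal := bimorphism_balanced tmap_bimorphism.
by split=> [|x y]; [exact: tlift0|exact: tliftD].
Qed.
Fact tmap_monoid : monoid_morphism tmap.
Proof.
by split=> [|x y]; [exact: (tlift1 tmap_bimorphism)|exact: (tliftM tmap_bimorphism)].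
Qed.
Fact tmap_scalable : scalable tmap.
Proof. by move=> c x; exact: (tliftZ tmap_bimorphism). Qed.
HB.instance Definition _ :=
  GRing.isNmodMorphism.Build (tensor A B) (tensor A' B') tmap tmap_nmod.
HB.instance Definition _ :=
  GRing.isMonoidMorphism.Build (tensor A B) (tensor A' B') tmap tmap_monoid.
HB.instance Definition _ := GRing.isScalable.Build K (tensor A B)
  (tensor A' B') *:%R tmap tmap_scalable.

Lemma tmapE a b : tmap (a ⊗ b) = phi a ⊗ psi b.
Proof. exact: tlift_pure (bimorphism_balanced tmap_bimorphism). Qed.

End Map.

Section Legs.
Variable A : algType K.
Local Notation A2 := (tensor A A).
Local Notation A3 := (tensor A2 A).

Fact tassoc_bimorphism :
  bimorphism (fun a => tlift (fun b c => (a ⊗ b) ⊗ c) : A2 -> A3).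
Proof.
have balr := @tassoc_balr K A; have [b1 b2 b3 b4] := @tassoc_bal K A.
have liftE a b c : tlift (fun b c => (a ⊗ b) ⊗ c : A3) (b ⊗ c) = (a ⊗ b) ⊗ c.
  exact: tlift_pure.
split=> //.
- move=> c a; elim/tensor_ind=> [|x y IHx IHy|b d].
  + by rewrite !tlift0 // scaler0.
  + by rewrite !tliftD // IHx IHy scalerDr.
  + by rewrite !liftE !tpureZl.
- move=> c a; elim/tensor_ind=> [|x y IHx IHy|b d].
  + by rewrite scaler0 !tlift0 // scaler0.
  + by rewrite scalerDr !tliftD // IHx IHy scalerDr.
  + by rewrite -tpureZr !liftE tpureZr.
- exact: liftE.
move=> a a'; elim/tensor_ind=> [|x x' IH IH'|b c] y.
- by rewrite mul0r !tlift0 // mul0r.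
- by rewrite mulrDl !tliftD // IH IH' mulrDl.
elim/tensor_ind: y => [|y y' IH IH'|b' c'].
- by rewrite mulr0 !tlift0 // mulr0.
- by rewrite mulrDr !tliftD // IH IH' mulrDr.
- by rewrite tpureM !liftE !tpureM.
Qed.

Fact tassoc_nmod : nmod_morphism (@tassoc K A).
Proof.
have bal := bimorphism_balanced tassoc_bimorphism.
by split=> [|x y]; [exact: tlift0|exact: tliftD].
Qed.
Fact tassoc_monoid : monoid_morphism (@tassoc K A).
Proof.
by split=> [|x y];
  [exact: (tlift1 tassoc_bimorphism)|exact: (tliftM tassoc_bimorphism)].
Qed.
Fact tassoc_scalable : scalable (@tassoc K A).
Proof. by move=> c x; exact: (tliftZ tassoc_bimorphism). Qed.
HB.instance Definition _ :=
  GRing.isNmodMorphism.Build (tensor A A2) A3 (@tassoc K A) tassoc_nmod.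
HB.instance Definition _ :=
  GRing.isMonoidMorphism.Build (tensor A A2) A3 (@tassoc K A) tassoc_monoid.
HB.instance Definition _ := GRing.isScalable.Build K (tensor A A2) A3
  *:%R (@tassoc K A) tassoc_scalable.

HB.instance Definition _ := GRing.LRMorphism.copy (@leg12 K A) (@tinl A2 A).
HB.instance Definition _ :=
  GRing.LRMorphism.copy (@leg23 K A) (@tassoc K A \o @tinr A A2).

End Legs.
End TensorMaps.

Arguments tinl {K A} B a.
Arguments tinr {K} A {B} b.

(** * Laurent polynomials and Newton interpolation *)

Section NewtonBasis.
Variables (K : fieldType) (p : K).
Hypotheses (p0 : p != 0) (p_free : forall n, p ^+ n.+1 != 1).

Lemma expr_inj_free i j : (i < j)%N -> p ^+ j - p ^+ i != 0.
Proof.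
move=> ij; rewrite -(subnK ij) addnS -addSn exprD -[X in _ - X]mul1r -mulrBl.
by rewrite mulf_neq0 ?expf_neq0 // subr_eq0 p_free.
Qed.

(** The Newton basis for the nodes 1, p, p^2, ..., normalized so that the value at p^m is the
    Gaussian binomial coefficient of m over j in base p. *)
Definition newton (j : nat) : {poly K} :=
  \prod_(i < j) ((p ^+ j - p ^+ i)^-1 *: ('X - (p ^+ i)%:P)).

Lemma horner_newton j x :
  (newton j).[x] = \prod_(i < j) ((x - p ^+ i) / (p ^+ j - p ^+ i)).
Proof.
rewrite horner_prod; apply: eq_bigr => i _.
by rewrite hornerZ hornerXsubC mulrC.
Qed.

Lemma newton_diag j : (newton j).[p ^+ j] = 1.
Proof.
by rewrite horner_newton big1 // => i _; rewrite divff ?expr_inj_free.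
Qed.

Lemma newton_lt j m : (m < j)%N -> (newton j).[p ^+ m] = 0.
Proof.
move=> mj; rewrite horner_newton (bigD1 (Ordinal mj)) //=.
by rewrite subrr mul0r mul0r.
Qed.

Lemma size_newton j : size (newton j) = j.+1.
Proof.
rewrite size_prod => [|i _]; last first.
  by rewrite scaler_eq0 invr_eq0 (negPf (expr_inj_free _)) // polyXsubC_eq0.
under eq_bigr => i _ do rewrite size_scale ?invr_eq0 ?expr_inj_free // size_XsubC.
by rewrite big_const_ord iter_addn_0 card_ord mul2n -addnn; lia.
Qed.

Lemma newton_span D (G : {poly K}) : (size G <= D)%N ->
  exists c : nat -> K, G = \sum_(j < D) c j *: newton j.
Proof.
elim: D G => [|D IHD] G GD.
  exists (fun=> 0); rewrite big_ord0; apply/eqP.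
  by rewrite -size_poly_eq0 -leqn0.
(* [newton D] has degree exactly D, so subtracting this multiple removes the top coefficient of
   [G]. *)
pose d := G`_D / lead_coef (newton D).
have l0 : lead_coef (newton D) != 0.
  by rewrite lead_coef_eq0 -size_poly_eq0 size_newton.
have [|c cE] := IHD (G - d *: newton D).
  apply/leq_sizeP => j; rewrite leq_eqVlt => /orP[/eqP <-|Dj]; rewrite coefB coefZ.
    have lE : (newton D)`_D = lead_coef (newton D) by rewrite lead_coefE size_newton.
    by rewrite lE divfK // subrr.
  by rewrite !nth_default ?size_newton ?mulr0 ?subr0 // (leq_trans GD).
exists (fun j => if j == D then d else c j); rewrite big_ord_recr /= eqxx.
rewrite -[LHS](subrK (d *: newton D)) cE; congr (_ + _); apply: eq_bigr => j _.
by rewrite ltn_eqF.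
Qed.

Lemma expr_sub_qint i j : (i <= j)%N ->
  p ^+ j - p ^+ i = (p - 1) * p ^+ i * qint p (j - i).
Proof.
move=> ij; rewrite /qint -{1}(subnK ij) exprD; field.
by rewrite subr_eq0 eq_sym -[p]expr1 p_free.
Qed.

Lemma newton_qint j m : (j <= m)%N -> (newton j).[p ^+ m] =
  \prod_(i < j) (qint p (m - i) * (qint p (j - i))^-1).
Proof.
move=> jm; rewrite horner_newton; apply: eq_bigr => i _; have ij := ltn_ord i.
have p1 : p - 1 != 0 by rewrite subr_eq0 -[p]expr1 p_free.
rewrite !expr_sub_qint ?(leq_trans (ltnW ij)) ?(ltnW ij) //.
have -> : (j - i)%N = (j - i).-1.+1 by lia.
by field; rewrite p1 expf_neq0 // qint_neq0.
Qed.

(** Rewrites each factor through (x - 1)/(p - 1) and q-integers. At a group-like element all these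
    ingredients lie in the regular form, although p^j - p^i vanishes at q = 1. *)
Lemma horner_alg_newton (B : algType K) (x : B) j : horner_alg x (newton j) =
  \prod_(i < j) ((p ^- i * (qint p (j - i))^-1) *:
    ((p - 1)^-1 *: (x - 1) - qint p i *: 1)).
Proof.
rewrite /newton rmorph_prod; apply: eq_bigr => i _; have ij := ltn_ord i.
have p1 : p - 1 != 0 by rewrite subr_eq0 -[p]expr1 p_free.
rewrite /= linearZ_LR /= mulr_algl rmorphB /= horner_algX horner_algC.
have -> : (p - 1)^-1 *: (x - 1) - qint p i *: 1 = (p - 1)^-1 *: (x - p ^+ i *: 1).
  have -> : qint p i = (p - 1)^-1 * (p ^+ i - 1).
    by rewrite /qint; field; rewrite p1 subr_eq0 eq_sym -[p]expr1 p_free.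
  by rewrite -scalerA -scalerBr scalerBl scale1r opprB addrA subrK.
rewrite expr_sub_qint ?(ltnW ij) // scalerA; congr (_ *: _).
have -> : (j - i)%N = (j - i).-1.+1 by lia.
by field; rewrite p1 expf_neq0 // qint_neq0.
Qed.

End NewtonBasis.

(** [laurent x y] relates a Laurent polynomial in [1 (x) kappa] with coefficients
    in [A (x) 1] to its sequence of values at [kappa = p ^+ m]. *)
Section Laurent.
Variables (K : fieldType) (p : K) (A B : algType K) (kappa kappa' : B).
Hypotheses (kk' : kappa * kappa' = 1) (k'k : kappa' * kappa = 1).
Hypotheses (p0 : p != 0) (p_free : forall n, p ^+ n.+1 != 1).
Local Notation T := (tensor A B).

Inductive laurent : T -> (nat -> A) -> Prop :=
| laurent_pure a (G : {poly K}) N : laurent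
    (a ⊗ (horner_alg kappa G * kappa' ^+ N))
    (fun m => (G.[p ^+ m] / (p ^+ m) ^+ N) *: a)
| laurent_add x x' y y' : laurent x y -> laurent x' y' ->
    laurent (x + x') (fun m => y m + y' m).

Lemma laurent_eq x y y' : laurent x y -> y =1 y' -> laurent x y'.
Proof. by move=> xy /funext <-. Qed.

Lemma laurent_const a : laurent (a ⊗ 1) (fun=> a).
Proof.
have := laurent_pure a 1 0; rewrite rmorph1 mul1r expr0 => /laurent_eq; apply=> m.
by rewrite hornerC expr0 divr1 scale1r.
Qed.

Lemma laurent_kappa a : laurent (a ⊗ kappa) (fun m => p ^+ m *: a).
Proof.
have := laurent_pure a 'X 0; rewrite /horner_alg horner_morphX mulr1.
move/laurent_eq; apply=> m; by rewrite hornerX expr0 divr1.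
Qed.

Lemma laurent_kappa' a : laurent (a ⊗ kappa') (fun m => (p ^+ m)^-1 *: a).
Proof.
have := laurent_pure a 1 1; rewrite rmorph1 mul1r expr1 => /laurent_eq; apply=> m.
by rewrite hornerC mul1r.
Qed.

Lemma laurentZ c x y : laurent x y -> laurent (c *: x) (fun m => c *: y m).
Proof.
elim=> {x y} [a G N|x x' y y' _ IH _ IH'].
  rewrite -tpureZl; apply: laurent_eq (laurent_pure (c *: a) G N) _ => m.
  by rewrite !scalerA mulrC.
rewrite scalerDr; apply: laurent_eq (laurent_add IH IH') _ => m.
by rewrite scalerDr.
Qed.

Lemma laurent0 : laurent 0 (fun=> 0).
Proof.
rewrite -(scale0r (0 ⊗ 1)); apply: laurent_eq (laurentZ 0 (laurent_const 0)) _ => m.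
by rewrite scale0r.
Qed.

Lemma laurent_sum (I : Type) (r : seq I) (x : I -> T) (y : I -> nat -> A) :
  (forall i, laurent (x i) (y i)) ->
  laurent (\sum_(i <- r) x i) (fun m => \sum_(i <- r) y i m).
Proof.
move=> xy; elim: r => [|i r IHr].
  rewrite big_nil; apply: laurent_eq laurent0 _ => m; by rewrite big_nil.
rewrite big_cons; apply: laurent_eq (laurent_add (xy i) IHr) _ => m.
by rewrite big_cons.
Qed.

Lemma horner_alg_comm G N :
  kappa' ^+ N * horner_alg kappa G = horner_alg kappa G * kappa' ^+ N.
Proof.
apply/esym/commrX; elim/poly_ind: G => [|G c IH].
  by rewrite rmorph0 /GRing.comm mul0r mulr0.
rewrite rmorphD rmorphM /= /horner_alg !horner_morphX horner_morphC -/(horner_alg _ _).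
rewrite /GRing.comm mulrDl mulrDr -[in LHS]mulrA kk' -k'k mulrA IH !mulrA.
by rewrite -scalerAl -scalerAr mul1r mulr1.
Qed.

Lemma laurentM x x' y y' : laurent x y -> laurent x' y' ->
  laurent (x * x') (fun m => y m * y' m).
Proof.
move=> xy; elim=> {x' y'} [b H M|x1 x2 y1 y2 _ IH1 _ IH2]; last first.
  rewrite mulrDr; apply: laurent_eq (laurent_add IH1 IH2) _ => m.
  by rewrite mulrDr.
elim: xy => {x y} [a G N|x1 x2 y1 y2 _ IH1 _ IH2]; last first.
  rewrite mulrDl; apply: laurent_eq (laurent_add IH1 IH2) _ => m.
  by rewrite mulrDl.
have E : horner_alg kappa G * kappa' ^+ N * (horner_alg kappa H * kappa' ^+ M) =
    horner_alg kappa (G * H) * kappa' ^+ (N + M).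
  by rewrite rmorphM exprD -[LHS]mulrA [kappa' ^+ N * (horner_alg _ _ * _)]mulrA
    horner_alg_comm !mulrA.
rewrite tpureM E; apply: laurent_eq (laurent_pure (a * b) (G * H) (N + M)) _ => m.
rewrite hornerM exprD invfM -scalerAl -scalerAr scalerA; congr (_ *: _).
by rewrite mulrACA.
Qed.

Definition fps_laurent (X : fps T) (Y : nat -> fps A) :=
  forall n, laurent (fcoef X n) (fun m => fcoef (Y m) n).

Lemma fps_laurentM X X' Y Y' : fps_laurent X Y -> fps_laurent X' Y' ->
  fps_laurent (X * X') (fun m => Y m * Y' m).
Proof.
by move=> XY XY' n; rewrite fcoefM; apply: laurent_sum => i; exact: laurentM.
Qed.

Lemma fps_laurent_const f : fps_laurent (fps_map (tinl B) f) (fun=> f).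
Proof. by move=> n; exact: laurent_const. Qed.

Lemma fps_laurent1 : fps_laurent 1 (fun=> 1).
Proof.
by case=> [|n]; [exact: (laurent_const 1)|exact: laurent0].
Qed.

Lemma fps_laurent_mono n x y : laurent x y ->
  fps_laurent (fps_mono n x) (fun m => fps_mono n (y m)).
Proof. by move=> xy k /=; case: eqP => _ //; exact: laurent0. Qed.

Lemma fps_laurentX X Y k : fps_laurent X Y -> fps_laurent (X ^+ k) (fun m => Y m ^+ k).
Proof.
move=> XY; elim: k => [|k IHk]; first exact: fps_laurent1.
rewrite exprS (_ : (fun m => _) = fun m => Y m * Y m ^+ k); first exact: fps_laurentM.
by apply/funext => m; exact: exprS.
Qed.

Lemma fps_laurent_qexp r X Y : fps_laurent X Y ->
  fps_laurent (qexp r X) (fun m => qexp r (Y m)).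
Proof.
move=> XY n /=; apply: laurent_sum => k; apply: laurentZ.
exact: (fps_laurentX k XY).
Qed.

Lemma fps_laurentN X Y : fps_laurent X Y -> fps_laurent (- X) (fun m => - Y m).
Proof.
move=> XY n; rewrite fcoefN -scaleN1r; apply: laurent_eq (laurentZ (-1) (XY n)) _ => m.
by rewrite scaleN1r.
Qed.

(** Normal form with one pole order [N] and one degree bound [D]. Both are quantified as all
    sufficiently large values, so that two elements can be brought to the same form before being
    added. *)
Lemma laurent_normal x y : laurent x y -> exists N0, forall N, (N0 <= N)%N ->
  exists D0, forall D, (D0 <= D)%N -> exists b : nat -> A,
  x = \sum_(j < D) b j ⊗ (horner_alg kappa (newton p j) * kappa' ^+ N) /\
  forall m, y m = (p ^+ m) ^- N *: \sum_(j < D) (newton p j).[p ^+ m] *: b j.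
Proof.
elim=> {x y} [a G N0|x x' y y' _ [N0 IH] _ [N1 IH']].
  exists N0 => N N0N; exists (size (G * 'X^(N - N0))) => D sD.
  have [c cE] := newton_span p0 p_free sD.
  exists (fun j => c j *: a); split.
    transitivity (a ⊗ (horner_alg kappa (G * 'X^(N - N0)) * kappa' ^+ N)).
      rewrite rmorphM rmorphXn /= horner_algX -mulrA; congr (_ ⊗ (_ * _)).
      rewrite -{2}(subnK N0N) exprD mulrA -exprMn_comm ?kk' ?expr1n ?mul1r //.
      by rewrite /GRing.comm kk' k'k.
    rewrite cE linear_sum mulr_suml (big_morph _ (tpureDr a) (tpure0r B a)).
    by apply: eq_bigr => j _; rewrite linearZ_LR /= mulr_algl -scalerAl tpure_bal.
  move=> m; under eq_bigr => j _ do rewrite scalerA mulrC -hornerZ.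
  rewrite -scaler_suml -horner_sum -cE hornerM hornerXn scalerA; congr (_ *: _).
  have pm0 : p ^+ m != 0 by rewrite expf_neq0.
  have -> : (p ^+ m) ^+ N = (p ^+ m) ^+ (N - N0) * (p ^+ m) ^+ N0.
    by rewrite -exprD subnK.
  by field; rewrite !expf_neq0.
exists (maxn N0 N1) => N; rewrite geq_max => /andP[N0N N1N].
have [D0 h] := IH N N0N; have [D1 h'] := IH' N N1N.
exists (maxn D0 D1) => D; rewrite geq_max => /andP[D0D D1D].
have [b [-> yE]] := h D D0D; have [b' [-> yE']] := h' D D1D.
exists (fun j => b j + b' j); split=> [|m].
  by rewrite -big_split; apply: eq_bigr => j _; rewrite tpureDl.
rewrite yE yE' -scalerDr -big_split; congr (_ *: _).
by apply: eq_bigr => j _; rewrite scalerDr.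
Qed.

Variables (S : A -> Prop) (S' : B -> Prop).
Hypotheses (S0 : S 0) (SB : forall a b, S a -> S b -> S (a - b)).
Hypothesis (SX : forall k a, S a -> S (p ^+ k *: a)).
Hypothesis (Snewton : forall j m a, (j <= m)%N -> S a -> S ((newton p j).[p ^+ m] *: a)).
Hypothesis (S'newton : forall j N, S' (horner_alg kappa (newton p j) * kappa' ^+ N)).

(** Newton interpolation without division: the matrix of the values of [newton i] at p^j is
    unitriangular with Gaussian binomial entries, so the coefficients are obtained from the values
    inside [S]. Here [S] plays the role of the regular form. *)
Lemma laurent_interpolation x y : laurent x y -> (forall m, S (y m)) ->
  exists s : seq (A * B), (forall c, c \in s -> S c.1 /\ S' c.2) /\
  x = \sum_(c <- s) c.1 ⊗ c.2.
Proof.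
move=> xy Sy; have [N0 /(_ N0 (leqnn _)) [D /(_ D (leqnn _)) [b [-> yE]]]] :=
  laurent_normal xy.
have Ssum (r : seq nat) (F : nat -> A) : (forall i, i \in r -> S (F i)) ->
    S (\sum_(i <- r) F i).
  elim: r => [|i r IHr] SF; first by rewrite big_nil.
  rewrite big_cons -[X in _ + X]opprK; apply: SB; first by apply: SF; rewrite mem_head.
  rewrite -[- _]sub0r; apply: SB => //; apply: IHr => j jr.
  by apply: SF; rewrite in_cons jr orbT.
have Sb j : (j < D)%N -> S (b j).
  have [n jn] := ubnP j; elim: n j jn => // n IHn j; rewrite ltnS => jn jD.
  (* Evaluation at p^j: the terms with i > j vanish, the one with i = j is [b j], and those with i <
     j lie in [S] by induction. *)
  have /(congr1 ( *:%R ((p ^+ j) ^+ N0))) := yE j.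
  rewrite scalerA divff ?expf_neq0 // scale1r -exprM.
  rewrite -(big_mkord xpredT (fun i => (newton p i).[p ^+ j] *: b i)).
  rewrite (big_cat_nat (n := j.+1)) //= big_nat_recr //=.
  rewrite newton_diag // scale1r [X in _ + X]big_nat_cond [X in _ + X]big1 ?addr0.
    move=> E; rewrite -(addrK (\sum_(0 <= i < j) (newton p i).[p ^+ j] *: b i) (b j)).
    rewrite addrC -[b j + _]addrC -E addrC; apply: SB; first exact: SX.
    apply: Ssum => i; rewrite mem_index_iota => /andP[_ ij].
    by apply: Snewton; [exact: ltnW|apply: IHn; lia].
  by move=> i /andP[/andP[ji _] _]; rewrite newton_lt // scale0r.
exists [seq (b j, horner_alg kappa (newton p j) * kappa' ^+ N0) | j <- iota 0 D].
split=> [c /mapP[j]|]; last by rewrite big_map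
  -[X in iota _ X]subn0 -/(index_iota 0 D) big_mkord.
by rewrite mem_iota => jD -> /=; split; [exact: Sb|exact: S'newton].
Qed.

End Laurent.

(** * Gauge transformations of twists *)

Lemma tlift_additive (K : fieldType) (A B : algType K) (M : nmodType)
    (G : tensor A B -> M) x : nmod_morphism G ->
  tlift (fun a b => G (a ⊗ b)) x = G x.
Proof.
move=> [G0 GD]; rewrite -[in RHS](tlift_pureE x) /tlift.
by rewrite (big_morph G GD G0).
Qed.

(** Gives a closed form to the continuous extension of a map that sandwiches a morphism between two
    fixed series. Both sides are sums over the exponents of the three factors, in different
    orders. *)
Lemma fps_ext_conj (K : fieldType) (A B : algType K) (psi : {lrmorphism A -> B})
    (P Q : fps B) (phi : A -> fps B) f :
  (forall a, phi a = P * fps_mono 0 (psi a) * Q) ->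
  fps_ext phi f = P * fps_map psi f * Q.
Proof.
move=> phiE; apply/fpsP => n; rewrite -[LHS]/(\sum_(i < n.+1) _).
have phiC a k : fcoef (phi a) k = \sum_(j < k.+1) fcoef P j * psi a * fcoef Q (k - j).
  rewrite phiE fcoefM; apply: eq_bigr => j _; congr (_ * _).
  rewrite fcoefM big_ord_recr /= subnn big1 ?add0r // => i _.
  by rewrite subn_eq0 leqNgt ltn_ord mulr0.
under eq_bigr => i _ do rewrite phiC.
(* Turns a range that depends on [m] into a condition on a fixed range, so that the sums can be
   exchanged. *)
have unn m (G : nat -> B) : (m <= n)%N ->
    \sum_(j < (n - m).+1) G j = \sum_(j < n.+1 | (m + j <= n)%N) G j.
  move=> mn; rewrite (big_ord_widen n.+1 G) ?ltnS ?leq_subr //.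
  by apply: eq_bigl => j; rewrite ltnS leq_subRL.
rewrite -mulrA fcoefM.
under [RHS]eq_bigr => j _.
  rewrite fcoefM mulr_sumr (unn j (fun i => fcoef P j *
    (fcoef (fps_map psi f) i * fcoef Q (n - j - i)))); last by rewrite -ltnS.
  over.
rewrite (exchange_big_dep xpredT) //=; apply: eq_bigr => i _.
rewrite (unn i (fun j => fcoef P j * psi (fcoef f i) * fcoef Q (n - i - j))) //.
  by apply: eq_big => [j|j _]; rewrite 1?addnC // mulrA -!subnDA addnC.
by rewrite -ltnS.
Qed.

Section Gauge.
Variables (K : fieldType) (A : algType K).
Variable D : {lrmorphism A -> tensor A A}.
Local Notation A2 := (tensor A A).
Local Notation A3 := (tensor A2 A).

Definition copl : A2 -> A3 := tmap D idfun.
Definition copr : A2 -> A3 := @tassoc K A \o tmap idfun D.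
HB.instance Definition _ := GRing.LRMorphism.on copl.
HB.instance Definition _ := GRing.LRMorphism.on copr.

Hypothesis coassoc : forall a, copl (D a) = copr (D a).

(** Only the cocycle equation of a twist; the counit conditions are handled separately in
    [counit_gauge]. *)
Definition drinfeld (T : fps A2) : Prop :=
  fps_map (@leg12 K A) T * fps_map copl T =
  fps_map (@leg23 K A) T * fps_map copr T.

Definition twist_cop (J : fps A2) : fps A -> fps A2 :=
  fun a => J * fps_map D a * J^-1.

(** Twisting affects the first two legs only, and an element of the third leg commutes with J^-1
    placed there; hence the twisted coproduct acts on one leg by conjugation. [id_cop_twist] is the
    mirror image. *)
Lemma cop_id_twist J F : cop_id (twist_cop J) F =
  fps_map (@leg12 K A) J * fps_map copl F * fps_map (@leg12 K A) J^-1.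
Proof.
apply: fps_ext_conj => x; set P := fps_map _ J; set Q := fps_map _ J^-1.
rewrite -[RHS](tlift_additive x (G := fun x => P * fps_mono 0 (copl x) * Q)).
  congr (tlift _ x); apply/funext => a; apply/funext => b.
  rewrite fps_tensorE !fps_mapM !fps_map_mono -!mulrA; congr (_ * _).
  rewrite -(fps_map_mono (tinr A2)).
  rewrite (fps_map_comm (phi := tinl A) (psi := tinr A2)); last first.
    exact: tinlr_comm.
  by rewrite fps_map_mono mulrA fps_monoM -tinlrE [copl _]tmapE.
split=> [|y z]; first by rewrite rmorph0 fps_mono_0 mulr0 mul0r.
by rewrite rmorphD fps_monoD mulrDr mulrDl.
Qed.

Lemma id_cop_twist J F : id_cop (twist_cop J) F =
  fps_map (@leg23 K A) J * fps_map copr F * fps_map (@leg23 K A) J^-1.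
Proof.
apply: fps_ext_conj => x; set P := fps_map _ J; set Q := fps_map _ J^-1.
rewrite -[RHS](tlift_additive x (G := fun x => P * fps_mono 0 (copr x) * Q)).
  congr (tlift _ x); apply/funext => a; apply/funext => b.
  rewrite fps_tensorE fps_mapM !fps_map_mono.
  have comm f : fps_mono 0 (tassoc (a ⊗ 1)) * fps_map (@leg23 K A) f =
      fps_map (@leg23 K A) f * fps_mono 0 (tassoc (a ⊗ 1)).
    rewrite -(fps_map_mono (@tassoc K A \o tinl A2)).
    apply: fps_map_comm => c d; rewrite -[leg23 d]/(tassoc (tinr A d)).
    by rewrite -[_ c]/(tassoc (tinl A2 c)) -!rmorphM /= tinlr_comm.
  rewrite /twist_cop !fps_mapM !fps_map_mono.
  rewrite -[fps_map _ (fps_map _ J)]/P -[fps_map _ (fps_map _ J^-1)]/Q.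
  rewrite !mulrA comm -!mulrA; congr (P * _); rewrite !mulrA; congr (_ * Q).
  rewrite fps_monoM -rmorphM -tinlrE; congr fps_mono.
  by rewrite /copr /= tmapE.
split=> [|y z]; first by rewrite rmorph0 fps_mono_0 mulr0 mul0r.
by rewrite rmorphD fps_monoD mulrDr mulrDl.
Qed.

(** Multiply both sides on the right by X = J^12 (Delta (x) id)(J) = J^23 (id (x) Delta)(J): every
    occurrence of [J] cancels, and the cocycle equation of [T] remains. *)
Lemma twist_quotient T J : J \is a GRing.unit -> drinfeld T -> drinfeld J ->
  fps_map (@leg12 K A) (T * J^-1) * cop_id (twist_cop J) (T * J^-1) =
  fps_map (@leg23 K A) (T * J^-1) * id_cop (twist_cop J) (T * J^-1).
Proof.
move=> Ju dT dJ; rewrite cop_id_twist id_cop_twist.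
pose X := fps_map (@leg12 K A) J * fps_map copl J.
have Xu : X \is a GRing.unit by rewrite rpredM ?fps_map_unit.
have step (B : unitRingType) (x x' y y' : B) : y \is a GRing.unit ->
    y' \is a GRing.unit -> x * y^-1 * (y * (x' * y'^-1) * y^-1) * (y * y') = x * x'.
  by move=> yu yu'; rewrite -!mulrA mulKr // mulKr // mulVr // mulr1.
have mapQ (B : algType K) (phi : {lrmorphism A2 -> B}) :
    fps_map phi (T * J^-1) = fps_map phi T * (fps_map phi J)^-1.
  by rewrite fps_mapM fps_mapV.
apply: (mulIr Xu); rewrite {2}/X dJ /X !mapQ (fps_mapV _ Ju) (fps_mapV _ Ju).
have := dT; rewrite /drinfeld.
rewrite -(step _ (fps_map (@leg12 K A) T) (fps_map copl T) _ _
  (fps_map_unit (@leg12 K A) Ju) (fps_map_unit copl Ju)).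
rewrite -(step _ (fps_map (@leg23 K A) T) (fps_map copr T) _ _
  (fps_map_unit (@leg23 K A) Ju) (fps_map_unit copr Ju)).
by [].
Qed.

(** With x1, x2, x3 the copies of [X] in the three legs, each side becomes x1 x2 x3 times the
    corresponding side for [T], times the same inverse by coassociativity. The copy in the leg that
    [T] does not touch commutes with [T]. *)
Lemma drinfeld_gauge X T : X \is a GRing.unit -> drinfeld T ->
  drinfeld ((X ⊗t X) * T * fps_map D X^-1).
Proof.
move=> Xu dT.
pose x1 := fps_map (@leg12 K A) (fps_map (tinl A) X).
pose x2 := fps_map (@leg12 K A) (fps_map (tinr A) X).
pose x3 := fps_map (tinr A2) X.
have l12 : fps_map (@leg12 K A) (X ⊗t X) = x1 * x2.
  by rewrite fps_tensorE fps_mapM.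
have l23 : fps_map (@leg23 K A) (X ⊗t X) = x2 * x3.
  rewrite fps_tensorE fps_mapM; congr (_ * _); apply/fpsP => n /=;
  by rewrite /leg23 /tinl /tinr tassocE.
have cl : fps_map copl (X ⊗t X) = fps_map (@leg12 K A) (fps_map D X) * x3.
  rewrite fps_tensorE fps_mapM; congr (_ * _); apply/fpsP => n /=;
  by rewrite /copl /tinl /tinr tmapE ?rmorph1.
have cr : fps_map copr (X ⊗t X) = fps_map (@leg23 K A) (fps_map D X) * x1.
  rewrite fps_tensorE fps_mapM.
  have -> : fps_map copr (fps_map (tinl A) X) = x1.
    apply/fpsP => n /=; rewrite /copr /tinl /= tmapE rmorph1.
    by rewrite -[1]/(1 ⊗ 1) tassocE.
  have -> : fps_map copr (fps_map (tinr A) X) = fps_map (@leg23 K A) (fps_map D X).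
    by apply/fpsP => n /=; rewrite /copr /tinr /= tmapE.
  apply: (@fps_map_comm _ _ _ _ (@leg12 K A \o tinl A) (@leg23 K A)) => a y /=.
  rewrite [leg12 _](esym (tassocE a 1 1)) -[a ⊗ _]/(tinl A2 a).
  by rewrite -[leg23 y]/(tassoc (tinr A y)) -!rmorphM tinlr_comm.
have c3 f : fps_map (@leg12 K A) f * x3 = x3 * fps_map (@leg12 K A) f.
  by apply: (@fps_map_comm _ _ _ _ (@leg12 K A) (tinr A2)) => y a; exact: tinlr_comm.
have c1 f : fps_map (@leg23 K A) f * x1 = x1 * fps_map (@leg23 K A) f.
  apply/esym/(@fps_map_comm _ _ _ _ (@leg12 K A \o tinl A) (@leg23 K A)) => a y /=.
  rewrite [leg12 _](esym (tassocE a 1 1)) -[a ⊗ _]/(tinl A2 a).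
  by rewrite -[leg23 y]/(tassoc (tinr A y)) -!rmorphM tinlr_comm.
have DX (phi : {lrmorphism A2 -> A3}) :
    fps_map phi (fps_map D X^-1) * fps_map phi (fps_map D X) = 1.
  by rewrite -!fps_mapM mulVr // !fps_map1.
have DDX : fps_map copl (fps_map D X^-1) = fps_map copr (fps_map D X^-1).
  by apply/fpsP => n /=; exact: coassoc.
rewrite /drinfeld !fps_mapM cl cr l12 l23 DDX !mulrA.
congr (_ * fps_map copr _).
rewrite -(mulrA (x1 * x2 * _)) DX mulr1 -(mulrA (x2 * x3 * _)) DX mulr1.
have alg (B : nzRingType) (a b c s t u v : B) : s * c = c * s ->
    t * a = a * t -> b * c * a = a * (b * c) -> s * u = t * v ->
    a * b * s * c * u = b * c * t * a * v.
  move=> sc ta bca su; rewrite -[a * b * s * c]mulrA sc -[b * c * t * a]mulrA ta.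
  by rewrite !mulrA bca -!mulrA su.
by apply: alg; [exact: c3|exact: c1|rewrite -l23 c1|exact: dT].
Qed.

Lemma drinfeld1 : drinfeld 1.
Proof. by rewrite /drinfeld !fps_map1. Qed.

(** [J] is the gauge transform of 1 by [W], and F J is that of [T] by W V, because the inner factors
    W^-1 and W cancel. Thus [F] is a quotient of two twists. *)
Lemma gauge_twist W V T : W \is a GRing.unit -> V \is a GRing.unit ->
  drinfeld T ->
  let J := (W ⊗t W) * fps_map D W^-1 in
  let F := ((W * V) ⊗t (W * V)) * T * fps_map D V^-1 * (W^-1 ⊗t W^-1) in
  fps_map (@leg12 K A) F * cop_id (twist_cop J) F =
  fps_map (@leg23 K A) F * id_cop (twist_cop J) F.
Proof.
move=> Wu Vu dT J F.
have WVu : W * V \is a GRing.unit by rewrite rpredM.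
have dJ : drinfeld J by rewrite /J -[W ⊗t W]mulr1; apply: drinfeld_gauge drinfeld1.
have WW : (W^-1 ⊗t W^-1) * (W ⊗t W) = 1.
  rewrite !fps_tensorE.
  have inv (B : nzRingType) (x x' y y' : B) : x' * x = 1 -> y' * y = 1 ->
      x * y' = y' * x -> x' * y' * (x * y) = 1.
    move=> xx yy xy; rewrite -mulrA [y' * _]mulrA -xy -mulrA yy mulr1; exact: xx.
  apply: inv; [| |apply: fps_map_comm; exact: tinlr_comm].
  - by rewrite -(fps_mapM (tinl A)) mulVr // fps_map1.
  - by rewrite -(fps_mapM (tinr A)) mulVr // fps_map1.
have Ju : J \is a GRing.unit.
  rewrite rpredM ?fps_map_unit ?rpredV // fps_tensorE rpredM //.
    exact: (fps_map_unit (tinl A) Wu).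
  exact: (fps_map_unit (tinr A) Wu).
have FJ : F * J = ((W * V) ⊗t (W * V)) * T * fps_map D (W * V)^-1.
  rewrite (invrM Wu Vu) (fps_mapM D).
  have cancel (B : nzRingType) (x y z z' t : B) :
      z * z' = 1 -> x * y * z * (z' * t) = x * (y * t).
    by move=> zz; rewrite -[x * y * z]mulrA -mulrA -mulrA [z * _]mulrA zz mul1r.
  exact: cancel WW.
have -> : F = ((W * V) ⊗t (W * V)) * T * fps_map D (W * V)^-1 * J^-1.
  by rewrite -FJ mulrK.
by apply: twist_quotient => //; exact: drinfeld_gauge.
Qed.

End Gauge.

(** * Counit conditions under gauge transformation *)

Section Counit.
Variables (K : fieldType) (A : algType K).
Variables (D : {lrmorphism A -> tensor A A}) (e : {lrmorphism A -> K^o}).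
Local Notation A2 := (tensor A A).

Definition counl : A2 -> A := tlift (fun a b => e a *: b).
Definition counr : A2 -> A := tlift (fun a b => e b *: a).

Fact counl_bimorphism : bimorphism (fun a b : A => e a *: b).
Proof.
split=> [a a' b|a b b'|c a b|c a b||a a' b b'].
- by rewrite rmorphD scalerDl.
- by rewrite scalerDr.
- by rewrite linearZ_LR scalerA.
- by rewrite !scalerA mulrC.
- by rewrite rmorph1 scale1r.
- by rewrite rmorphM -scalerAl -scalerAr scalerA.
Qed.

Fact counr_bimorphism : bimorphism (fun a b : A => e b *: a).
Proof.
split=> [a a' b|a b b'|c a b|c a b||a a' b b'].
- by rewrite scalerDr.
- by rewrite rmorphD scalerDl.
- by rewrite !scalerA mulrC.
- by rewrite linearZ_LR scalerA.
- by rewrite rmorph1 scale1r.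
- by rewrite rmorphM -scalerAl -scalerAr scalerA.
Qed.

Fact counl_nmod : nmod_morphism counl.
Proof.
have bal := bimorphism_balanced counl_bimorphism.
by split=> [|x y]; [exact: tlift0|exact: tliftD].
Qed.
Fact counl_monoid : monoid_morphism counl.
Proof.
by split=> [|x y];
  [exact: (tlift1 counl_bimorphism)|exact: (tliftM counl_bimorphism)].
Qed.
Fact counl_scalable : scalable counl.
Proof. by move=> c x; exact: (tliftZ counl_bimorphism). Qed.
HB.instance Definition _ := GRing.isNmodMorphism.Build A2 A counl counl_nmod.
HB.instance Definition _ := GRing.isMonoidMorphism.Build A2 A counl counl_monoid.
HB.instance Definition _ := GRing.isScalable.Build K A2 A *:%R counl counl_scalable.

Fact counr_nmod : nmod_morphism counr.
Proof.
have bal := bimorphism_balanced counr_bimorphism.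
by split=> [|x y]; [exact: tlift0|exact: tliftD].
Qed.
Fact counr_monoid : monoid_morphism counr.
Proof.
by split=> [|x y];
  [exact: (tlift1 counr_bimorphism)|exact: (tliftM counr_bimorphism)].
Qed.
Fact counr_scalable : scalable counr.
Proof. by move=> c x; exact: (tliftZ counr_bimorphism). Qed.
HB.instance Definition _ := GRing.isNmodMorphism.Build A2 A counr counr_nmod.
HB.instance Definition _ := GRing.isMonoidMorphism.Build A2 A counr counr_monoid.
HB.instance Definition _ := GRing.isScalable.Build K A2 A *:%R counr counr_scalable.

Lemma counlE a b : counl (a ⊗ b) = e a *: b.
Proof. exact: tlift_pure (bimorphism_balanced counl_bimorphism). Qed.

Lemma counrE a b : counr (a ⊗ b) = e b *: a.
Proof. exact: tlift_pure (bimorphism_balanced counr_bimorphism). Qed.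

Hypothesis counitl : forall a, counl (D a) = a.
Hypothesis counitr : forall a, counr (D a) = a.

Lemma counl_tensor f g : fps_map e f = 1 -> fps_map counl (f ⊗t g) = g.
Proof.
move=> f1; rewrite fps_tensorE fps_mapM.
have -> : fps_map counl (fps_map (tinl A) f) = 1.
  apply/fpsP => n /=; rewrite counlE; move/fpsP/(_ n): f1 => /= ->.
  by case: eqP => _; rewrite ?scale1r ?scale0r.
rewrite mul1r; apply/fpsP => n /=; by rewrite counlE rmorph1 scale1r.
Qed.

Lemma counr_tensor f g : fps_map e g = 1 -> fps_map counr (f ⊗t g) = f.
Proof.
move=> f1; rewrite fps_tensorE fps_mapM.
have -> : fps_map counr (fps_map (tinr A) g) = 1.
  apply/fpsP => n /=; rewrite counrE; move/fpsP/(_ n): f1 => /= ->.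
  by case: eqP => _; rewrite ?scale1r ?scale0r.
rewrite mulr1; apply/fpsP => n /=; by rewrite counrE rmorph1 scale1r.
Qed.

(** Applying the counit to one leg trivializes that leg and undoes the coproduct, which leaves W V
    V^-1 W^-1 = 1 in the other leg. *)
Lemma counit_gauge W V T : W \is a GRing.unit -> V \is a GRing.unit ->
  fps_map e W = 1 -> fps_map e V = 1 ->
  fps_map counl T = 1 -> fps_map counr T = 1 ->
  let F := ((W * V) ⊗t (W * V)) * T * fps_map D V^-1 * (W^-1 ⊗t W^-1) in
  fps_map counl F = 1 /\ fps_map counr F = 1.
Proof.
move=> Wu Vu W1 V1 Tl Tr F.
have X1 : fps_map e (W * V) = 1 by rewrite fps_mapM W1 V1 mulr1.
have WV1 : fps_map e W^-1 = 1 by rewrite fps_mapV // W1 invr1.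
have WVK : W * V * V^-1 * W^-1 = 1 by rewrite mulrK // mulrV.
split; rewrite /F !fps_mapM.
  rewrite !counl_tensor // Tl mulr1 (_ : fps_map counl (fps_map D _) = V^-1) //.
  by apply/fpsP => n; exact: counitl.
rewrite !counr_tensor // Tr mulr1 (_ : fps_map counr (fps_map D _) = V^-1) //.
by apply/fpsP => n; exact: counitr.
Qed.

End Counit.

(** * The Hopf algebra structure *)

Lemma Uq_ext (K : fieldType) (q : K) (A : algType K)
    (phi psi : {lrmorphism Uq q -> A}) :
  (forall g, phi (pgen (uq_rel q) g) = psi (pgen (uq_rel q) g)) -> phi =1 psi.
Proof.
move=> gens u; have [x ->] := pi_pres_surj u; rewrite pi_Uq.
elim: x => [g|c|x IHx y IHy|x IHx y IHy] /=; first exact: gens.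
- by rewrite !linearZ_LR /= !rmorph1.
- by rewrite !rmorphD /= IHx IHy.
- by rewrite !rmorphM /= IHx IHy.
Qed.

(** * Commutation relations between the elements that enter the twist *)

Section Relations.
Variables (K : fieldType) (q : K).
Hypotheses (q0 : q != 0) (q2 : q ^+ 2 != 1).
Local Notation U := (Uq q).
Local Notation e := (ue q).
Local Notation f := (uf q).
Local Notation L := (uL q).
Local Notation L' := (uLinv q).

(* With [E = e_(1+2) L_1] and [g = e_1 L_1^2 L_2^-2], the elements [E], [f_2] and
   [g] satisfy [E f_2 - f_2 E = q g], [E g = q^2 g E], [g f_2 = q^2 f_2 g]; the
   group-like [K = L_1^-2 L_2^2] commutes with [E] and [e_1 = g K]. *)
Definition ue12 : U := e i1 * e i2 - q *: (e i2 * e i1).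
Definition uE : U := ue12 * L i1.
Definition ug : U := e i1 * L i1 ^+ 2 * L' i2 ^+ 2.
Definition uK : U := L' i1 ^+ 2 * L i2 ^+ 2.
Definition uK' : U := L i1 ^+ 2 * L' i2 ^+ 2.

Lemma qcommDr (A : algType K) c (x y z : A) :
  qcomm c x y -> qcomm c x z -> qcomm c x (y + z).
Proof. by rewrite /qcomm mulrDr mulrDl scalerDr => -> ->. Qed.

Lemma qcommZr (A : algType K) c d (x y : A) :
  qcomm c x y -> qcomm c x (d *: y).
Proof. by rewrite /qcomm -scalerAr -scalerAl => ->; rewrite !scalerA mulrC. Qed.

Lemma qcomm_symV (A : algType K) c (x y : A) : c != 0 ->
  qcomm c y x -> qcomm c^-1 x y.
Proof. exact: qcomm_sym. Qed.

Lemma qcomm1P (A : algType K) (x y : A) : qcomm 1 x y -> x * y = y * x.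
Proof. by rewrite /qcomm scale1r. Qed.

Lemma qLe12 i : qcomm q (L i) ue12.
Proof.
have h j k : j != k -> qcomm q (L i) (e j * e k).
  move=> jk; apply: qcomm_eq (qcommMr (qLe q i j) (qLe q i k)) _.
  by move: jk; case: (ord2P i) => ->; case: (ord2P j) => ->; case: (ord2P k) => ->;
    rewrite //= expr0 expr1 ?mulr1 ?mul1r.
by apply: qcommDr; rewrite -?scaleN1r; do ?apply: qcommZr; exact: h.
Qed.

Lemma qLinve12 i : qcomm q^-1 (L' i) ue12.
Proof. by apply: qcomm_inv (qLe12 i); rewrite ?uLLinv ?uLinvL. Qed.

Ltac qcomm_atom := first
  [ apply: qLL | apply: qLLinv | apply: qLinvL | apply: qLinvLinv
  | apply: qLe12 | apply: qLinve12 | apply: qLe | apply: qLf | apply: qLinve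
  | apply: qLinvf | apply: qcomm1l | apply: qcomm1r].
(** q-commutation scalars multiply over products on either side, so the scalar is synthesized factor
    by factor and compared with the required one only at the end, by [field]. *)
Ltac qcomm_rec := lazymatch goal with
  | |- qcomm _ (_ * _) _ => eapply qcommMl; [qcomm_rec|qcomm_rec]
  | |- qcomm _ _ (_ * _) => eapply qcommMr; [qcomm_rec|qcomm_rec]
  | |- qcomm _ (_ ^+ 2) _ => rewrite expr2; qcomm_rec
  | |- qcomm _ _ (_ ^+ 2) => rewrite expr2; qcomm_rec
  | |- _ => first [eassumption | by qcomm_atom
      | eapply qcomm_symV; [|by qcomm_atom]; rewrite ?invr_eq0 ?expf_neq0 ?oner_neq0 //]
  end.
Ltac qcomm_solve := eapply qcomm_eq; [qcomm_rec|
  rewrite /= ?expr0 ?expr1; field; rewrite ?q0 ?oner_neq0 //].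

Lemma uKE : uK * uE = uE * uK.
Proof. by apply: qcomm1P; rewrite /uK /uE; qcomm_solve. Qed.

Lemma uK'E : uK' * uE = uE * uK'.
Proof. by apply: qcomm1P; rewrite /uK' /uE; qcomm_solve. Qed.

Lemma uKf : qcomm (q ^- 2) uK (f i2).
Proof. by rewrite /uK; qcomm_solve. Qed.

Lemma uKg : qcomm (q ^- 2) uK ug.
Proof. by rewrite /uK /ug; qcomm_solve. Qed.

Lemma uK'g : qcomm (q ^+ 2) uK' ug.
Proof. by rewrite /uK' /ug; qcomm_solve. Qed.

Lemma uKe1 : qcomm (q ^- 2) uK (e i1).
Proof. by rewrite /uK; qcomm_solve. Qed.

Lemma uKK' : uK * uK' = 1.
Proof.
have c : qcomm 1 (L i2 ^+ 2) (L i1 ^+ 2) by qcomm_solve.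
have sq i : L i ^+ 2 * L' i ^+ 2 = 1.
  by rewrite !expr2 mulrA -[L i * L i * L' i]mulrA uLLinv mulr1 uLLinv.
have sq' i : L' i ^+ 2 * L i ^+ 2 = 1.
  by rewrite !expr2 mulrA -[L' i * L' i * L i]mulrA uLinvL mulr1 uLinvL.
rewrite /uK /uK' -mulrA [L i2 ^+ 2 * _]mulrA (qcomm1P c).
by rewrite -[L i1 ^+ 2 * _ * _]mulrA sq mulr1 sq'.
Qed.

Lemma uK'K : uK' * uK = 1.
Proof.
have c : qcomm 1 uK' uK by rewrite /uK /uK'; qcomm_solve.
by rewrite (qcomm1P c) uKK'.
Qed.

Lemma ugE : ug = e i1 * uK'.
Proof. by rewrite /ug /uK' mulrA. Qed.

Lemma ugK : ug * uK = e i1.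
Proof. by rewrite ugE -mulrA uK'K mulr1. Qed.

Lemma ue1f2 : e i1 * f i2 = f i2 * e i1.
Proof. by apply/eqP; rewrite -subr_eq0 uef mul0r scale0r. Qed.

Lemma ugf : qcomm (q ^+ 2) ug (f i2).
Proof.
have ef : qcomm 1 (e i1) (f i2) by rewrite /qcomm scale1r ue1f2.
by rewrite /ug; qcomm_solve.
Qed.

(** The quantum Serre relation for e_1, e_1, e_2, solved for e_2 e_1^2. *)
Lemma ue12e1 : qcomm q ue12 (e i1).
Proof.
have := userre_e q (isT : i1 != i2); rewrite /qcomm /ue12 expr2.
move: (e i1) (e i2) => a b serre.
have baa : b * a * a = (q + q^-1) *: (a * b * a) - a * a * b.
  by move/eqP: serre; rewrite !mulrA addrC addr_eq0 opprB => /eqP.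
rewrite mulrBl mulrBr scalerBr -!scalerAl -!scalerAr !mulrA baa scalerBr !scalerA.
rewrite mulrDr divff // -expr2 scalerDl scale1r opprB addrCA opprD.
by rewrite [X in _ + X]addrCA subrr addr0.
Qed.

Lemma uEg : qcomm (q ^+ 2) uE ug.
Proof. by have h := ue12e1; rewrite /uE /ug; qcomm_solve. Qed.

(** f_2 meets only e_2 in e_(1+2), which yields k_2 - k_2^-1. The choice of [q] in e_(1+2) makes the
    k_2 terms cancel, since k_2 e_1 = q^-1 e_1 k_2, and k_2^-1 L_1 = L_1^2 L_2^-2 turns the
    remaining term into [ug]. *)
Lemma uEf : uE * f i2 = f i2 * uE + q *: ug.
Proof.
have e2f : e i2 * f i2 = f i2 * e i2 + (q - q^-1)^-1 *: (uk q i2 - ukinv q i2).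
  by have := uef q i2 i2; rewrite eqxx div1r => <-; rewrite addrC subrK.
have ke : qcomm q^-1 (uk q i2) (e i1) by rewrite /uk; qcomm_solve.
have k'e : qcomm q (ukinv q i2) (e i1) by rewrite /ukinv; qcomm_solve.
have k'L : ukinv q i2 * L i1 = uK'.
  have c : qcomm 1 (L' i2 ^+ 2) (L i1 ^+ 2) by qcomm_solve.
  rewrite /ukinv (_ : rev_ord i2 = i1); last exact: val_inj.
  by rewrite -mulrA -expr2 (qcomm1P c).
have e12f : ue12 * f i2 = f i2 * ue12 + q *: (e i1 * ukinv q i2).
  move: ke k'e ue1f2 e2f; rewrite /qcomm /ue12; clear k'L.
  move: (e i1) (e i2) (f i2) (uk q i2) (ukinv q i2) => a b c k k' ka k'a ac bc.
  rewrite mulrBl -mulrA bc mulrDr mulrA ac -scalerAl -[b * a * c]mulrA ac.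
  rewrite [b * (c * a)]mulrA bc mulrDl -!scalerAl -scalerAr.
  rewrite mulrBr mulrBl ka k'a mulrBr -!scalerAr !mulrA.
  rewrite [q *: (_ + _)]scalerDr opprD addrACA; congr (_ + _).
  rewrite !scalerBr !scalerA [q * _ * q^-1]mulrAC divff // mul1r opprB.
  rewrite [X in X + _ = _]addrC addrACA subrr addr0.
  rewrite addrC -scalerBl; congr (_ *: _).
  by field; rewrite q0 subr_eq0 -expr2.
have Lf : L i1 * f i2 = f i2 * L i1.
  by apply: qcomm1P; qcomm_solve.
rewrite /uE -mulrA Lf mulrA e12f mulrDl -mulrA -scalerAl -mulrA k'L.
by rewrite -ugE.
Qed.

End Relations.

(** * Coproduct and counit as algebra morphisms; coassociativity and counit axioms *)

Section CoproductMorphism.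
Variables (K : fieldType) (q : K).
Hypothesis q0 : q != 0.
Local Notation U := (Uq q).
Local Notation UU := (tensor U U).

Fact coproduct_nmod : nmod_morphism (@coproduct K q).
Proof. by split; [exact: plift0 (cop_rel q0)|exact: coproductD]. Qed.
Fact coproduct_monoid : monoid_morphism (@coproduct K q).
Proof. by split; [exact: coproduct1|exact: coproductM]. Qed.
Fact coproduct_scalable : scalable (@coproduct K q).
Proof. by move=> c; exact: coproductZ. Qed.

(** The proof of q != 0 is an argument because the morphism structure depends on it; this makes the
    structure inferable. *)
Definition cop_map of q != 0 : U -> UU := @coproduct K q.
HB.instance Definition _ :=
  GRing.isNmodMorphism.Build U UU (cop_map q0) coproduct_nmod.
HB.instance Definition _ :=
  GRing.isMonoidMorphism.Build U UU (cop_map q0) coproduct_monoid.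
HB.instance Definition _ :=
  GRing.isScalable.Build K U UU *:%R (cop_map q0) coproduct_scalable.

Fact counit_nmod : nmod_morphism (@counit K q : U -> K^o).
Proof.
by split; [exact: plift0 (@counit_rel _ q)|exact: pliftD (@counit_rel _ q)].
Qed.
Fact counit_monoid : monoid_morphism (@counit K q : U -> K^o).
Proof.
by split; [exact: plift1 (@counit_rel _ q)|exact: pliftM (@counit_rel _ q)].
Qed.
Fact counit_scalable : scalable (@counit K q : U -> K^o).
Proof. by move=> c; exact: (pliftZ (@counit_rel _ q)). Qed.
HB.instance Definition _ :=
  GRing.isNmodMorphism.Build U K^o (@counit K q) counit_nmod.
HB.instance Definition _ :=
  GRing.isMonoidMorphism.Build U K^o (@counit K q) counit_monoid.
HB.instance Definition _ :=
  GRing.isScalable.Build K U K^o *:%R (@counit K q) counit_scalable.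

Let D : {lrmorphism U -> UU} := cop_map q0.
Let eps : {lrmorphism U -> K^o} := @counit K q : U -> K^o.

Lemma cop_mapE g : D (pgen (uq_rel q) g) = cop_gen q g.
Proof. exact: coproduct_gen q0 g. Qed.

Lemma counit_mapE g : eps (pgen (uq_rel q) g) = counit_gen K g.
Proof. exact: plift_gen (@counit_rel _ q) g. Qed.

Lemma copl_pure a b : copl D (a ⊗ b) = D a ⊗ b.
Proof. exact: tmapE. Qed.

Lemma copr_pure a b : copr D (a ⊗ b) = tassoc (a ⊗ D b).
Proof. by rewrite /copr /= tmapE. Qed.

(** Both composites are algebra morphisms, so it is enough to compare them on generators, where the
    monomials in the L_i are group-like. *)
Lemma coproduct_coassoc a : copl D (D a) = copr D (D a).
Proof.
move: a; apply: (Uq_ext (phi := copl D \o D) (psi := copr D \o D)) => g.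
have LE i : D (uL q i) = uL q i ⊗ uL q i by exact: cop_mapE (GL i).
have L'E i : D (uLinv q i) = uLinv q i ⊗ uLinv q i by exact: cop_mapE (GLinv i).
have MM (x y : U) : D x = x ⊗ x -> D y = y ⊗ y -> D (x * y) = (x * y) ⊗ (x * y).
  by move=> xE yE; rewrite rmorphM /= xE yE tpureM.
have eE i := cop_mapE (Ge i); have fE i := cop_mapE (Gf i).
have one : D 1 = 1 ⊗ 1 by rewrite rmorph1.
rewrite /= cop_mapE; case: g => i /=; last first.
- by rewrite copl_pure copr_pure L'E tassocE.
- by rewrite copl_pure copr_pure LE tassocE.
- case: (ord2P i) => -> /=; rewrite !rmorphD /= !copl_pure !copr_pure.
    rewrite L'E (fE i1) /= !expr2 !MM // ?L'E !tpureDr !tpureDl !rmorphD /= !tassocE.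
    by rewrite addrA.
  rewrite (fE i2) /= one !expr2 !MM // !tpureDr !tpureDl !rmorphD /= !tassocE.
  by rewrite addrA.
case: (ord2P i) => -> /=; rewrite !rmorphD /= !copl_pure !copr_pure.
  rewrite (eE i1) /= one !expr2 !MM // !tpureDr !tpureDl !rmorphD /= !tassocE.
  by rewrite addrA.
rewrite (eE i2) /= !expr2 !MM ?LE // !tpureDr !tpureDl !rmorphD /= !tassocE.
by rewrite addrA.
Qed.

Lemma coproduct_counitl a : counl eps (D a) = a.
Proof.
move: a; apply: (Uq_ext (phi := counl eps \o D) (psi := idfun)) => g.
have LE i : eps (uL q i) = 1 by exact: counit_mapE (GL i).
have L'E i : eps (uLinv q i) = 1 by exact: counit_mapE (GLinv i).
have eE i : eps (ue q i) = 0 by exact: counit_mapE (Ge i).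
have fE i : eps (uf q i) = 0 by exact: counit_mapE (Gf i).
rewrite /= cop_mapE; case: g => i /=; last first.
- by rewrite counlE L'E scale1r.
- by rewrite counlE LE scale1r.
- case: (ord2P i) => -> /=; rewrite !rmorphD /= !counlE fE scale0r add0r.
    by rewrite L'E scale1r.
  by rewrite rmorph1 scale1r.
case: (ord2P i) => -> /=; rewrite !rmorphD /= !counlE eE scale0r addr0.
  by rewrite rmorphM !rmorphXn /= LE L'E !expr1n mulr1 scale1r.
by rewrite rmorphM !rmorphXn /= LE L'E !expr1n mulr1 scale1r.
Qed.

Lemma coproduct_counitr a : counr eps (D a) = a.
Proof.
move: a; apply: (Uq_ext (phi := counr eps \o D) (psi := idfun)) => g.
have LE i : eps (uL q i) = 1 by exact: counit_mapE (GL i).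
have L'E i : eps (uLinv q i) = 1 by exact: counit_mapE (GLinv i).
have eE i : eps (ue q i) = 0 by exact: counit_mapE (Ge i).
have fE i : eps (uf q i) = 0 by exact: counit_mapE (Gf i).
rewrite /= cop_mapE; case: g => i /=; last first.
- by rewrite counrE L'E scale1r.
- by rewrite counrE LE scale1r.
- case: (ord2P i) => -> /=; rewrite !rmorphD /= !counrE fE scale0r addr0.
    by rewrite rmorphM !rmorphXn /= LE L'E !expr1n mulr1 scale1r.
  by rewrite rmorphM !rmorphXn /= LE L'E !expr1n mulr1 scale1r.
case: (ord2P i) => -> /=; rewrite !rmorphD /= !counrE eE scale0r add0r.
  by rewrite rmorph1 scale1r.
by rewrite LE scale1r.
Qed.

End CoproductMorphism.

(** * The twisting series *)

Local Opaque qexp.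

Section TwistingSeries.
Variables (K : fieldType) (q : K).
Hypotheses (q0 : q != 0) (q_free : forall n, (q ^+ 2) ^+ n.+1 != 1).
Local Notation U := (Uq q).
Local Notation UU := (tensor U U).
Local Notation P := (q ^- 2).
Local Notation f2 := (uf q i2).
Local Notation e1 := (ue q i1).

Let D : {lrmorphism U -> UU} := cop_map q0.
Let p0 : q ^+ 2 != 0. Proof. by rewrite expf_neq0. Qed.
Let q2 : q ^+ 2 != 1. Proof. exact: (q_free 0). Qed.
Let P_free : forall n, P ^+ n.+1 != 1. Proof. exact: inv_free. Qed.
Let P0 : P != 0. Proof. by rewrite invr_eq0. Qed.
Let d0 : 1 - q ^+ 2 != 0. Proof. by rewrite subr_eq0 eq_sym. Qed.

(* [W = serW], [V = serA 1 * serB], and [serPhi] is the middle factor of [F_q];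
   [serB' 1] is the inverse of [serB]. The parameter [k] is a scalar put in place of
   the group-like [K]: [serFK] and the inverse of [serGK], which involve [f_2 (x) K]
   and [g (x) K^-1], specialize to [serB' k] and the inverse of [serA k^-1]. *)
Definition cu : K := 1 / (1 - q ^+ 2).
Definition cv : K := q^-1 / (1 - q ^+ 2) ^+ 2.
Definition cw : K := q ^- 3 / (1 - q ^+ 2) ^+ 2.

Definition serW : fps U := qexp P (fps_mono 1 ((- cu) *: uE q)).
Definition serA (k : K) : fps U := qexp P (fps_mono 2 ((- (k * cv)) *: ug q)).
Definition serB : fps U := qexp (q ^+ 2) (fps_mono 1 (cu *: f2)).
Definition serB' (k : K) : fps U := qexp P (fps_mono 1 ((- (k * cu)) *: f2)).
Definition serPhi : fps UU := qexp P (fps_mono 3 (cw *: (f2 ⊗ e1))).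
Definition serFK : fps UU := qexp P (fps_mono 1 ((- cu) *: (f2 ⊗ uK q))).
Definition serGK : fps UU := qexp P (fps_mono 2 ((- cv) *: (ug q ⊗ uK' q))).

Lemma fps_mono_coef0 n (A : algType K) (a : A) : fcoef (fps_mono n.+1 a) 0 = 0.
Proof. by []. Qed.

Lemma scale_fps_mono_coef0 n c (A : algType K) (a : A) : fcoef (c *: fps_mono n.+1 a) 0 = 0.
Proof. by rewrite fcoefZ scaler0. Qed.

Lemma qcommZl (A : algType K) c d (x y : A) : qcomm c x y -> qcomm c (d *: x) y.
Proof. by rewrite /qcomm -scalerAl -scalerAr => ->; rewrite !scalerA mulrC. Qed.

Lemma qcommZZ (A : algType K) c d d' (x y : A) :
  qcomm c x y -> qcomm c (d *: x) (d' *: y).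
Proof. by move=> h; apply/qcommZl/qcommZr. Qed.

Lemma serB_inv : serB * serB' 1 = 1.
Proof.
by rewrite /serB' mul1r scaleNr fps_monoN qexp_inv.
Qed.

Lemma cop_f2 : D f2 = f2 ⊗ uK q + 1 ⊗ f2.
Proof. exact: cop_mapE q0 (Gf i2). Qed.

Lemma cop_uL i : D (uL q i) = uL q i ⊗ uL q i.
Proof. exact: cop_mapE q0 (GL i). Qed.

Lemma cop_uLinv i : D (uLinv q i) = uLinv q i ⊗ uLinv q i.
Proof. exact: cop_mapE q0 (GLinv i). Qed.

Lemma cop_uK' : D (uK' q) = uK' q ⊗ uK' q.
Proof. by rewrite /uK' rmorphM !rmorphXn /= cop_uL cop_uLinv !expr2 !tpureM. Qed.

Lemma cop_g : D (ug q) = ug q ⊗ uK' q + 1 ⊗ ug q.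
Proof.
rewrite ugE rmorphM /= cop_uK' (cop_mapE q0 (Ge i1)) /= -/(uK q) mulrDl !tpureM.
by rewrite uKK' // mul1r addrC.
Qed.

(** The two summands of Delta(f_2) q-commute because K f_2 = q^-2 f_2 K, so the addition theorem
    splits the exponential. [cop_serA] does the same for g. *)
Lemma fps_map_serB' : fps_map D (serB' 1) = fps_map (tinr U) (serB' 1) * serFK.
Proof.
rewrite !fps_map_qexp !fps_map_mono !linearZ_LR /= -/D cop_f2 mul1r.
rewrite addrC scalerDr fps_monoD qexpD //; apply: fps_mono_qcomm.
apply: qcommZZ; rewrite -[P]mul1r; apply: qcomm_tensor; first exact: qcomm1r.
exact: uKf.
Qed.

Lemma cop_serA : fps_map D (serA 1) = serGK * fps_map (tinr U) (serA 1).
Proof.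
rewrite !fps_map_qexp !fps_map_mono !linearZ_LR /= -/D cop_g mul1r.
rewrite scalerDr fps_monoD qexpD //; apply: fps_mono_qcomm.
apply: qcommZZ; rewrite -[P]mul1r; apply: qcomm_tensor; first exact: qcomm1l.
by apply: qcomm_sym => //; exact: uK'g.
Qed.

(* As [e_1 = g K], this amounts to the [q]-difference equation of [serA 1]. *)
Lemma serA_conj : serA 1 * (fps_mono 2 (cw *: e1) + fps_mono 0 ((- cu) *: uK q)) =
  fps_mono 0 ((- cu) *: uK q) * serA 1.
Proof.
(* Chosen so that q^-2 y is the exponent of [serA 1], as [qexp_shift] requires. *)
pose y := fps_mono 2 ((- (cv * q ^+ 2)) *: ug q).
have Py : P *: y = fps_mono 2 ((- (1 * cv)) *: ug q).
  by rewrite -fps_monoZ scalerA mulrN mulrCA mulVf ?mulr1 ?mul1r.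
have shift : serA 1 = (1 - (1 - P) *: y) * qexp P y.
  by have := @qexp_shift _ _ U P_free y erefl; rewrite Py.
have KA : fps_mono 0 (uK q) * qexp P y = serA 1 * fps_mono 0 (uK q).
  rewrite /serA -Py; apply: qexp_intertwine => //; first exact: scale_fps_mono_coef0.
  by rewrite -scalerAl; apply: fps_mono_qcomm; apply: qcommZr; exact: uKg.
have gA : serA 1 * fps_mono 2 (ug q) = fps_mono 2 (ug q) * serA 1.
  by apply/esym/qexp_intertwine => //; rewrite !fps_monoM -scalerAl -scalerAr.
have Ky : fps_mono 0 (uK q) * y = (- cv) *: (fps_mono 2 (ug q) * fps_mono 0 (uK q)).
  rewrite !fps_monoM -scalerAr uKg // scalerA fps_monoZ; congr (_ *: _).
  by rewrite mulNr mulfK.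
rewrite -(ugK q) !fps_monoZ -[fps_mono 2 (_ * _)](fps_monoM 2 0).
rewrite mulrDr -!fps_scalerAr mulrA gA -mulrA -KA mulrA -fps_scalerAl shift.
rewrite [in RHS]mulrA mulrBr mulr1 -fps_scalerAr Ky.
rewrite [in RHS]mulrBl scalerBr addrC; congr (_ + _).
rewrite -!fps_scalerAl !scalerA -scaleNr; congr (_ *: _).
by rewrite /cw /cu /cv; field; rewrite q0 d0.
Qed.

Let comm_intertwine (A : algType K) p p' (x y : fps A) : fcoef x 0 = 0 ->
  fcoef y 0 = 0 -> x * y = y * x -> qexp p x * qexp p' y = qexp p' y * qexp p x.
Proof.
by move=> x0 y0 xy; apply: qexp_intertwine => //; apply/esym/qexp_intertwine.
Qed.

Lemma serB_Phi : fps_map (tinr U) serB * serPhi = serPhi * fps_map (tinr U) serB.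
Proof.
rewrite fps_map_qexp fps_map_mono; apply: comm_intertwine => //.
rewrite !fps_monoM linearZ_LR /= -!scalerAl -!scalerAr !tpureM mul1r mulr1.
by rewrite (ue1f2 q) !scalerA mulrC.
Qed.

(** The addition theorem merges the two exponentials into one with exponent t f_2 (x) (cw t^2 e_1 -
    cu K). By [serA_conj], passing [serA 1] through the second leg removes the e_1 term. *)
Lemma serA_PhiFK : fps_map (tinr U) (serA 1) * (serPhi * serFK) =
  serFK * fps_map (tinr U) (serA 1).
Proof.
have addE : serPhi * serFK = qexp P (fps_mono 3 (cw *: (f2 ⊗ e1)) +
    fps_mono 1 ((- cu) *: (f2 ⊗ uK q))).
  rewrite qexpD //; apply: fps_mono_qcomm; apply: qcommZZ.
  rewrite -[P]mul1r; apply: qcomm_tensor; last exact: uKe1.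
  by rewrite /qcomm scale1r.
have split1 n c a : fps_mono n.+1 (c *: (f2 ⊗ a)) =
    fps_map (tinl U) (fps_mono 1 f2) * fps_map (tinr U) (fps_mono n (c *: a)).
  by rewrite !fps_map_mono fps_monoM -tinlrE tpureZr.
have comm := fps_map_comm (fps_mono 1 f2) (serA 1) (@tinlr_comm K U U).
have sum0 : fcoef (fps_mono 3 (cw *: (f2 ⊗ e1)) +
  fps_mono 1 ((- cu) *: (f2 ⊗ uK q)) : fps UU) 0 = 0 by rewrite fcoefD addr0.
have key : fps_map (tinr U) (serA 1) * (fps_mono 3 (cw *: (f2 ⊗ e1)) +
    fps_mono 1 ((- cu) *: (f2 ⊗ uK q))) =
    fps_mono 1 ((- cu) *: (f2 ⊗ uK q)) * fps_map (tinr U) (serA 1).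
  rewrite (split1 2) (split1 0) -mulrDr -fps_mapD mulrA -comm -!mulrA -!fps_mapM.
  by rewrite serA_conj.
exact: (etrans (congr1 (fun z => fps_map (tinr U) (serA 1) * z) addE)
  (qexp_intertwine P sum0 (fps_mono_coef0 0 _) key)).
Qed.

Lemma serAE k : serA k = qexp P (fps_mono 2 ((- (k * cv)) *: ug q)).
Proof. by []. Qed.

Local Opaque serA serB serB' serPhi serFK serGK.

Let assemble (B : unitRingType) (lv ra rb phi rb' fk gk : B) :
  ra \is a GRing.unit -> rb * phi = phi * rb -> rb * rb' = 1 ->
  ra * (phi * fk) = fk * ra ->
  lv * (ra * rb) * phi * (rb' * fk * (ra^-1 * gk^-1)) = lv * fk * gk^-1.
Proof.
move=> rau bphi bb aphi; rewrite -!mulrA; congr (lv * _).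
rewrite [rb * _]mulrA bphi -!mulrA [rb * _]mulrA bb mul1r !mulrA.
by rewrite -[ra * phi * fk]mulrA aphi mulrK.
Qed.

(** All factors living in the second leg alone cancel: [serB] commutes with [serPhi] and meets its
    inverse, then [serA 1] absorbs [serPhi] into [serFK] and meets its own inverse. *)
Lemma twisted_coboundary :
  ((serA 1 * serB) ⊗t (serA 1 * serB)) * serPhi * fps_map D (serA 1 * serB)^-1 =
  fps_map (tinl U) (serA 1 * serB) * serFK * serGK^-1.
Proof.
have Au : serA 1 \is a GRing.unit by exact: qexp_unit.
have Bu : serB \is a GRing.unit by exact: qexp_unit.
have GKu : serGK \is a GRing.unit by exact: qexp_unit.
have BV : serB^-1 = serB' 1 by apply: (mulrI Bu); rewrite serB_inv divrr.
have rAu := fps_map_unit (tinr U) Au.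
have Bc : fps_map (tinr U) serB * fps_map (tinr U) (serB' 1) = 1.
  by rewrite -fps_mapM serB_inv fps_map1.
have AVB : (serA 1 * serB)^-1 = serB' 1 * (serA 1)^-1.
  exact: etrans (invrM Au Bu) (congr1 (fun z => z * (serA 1)^-1) BV).
have DA : fps_map D (serA 1)^-1 = (fps_map (tinr U) (serA 1))^-1 * serGK^-1.
  by rewrite (fps_mapV D Au) cop_serA (invrM GKu rAu).
rewrite AVB (fps_mapM D) fps_tensorE (fps_mapM (tinr U)).
have asm := assemble (fps_map (tinl U) (serA 1 * serB))
  serGK rAu serB_Phi Bc serA_PhiFK.
by refine (etrans _ asm); congr (_ * _); exact: congr2 fps_map_serB' DA.
Qed.

Lemma serW_FK : fps_map (tinr U) serW * serFK = serFK * fps_map (tinr U) serW.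
Proof.
rewrite fps_map_qexp fps_map_mono; apply: comm_intertwine => //.
rewrite !fps_monoM linearZ_LR /= -!scalerAl -!scalerAr !tpureM mul1r mulr1.
by rewrite uKE // !scalerA mulrC.
Qed.

Lemma serW_GK : fps_map (tinr U) serW * serGK = serGK * fps_map (tinr U) serW.
Proof.
rewrite fps_map_qexp fps_map_mono; apply: comm_intertwine => //.
rewrite !fps_monoM linearZ_LR /= -!scalerAl -!scalerAr !tpureM mul1r mulr1.
by rewrite uK'E // !scalerA mulrC.
Qed.

Let assemble_conj (B : unitRingType) (lw rw lv rv phi dv fk gk lw' rw' : B) :
  rw * lv = lv * rw -> rw * fk = fk * rw -> rw * gk^-1 = gk^-1 * rw ->
  rw * lw' = lw' * rw -> rw * rw' = 1 ->
  lv * rv * phi * dv = lv * fk * gk^-1 ->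
  lw * lv * (rw * rv) * phi * dv * (lw' * rw') = lw * lv * fk * gk^-1 * lw'.
Proof.
move=> clv cfk cgk clw rr E.
rewrite -[lw * lv * _]mulrA [lv * (rw * rv)]mulrA -clv -!mulrA.
rewrite [lv * (rv * _)](_ : _ = lv * rv * phi * dv * (lw' * rw')); last first.
  by rewrite !mulrA.
rewrite E -!mulrA; congr (lw * _).
rewrite [rw * _]mulrA clv -mulrA [rw * _]mulrA cfk -mulrA [rw * _]mulrA cgk.
by rewrite -mulrA [rw * _]mulrA clw -mulrA rr mulr1.
Qed.

(** Since K commutes with E, the copy of W in the second leg passes through everything and cancels
    against W^-1. Only powers of K and K^-1 remain in the second leg. *)
Lemma twist_form : let V := serA 1 * serB in
  ((serW * V) ⊗t (serW * V)) * serPhi * fps_map D V^-1 * (serW^-1 ⊗t serW^-1) =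
  fps_map (tinl U) (serW * V) * serFK * serGK^-1 * fps_map (tinl U) serW^-1.
Proof.
move=> V; have Wu : serW \is a GRing.unit by exact: qexp_unit.
have GKu : serGK \is a GRing.unit by exact: qexp_unit.
have comm f g : fps_map (tinr U) f * fps_map (tinl U) g =
    fps_map (tinl U) g * fps_map (tinr U) f.
  by apply/esym/fps_map_comm => a b; exact: tinlr_comm.
have cobV := twisted_coboundary; rewrite -/V fps_tensorE in cobV.
rewrite 2!fps_tensorE (fps_mapM (tinl U)) (fps_mapM (tinr U)).
apply: assemble_conj; [exact: comm|exact: serW_FK| |exact: comm| |exact: cobV].
- exact: (commrV serW_GK).
- by rewrite -(fps_mapM (tinr U)) divrr // fps_map1.
Qed.

(* The right-hand side of [twist_form] with the second tensor factor [K]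
   specialized to the scalar [k]. *)
Definition serY (k : K) : fps U :=
  serW * (serA 1 * serB) * serB' k * (serA k^-1)^-1 * serW^-1.

Definition serT : fps U := 1 - fps_mono 1 (uE q).

Definition serZ (k : K) : fps U := 1 - fps_mono 1 (k *: f2) +
  ((q * k - q ^- 3 * k^-1) / (1 - q ^+ 2)) *: (fps_mono 2 (ug q) * serT^-1).

Lemma serT_unit : serT \is a GRing.unit.
Proof. by apply: fps_unit_coef0; rewrite fcoefD fcoefN subr0. Qed.

Lemma serY1 : serY 1 = 1.
Proof.
have Au : serA 1 \is a GRing.unit by exact: qexp_unit.
have Wu : serW \is a GRing.unit by exact: qexp_unit.
have cancel (B : unitRingType) (w x y z : B) : w \is a GRing.unit ->
    x \is a GRing.unit -> y * z = 1 -> w * (x * y) * z * x^-1 * w^-1 = 1.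
  move=> wu xu yz; rewrite -[w * _ * z]mulrA -[x * y * z]mulrA yz mulr1.
  by rewrite mulrK // divrr.
by rewrite /serY invr1; exact: cancel Wu Au serB_inv.
Qed.

Lemma serB'_shift k :
  serB' k = serB' (q ^+ 2 * k) * (1 - fps_mono 1 (k *: f2)).
Proof.
pose y := fps_mono 1 ((- (q ^+ 2 * k * cu)) *: f2).
have Py : P *: y = fps_mono 1 ((- (k * cu)) *: f2).
  by rewrite -fps_monoZ scalerA mulrN -[q ^+ 2 * k * cu]mulrA mulKf.
have := @qexp_shift _ _ U P_free y erefl; rewrite Py => shift.
rewrite [LHS]shift.
have -> : 1 - (1 - P) *: y = 1 - fps_mono 1 (k *: f2).
  congr (_ - _); rewrite -fps_monoZ scalerA; congr (fps_mono 1 (_ *: _)).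
  by rewrite /cu; field; rewrite q0 d0.
rewrite -[serB' _]/(qexp P y); apply: qexp_intertwine => //.
by rewrite mulrBl mulrBr mul1r mulr1 !fps_monoM -!scalerAl -!scalerAr !scalerA mulrC.
Qed.

Lemma serA_shift k : serA (P * k) =
  (1 - fps_mono 2 (((1 - q ^+ 2) * (P * k * cv)) *: ug q)) * serA k.
Proof.
pose y := fps_mono 2 ((- (k * cv)) *: ug q).
have := @qexp_shift _ _ U P_free y erefl.
rewrite -[P *: y]fps_monoZ -[(1 - P) *: y]fps_monoZ !scalerA => shift.
rewrite !serAE -[P * k * cv]mulrA -mulrN [LHS]shift; congr ((1 - fps_mono 2 (_ *: _)) * _).
by field.
Qed.

Lemma f2_serA k : fps_mono 1 f2 * serA k = serA (P * k) * fps_mono 1 f2.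
Proof.
rewrite !serAE.
apply: qexp_intertwine => //; rewrite !fps_monoM -scalerAl -scalerAr.
rewrite (qcomm_sym p0 (ugf q0)) // scalerA; congr (fps_mono 3 (_ *: _)).
by field.
Qed.

(** The q-difference equation at q^2 x, where x is the exponent of W. The factor 1 - q^2 cancels the
    denominator of [cu], so [serT] has regular coefficients. *)
Lemma serW_shift : serW = serT * qexp P (q ^+ 2 *: fps_mono 1 ((- cu) *: uE q)).
Proof.
pose x := fps_mono 1 ((- cu) *: uE q).
have := @qexp_shift _ _ U P_free (q ^+ 2 *: x) (scale_fps_mono_coef0 0 _ _).
rewrite scalerA mulVf // scale1r => shift; rewrite [LHS]shift.
congr ((1 - _) * _); rewrite -!fps_monoZ !scalerA -[uE q in RHS]scale1r.
congr (fps_mono 1 (_ *: _)).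
by rewrite /cu; field; rewrite q0 d0.
Qed.

(** As E g = q^2 g E, moving [ug] to the left rescales the exponent of W by q^2, and [serW_shift]
    expresses the result through W itself. *)
Lemma serW_g : serW * fps_mono 2 (ug q) = fps_mono 2 (ug q) * (serT^-1 * serW).
Proof.
rewrite {2}serW_shift mulKr ?serT_unit //.
apply/esym/qexp_intertwine => //; first exact: scale_fps_mono_coef0.
rewrite -fps_monoZ !fps_monoM -!scalerAl -!scalerAr !scalerA (uEg q0) // scalerA.
by rewrite mulrC.
Qed.

(** The case of [qexp_commutator] given by E f_2 = f_2 E + q g; the rescaled exponential is again
    serT^-1 W. *)
Lemma serW_f : serW * fps_mono 1 f2 =
  (fps_mono 1 f2 - (q * cu) *: (fps_mono 2 (ug q) * serT^-1)) * serW.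
Proof.
pose x := fps_mono 1 ((- cu) *: uE q).
have xf : x * fps_mono 1 f2 = fps_mono 1 f2 * x + fps_mono 2 ((- (q * cu)) *: ug q).
  rewrite !fps_monoM -fps_monoD -!scalerAl -!scalerAr (uEf q0 q2) scalerDr scalerA.
  by rewrite mulNr mulrC.
have := @qexp_commutator _ _ U P0 P_free _ _ _ (fps_mono_coef0 0 _) xf.
rewrite invrK => -> //; last first.
  by apply: fps_mono_qcomm; apply: qcommZZ; exact: uEg.
rewrite mulrBl -[qexp P x]/serW; congr (_ + _).
rewrite serW_shift -fps_scalerAl -mulrA mulKr ?serT_unit //.
by rewrite fps_monoZ scaleNr mulNr fps_scalerAl.
Qed.

(** Shifting [serB'] releases the factor 1 - t k f_2. Carrying it to the right past the inverse of
    [serA] shifts that series too and adds a term in g; conjugation by W then turns the factor into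
    [serZ]. *)
Lemma serY_rec k : k != 0 -> serY k = serY (q ^+ 2 * k) * serZ k.
Proof.
move=> k0.
have Wu : serW \is a GRing.unit by exact: qexp_unit.
pose g2 := fps_mono 2 (((1 - q ^+ 2) * (P * k^-1 * cv)) *: ug q).
pose f1 := fps_mono 1 (k *: f2).
have A1u : serA k^-1 \is a GRing.unit by exact: qexp_unit.
have A2u : serA (P * k^-1) \is a GRing.unit by exact: qexp_unit.
have WZ : serW * (1 - g2 - f1) = serZ k * serW.
  pose gT := fps_mono 2 (ug q) * serT^-1.
  have Wg : serW * g2 = (((1 - q ^+ 2) * (P * k^-1 * cv)) *: gT) * serW.
    by rewrite /g2 fps_monoZ -fps_scalerAr serW_g [_ * (serT^-1 * _)]mulrA fps_scalerAl.
  have Wf : serW * f1 = (k *: (fps_mono 1 f2 - (q * cu) *: gT)) * serW.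
    by rewrite /f1 fps_monoZ -fps_scalerAr serW_f fps_scalerAl.
  rewrite 2!mulrBr mulr1 Wg Wf -{1}[serW]mul1r -2!mulrBl; congr (_ * serW).
  rewrite /serZ -/gT fps_monoZ scalerBr scalerA opprB addrA [RHS]addrAC.
  congr (_ - _); rewrite -addrA -scaleNr -scalerDl; congr (1 + _ *: _).
  by rewrite /cu /cv; field; rewrite k0 q0 d0.
have AZ : (1 - f1) * (serA k^-1)^-1 = (serA (P * k^-1))^-1 * (1 - g2 - f1).
  have f1A : f1 * serA k^-1 = serA (P * k^-1) * f1.
    by rewrite /f1 fps_monoZ -fps_scalerAl f2_serA fps_scalerAr.
  have solve (B : unitRingType) (a a' x y : B) : a \is a GRing.unit ->
      a' \is a GRing.unit -> y * a = a' * y -> a' = (1 - x) * a ->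
      (1 - y) * a^-1 = a'^-1 * (1 - x - y).
    move=> au au' ya a'E; apply: (mulrI au'); apply: (mulIr au).
    by rewrite -!mulrA mulVr // mulr1 mulVKr // mulrBr mulr1 -ya a'E -mulrBl.
  exact: solve A1u A2u f1A (serA_shift _).
have solve (B : unitRingType) (w v b b' a a' y x z : B) : w \is a GRing.unit ->
    b = b' * y -> y * a^-1 = a'^-1 * x -> w * x = z * w ->
    w * v * b * a^-1 * w^-1 = w * v * b' * a'^-1 * w^-1 * z.
  move=> wu -> ya wx; have wz : w^-1 * z = x * w^-1.
    by apply: (mulrI wu); apply: (mulIr wu); rewrite -!mulrA mulVr // mulr1 mulVKr.
  rewrite -[RHS]mulrA wz [RHS]mulrA; congr (_ * w^-1).
  by rewrite [w * v * (b' * y)]mulrA -mulrA ya mulrA.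
rewrite /serY invfM.
exact: solve Wu (serB'_shift k) AZ WZ.
Qed.

(** At k = q^(2m) the numerator is divisible by 1 - q^2 and the quotient is a q-integer up to a
    unit; hence the coefficient has no pole at q = 1. *)
Lemma serZ_qint m : let k := (q ^+ 2) ^+ m in
  serZ k = 1 - fps_mono 1 (k *: f2) +
    (- (q ^- 3 * k^-1 * qint (q ^+ 2) (m + m + 2))) *: (fps_mono 2 (ug q) * serT^-1).
Proof.
rewrite /= /serZ; congr (_ + _ *: _); rewrite /qint !exprD; field.
by rewrite d0 q0 !expf_neq0.
Qed.

End TwistingSeries.

(** * Cocycle equation of the middle factor, counit conditions, and the Laurent form of [serF] *)

Section TwistProof.
Variables (K : fieldType) (q : K).
Hypotheses (q0 : q != 0) (q_free : forall n, (q ^+ 2) ^+ n.+1 != 1).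
Local Notation U := (Uq q).
Local Notation UU := (tensor U U).
Local Notation P := (q ^- 2).
Local Notation f2 := (uf q i2).
Local Notation e1 := (ue q i1).
Let D : {lrmorphism U -> UU} := cop_map q0.
Let p0 : q ^+ 2 != 0. Proof. by rewrite expf_neq0. Qed.
Let P0 : P != 0. Proof. by rewrite invr_eq0. Qed.
Let P_free : forall n, P ^+ n.+1 != 1. Proof. exact: inv_free. Qed.

(** The addition theorem gives exp(a) exp(d) exp(b) on one side and exp(d) exp(a) exp(b) on the
    other. These agree because [a] and [d] overlap only in the second leg, where e_1 and f_2
    commute. *)
Lemma drinfeld_serPhi : drinfeld D (serPhi q).
Proof.
pose mono (a : tensor UU U) := fps_mono 3 (cw q *: a).
pose a := (f2 ⊗ e1) ⊗ 1 : tensor UU U.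
pose b := (f2 ⊗ uK q) ⊗ e1 : tensor UU U.
pose d := (1 ⊗ f2) ⊗ e1 : tensor UU U.
have l12 : fps_map (@leg12 _ U) (serPhi q) = qexp P (mono a).
  by rewrite fps_map_qexp fps_map_mono linearZ_LR.
have l23 : fps_map (@leg23 _ U) (serPhi q) = qexp P (mono d).
  rewrite fps_map_qexp fps_map_mono linearZ_LR; congr (qexp _ (fps_mono _ (_ *: _))).
  by rewrite /= /leg23 tassocE.
have cl : fps_map (copl D) (serPhi q) = qexp P (mono (d + b)).
  rewrite fps_map_qexp fps_map_mono linearZ_LR; congr (qexp _ (fps_mono _ (_ *: _))).
  by rewrite /= copl_pure (cop_f2 q0) tpureDl addrC.
have cr : fps_map (copr D) (serPhi q) = qexp P (mono (a + b)).
  rewrite fps_map_qexp fps_map_mono linearZ_LR; congr (qexp _ (fps_mono _ (_ *: _))).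
  rewrite /= copr_pure (cop_mapE q0 (Ge i1)) /= tpureDr rmorphD /= !tassocE.
  by rewrite addrC.
have Ke := uKe1 q0; have Kf := uKf q0.
have one_f : qcomm 1 f2 1 by exact: qcomm1r.
have bd : qcomm P b d.
  rewrite -[P]mulr1; apply: qcomm_tensor; last by rewrite /qcomm scale1r.
  by rewrite -[P]mul1r; apply: qcomm_tensor.
have ba : qcomm P b a.
  rewrite -[P]mulr1; apply: qcomm_tensor; last exact: qcomm1r.
  by rewrite -[P]mul1r; apply: qcomm_tensor => //; rewrite /qcomm scale1r.
have ad : a * d = d * a by rewrite !tpureM !mul1r !mulr1 ue1f2.
have split x : qcomm P b x -> qexp P (mono (x + b)) = qexp P (mono x) * qexp P (mono b).
  move=> bx; rewrite /mono scalerDr fps_monoD qexpD //.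
  by apply: fps_mono_qcomm; exact: qcommZZ.
have comm : qexp P (mono a) * qexp P (mono d) = qexp P (mono d) * qexp P (mono a).
  have ad' : mono a * mono d = mono d * mono a.
    by rewrite !fps_monoM -!scalerAl -!scalerAr ad.
  by apply: qexp_intertwine => //; apply/esym/qexp_intertwine.
rewrite /drinfeld l12 l23 cl cr (split _ bd) (split _ ba).
have swap (B : nzRingType) (x y z : B) : x * y = y * x -> x * (y * z) = y * (x * z).
  by move=> xy; rewrite mulrA xy mulrA.
exact: swap comm.
Qed.

Lemma serW_unit : serW q \is a GRing.unit. Proof. exact: qexp_unit. Qed.

Lemma serAB_unit : serA q 1 * serB q \is a GRing.unit.
Proof. by rewrite rpredM //; exact: qexp_unit. Qed.

Let eps : {lrmorphism U -> K^o} := @counit K q : U -> K^o.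

Lemma counit_ue i : eps (ue q i) = 0. Proof. exact: counit_mapE (Ge i). Qed.

Lemma counit_uf i : eps (uf q i) = 0. Proof. exact: counit_mapE (Gf i). Qed.

Lemma counit_qexp (A B : algType K) (phi : {lrmorphism A -> B}) r n c a :
  phi a = 0 -> fps_map phi (qexp r (fps_mono n (c *: a))) = 1.
Proof.
by move=> a0; rewrite fps_map_qexp fps_map_mono linearZ_LR /= a0 scaler0
  fps_mono_0 qexp0.
Qed.

Lemma counit_serW : fps_map eps (serW q) = 1.
Proof.
apply: counit_qexp; rewrite rmorphM (_ : _ (ue12 q) = 0) ?mul0r //.
have eM x y : eps x = 0 -> eps (x * y) = 0 by move=> x0; rewrite rmorphM /= x0 mul0r.
rewrite /ue12 -scalerN rmorphD [X in X + _]eM ?counit_ue // add0r.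
have e21 : eps (- (ue q i2 * ue q i1)) = 0.
  by rewrite (raddfN eps) [X in - X]eM ?counit_ue ?oppr0.
transitivity (q *: eps (- (ue q i2 * ue q i1))); first exact: (linearZ_LR eps).
by rewrite e21; exact: scaler0.
Qed.

Lemma counit_serAB : fps_map eps (serA q 1 * serB q) = 1.
Proof.
rewrite fps_mapM (counit_qexp (phi := eps)); last first.
  by rewrite /ug !rmorphM /= counit_ue !mul0r.
by rewrite (counit_qexp (phi := eps)) ?mulr1 // counit_uf.
Qed.

Lemma counl_serPhi : fps_map (counl eps) (serPhi q) = 1.
Proof. by apply: counit_qexp; rewrite /= counlE counit_uf scale0r. Qed.

Lemma counr_serPhi : fps_map (counr eps) (serPhi q) = 1.
Proof. by apply: counit_qexp; rewrite /= counrE counit_ue scale0r. Qed.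

Definition serF : fps UU := let V := serA q 1 * serB q in
  ((serW q * V) ⊗t (serW q * V)) * serPhi q * fps_map (@coproduct K q) V^-1 *
  ((serW q)^-1 ⊗t (serW q)^-1).

Lemma serF_twist : is_twist
  (twist_cop D ((serW q ⊗t serW q) * fps_map (@coproduct K q) (serW q)^-1))
  (@counit K q) serF.
Proof.
have Wu := serW_unit; have Vu := serAB_unit.
have [cl cr] := counit_gauge (@coproduct_counitl K q q0) (@coproduct_counitr K q q0)
  Wu Vu counit_serW counit_serAB counl_serPhi counr_serPhi.
split; [|exact: cl|exact: cr].
exact: (gauge_twist (@coproduct_coassoc K q q0) Wu Vu drinfeld_serPhi).
Qed.

Lemma qexpV (A : algType K) (x : fps A) : fcoef x 0 = 0 ->
  (qexp P x)^-1 = qexp P^-1 (- x).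
Proof.
move=> x0; have xu : qexp P x \is a GRing.unit by exact: qexp_unit.
by apply: (mulrI xu); rewrite divrr // qexp_inv.
Qed.

Lemma fps_laurent_eq (p : K) (A B : algType K) (k k' : B) X (Y Y' : nat -> fps A) :
  fps_laurent p k k' X Y -> Y =1 Y' -> fps_laurent p k k' X Y'.
Proof. by move=> XY /funext <-. Qed.

(** Reads off [twist_form] factor by factor. Inverses of [serGK] and [serA] are first written as
    q-exponentials by [qexpV], since [fps_laurent] is shown stable under [qexp] and products. *)
Lemma serF_laurent : fps_laurent (q ^+ 2) (uK q) (uK' q) serF
  (fun m => serY q ((q ^+ 2) ^+ m)).
Proof.
have kk := uKK' q; have k'k := uK'K q.
rewrite [serF](twist_form q0 q_free).
apply: fps_laurentM => //; last exact: fps_laurent_const.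
apply: fps_laurentM => //; last first.
  have E k : (serA q k)^-1 = qexp P^-1 (- fps_mono 2 (- (k * cv q) *: ug q)).
    by rewrite serAE qexpV.
  rewrite /serGK qexpV //; apply: fps_laurent_eq (fun m => esym (E _)).
  apply: fps_laurent_qexp => //; apply: fps_laurentN => //.
  apply: fps_laurent_mono => //.
  apply: laurent_eq (laurentZ (- cv q) (laurent_kappa' _ _ _ (ug q))) _ => m.
  by rewrite scalerA mulNr mulrC.
apply: fps_laurentM => //; first exact: fps_laurent_const.
apply: fps_laurent_qexp => //; apply: fps_laurent_mono => //.
apply: laurent_eq (laurentZ (- cu q) (laurent_kappa _ _ _ f2)) _ => m.
by rewrite scalerA mulNr mulrC.
Qed.

End TwistProof.

(** * Regularity at q = 1 *)

Section Regular.
Variable R : realType.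
Local Notation "x %:F" := (@FracField.tofrac _ x).
Local Notation q := (qvar R).
Local Notation reg := (@regular_at1 R).

Lemma regular_poly (G : {poly R[i]}) : reg G%:F.
Proof. by exists G, 1; rewrite hornerC oner_neq0 tofrac1 divr1. Qed.

Lemma regular_polyV (G : {poly R[i]}) : G.[1] != 0 -> reg (G%:F)^-1.
Proof. by move=> G1; exists 1, G; rewrite tofrac1 mul1r. Qed.

Lemma regularM x y : reg x -> reg y -> reg (x * y).
Proof.
move=> [a [b [b1 ->]]] [c [d [d1 ->]]]; exists (a * c), (b * d).
by rewrite hornerM mulf_neq0 // !tofracM mulf_div.
Qed.

Lemma regularD x y : reg x -> reg y -> reg (x + y).
Proof.
move=> [a [b [b1 ->]]] [c [d [d1 ->]]]; exists (a * d + c * b), (b * d).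
rewrite hornerM mulf_neq0 // !(tofracM, tofracD) addf_div //.
  by rewrite tofrac_eq0; apply: contraNneq b1 => ->; rewrite horner0.
by rewrite tofrac_eq0; apply: contraNneq d1 => ->; rewrite horner0.
Qed.

Lemma regular1 : reg 1. Proof. by rewrite -tofrac1; exact: regular_poly. Qed.

Lemma regularN x : reg x -> reg (- x).
Proof.
rewrite -mulN1r -tofrac1 -tofracN => rx.
by apply: regularM => //; exact: regular_poly.
Qed.

Lemma regularX x n : reg x -> reg (x ^+ n).
Proof.
move=> rx; elim: n => [|n IHn]; first exact: regular1.
by rewrite exprS; exact: regularM.
Qed.

Lemma regular_q : reg q. Proof. exact: regular_poly. Qed.

Lemma regular_qV : reg q^-1.
Proof. by apply: regular_polyV; rewrite hornerX oner_neq0. Qed.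

Lemma q2_free n : (q ^+ 2) ^+ n.+1 != 1.
Proof.
rewrite -exprM /qvar -tofracXn -tofrac1 tofrac_eq; apply/eqP.
by move/(congr1 (fun G : {poly R[i]} => size G)); rewrite size_polyXn size_poly1.
Qed.

Local Notation p := (q ^+ 2).
Let p_free : forall n, p ^+ n.+1 != 1 := q2_free.
Let q0 : q != 0 := qvar_neq0 R.
Let p0 : p != 0. Proof. by rewrite expf_neq0. Qed.

(** The value n at q = 1 is what makes (n)_(q^2) invertible among the regular functions for n > 0,
    by characteristic zero. *)
Lemma qint_poly n : exists G : {poly R[i]}, qint p n = G%:F /\ G.[1] = n%:R.
Proof.
elim: n => [|n [G [GE G1]]].
  by exists 0; rewrite qint0 tofrac0 horner0.
exists (1 + 'X ^+ 2 * G).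
rewrite qintS // GE tofracD tofracM tofracXn tofrac1; split=> //.
by rewrite hornerD hornerM hornerXn hornerC expr1n mul1r G1 nat1r.
Qed.

Lemma regular_qint n : reg (qint p n).
Proof. by have [G [-> _]] := qint_poly n; exact: regular_poly. Qed.

Lemma regular_qintV n : reg (qint p n.+1)^-1.
Proof.
have [G [-> G1]] := qint_poly n.+1; apply: regular_polyV.
by rewrite G1 pnatr_eq0.
Qed.

(** Passes from the base q^2 of the interpolation to the denominator q - 1 of the regular form; q +
    1 is invertible there, its value at 1 being 2. *)
Lemma q1V : exists2 c, reg c & (p - 1)^-1 = c * (q - 1)^-1.
Proof.
exists ('X + 1)%:F^-1.
  apply: regular_polyV; rewrite hornerD hornerX hornerC.
  by rewrite -(natrD _ 1 1) pnatr_eq0.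
have e (F : fieldType) (x : F) : (x ^+ 2 - 1)^-1 = (x + 1)^-1 * (x - 1)^-1.
  by rewrite subr_sqr_1 invfM mulrC.
by rewrite e tofracD tofrac1.
Qed.

Lemma regular_newton j m : (j <= m)%N -> reg (newton p j).[p ^+ m].
Proof.
move=> jm; rewrite (newton_qint p0 p_free jm); elim/big_ind: _ => [||i _].
- exact: regular1.
- by move=> x y; exact: regularM.
have -> : (j - i)%N = (j - i).-1.+1 by have := ltn_ord i; lia.
by apply: regularM; [exact: regular_qint|exact: regular_qintV].
Qed.

Local Notation U := (Uq q).
Local Notation L := (uL q).
Local Notation L' := (uLinv q).

Lemma Uhat0 : @Uhat R 0.
Proof.
rewrite -(scale0r 1); apply: Uhat_Z (Uhat_1 R).
by rewrite -tofrac0; exact: regular_poly.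
Qed.

Lemma UhatN x : @Uhat R x -> Uhat (- x).
Proof. by rewrite -scaleN1r => ?; apply: Uhat_Z => //; exact/regularN/regular1. Qed.

Lemma UhatB x y : @Uhat R x -> Uhat y -> Uhat (x - y).
Proof. by move=> ? ?; apply: Uhat_D => //; exact: UhatN. Qed.

Lemma UhatX x n : @Uhat R x -> Uhat (x ^+ n).
Proof.
move=> ux; elim: n => [|n IHn]; first exact: Uhat_1.
by rewrite exprS; exact: Uhat_M.
Qed.

Lemma regular_q1 : reg (q - 1).
Proof. by apply: regularD; [exact: regular_q|apply/regularN/regular1]. Qed.

Let q1 : q - 1 != 0.
Proof.
by rewrite subr_eq0; apply: contraNneq (p_free 0) => ->; rewrite !expr1n.
Qed.

(** Congruence to 1 modulo q - 1 inside the regular form, a condition stable under products. *)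
Definition near1 (x : U) := Uhat x /\ Uhat ((q - 1)^-1 *: (x - 1)).

Lemma near1M x y : near1 x -> near1 y -> near1 (x * y).
Proof.
move=> [ux hx] [uy hy]; split; first exact: Uhat_M.
have -> : x * y - 1 = (x - 1) * y + (y - 1) by rewrite mulrBl mul1r addrA subrK.
by rewrite scalerDr scalerAl; apply: Uhat_D => //; exact: Uhat_M.
Qed.

Lemma near1L i : near1 (L i).
Proof.
have h := @Uhat_h R i; split=> //.
rewrite -(subrK 1 (L i)) -[L i - 1](scalerKV q1); apply: Uhat_D; last exact: Uhat_1.
by apply: Uhat_Z h; exact: regular_q1.
Qed.

Lemma near1L' i : near1 (L' i).
Proof.
have u := @Uhat_Linv R i; split=> //.
have -> : L' i - 1 = - (L' i * (L i - 1)) by rewrite mulrBr mulr1 uLinvL opprB.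
by rewrite scalerN scalerAr; apply/UhatN/Uhat_M => //; exact: Uhat_h.
Qed.

Lemma near1K : near1 (uK q).
Proof. by rewrite /uK !expr2; do 3?apply: near1M; do ?[exact: near1L|exact: near1L']. Qed.

Lemma Uhat_K' : Uhat (uK' q).
Proof.
have L1 := (near1L i1).1; have L2 := (near1L' i2).1.
by apply: Uhat_M; exact: UhatX.
Qed.

(** The basis evaluated at K is a product of factors (K - 1)/(q^2 - 1) - (i)_(q^2) with regular
    scalars, and K is congruent to 1 modulo q - 1. *)
Lemma Uhat_newton j N : Uhat (horner_alg (uK q) (newton p j) * uK' q ^+ N).
Proof.
have [uK1 hK] := near1K.
apply: Uhat_M; last by apply/UhatX/Uhat_K'.
rewrite (horner_alg_newton p0 p_free); elim/big_ind: _ => [||i _].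
- exact: Uhat_1.
- by move=> x y; exact: Uhat_M.
have -> : (j - i)%N = (j - i).-1.+1 by have := ltn_ord i; lia.
have [c rc cE] := q1V.
apply: Uhat_Z; last apply: UhatB.
- apply: regularM; last exact: regular_qintV.
  by rewrite -exprVn; apply/regularX; rewrite -exprVn; exact/regularX/regular_qV.
- by rewrite cE -scalerA; exact: Uhat_Z.
- by apply: Uhat_Z (Uhat_1 R); exact: regular_qint.
Qed.

Definition fps_Uhat (X : fps U) := forall n, Uhat (fcoef X n).

Lemma fps_UhatM X Y : fps_Uhat X -> fps_Uhat Y -> fps_Uhat (X * Y).
Proof.
move=> uX uY n; rewrite fcoefM; elim/big_ind: _ => [||i _].
- exact: Uhat0.
- by move=> x y; exact: Uhat_D.
- exact: Uhat_M.
Qed.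

Lemma fps_UhatD X Y : fps_Uhat X -> fps_Uhat Y -> fps_Uhat (X + Y).
Proof. by move=> uX uY n; exact: Uhat_D. Qed.

Lemma fps_UhatN X : fps_Uhat X -> fps_Uhat (- X).
Proof. by move=> uX n; exact: UhatN. Qed.

Lemma fps_UhatZ c X : reg c -> fps_Uhat X -> fps_Uhat (c *: X).
Proof. by move=> rc uX n; exact: Uhat_Z. Qed.

Lemma fps_Uhat_mono n x : Uhat x -> fps_Uhat (fps_mono n x).
Proof. by move=> ux k /=; case: eqP => _ //; exact: Uhat0. Qed.

Lemma fps_Uhat1 : fps_Uhat 1.
Proof. by case=> [|n]; [exact: Uhat_1|exact: Uhat0]. Qed.

(** With constant term 1, each coefficient of the inverse is a polynomial in earlier ones, without
    division. *)
Lemma fps_UhatV X : fcoef X 0 = 1 -> fps_Uhat X -> fps_Uhat X^-1.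
Proof.
move=> X0 uX n; have [m nm] := ubnP n; elim: m n nm => // m IHm n; rewrite ltnS => nm.
have Xu := fps_unit_coef0 X0.
have : fcoef (X * X^-1) n = fcoef (1 : fps U) n by rewrite divrr.
rewrite fcoefM big_ord_recl X0 mul1r subn0 => /(canRL (addrK _)) ->.
apply: UhatB; first exact: fps_Uhat1.
elim/big_ind: _ => [||i _]; [exact: Uhat0|by move=> x y; exact: Uhat_D|].
by apply: Uhat_M => //; apply: IHm; rewrite /= /bump; have := ltn_ord i; lia.
Qed.

Lemma Uhat_uE : Uhat (uE q).
Proof.
have ue i := Uhat_e R i.
apply: Uhat_M; last exact: (near1L i1).1.
apply: UhatB; first exact: Uhat_M.
by apply: Uhat_Z; [exact: regular_q|exact: Uhat_M].
Qed.

Lemma Uhat_ug : Uhat (ug q).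
Proof.
apply: Uhat_M; last exact/UhatX/(near1L' i2).1.
by apply: Uhat_M; [exact: Uhat_e|exact/UhatX/(near1L i1).1].
Qed.

Lemma Uhat_serZ m : fps_Uhat (serZ q (p ^+ m)).
Proof.
have rpm : reg (p ^+ m) by apply/regularX/regularX/regular_q.
have rpmV : reg (p ^+ m)^-1.
  by rewrite -exprVn -exprVn; apply/regularX/regularX/regular_qV.
rewrite serZ_qint //; apply: fps_UhatD.
  apply: fps_UhatD; first exact: fps_Uhat1.
  by apply/fps_UhatN/fps_Uhat_mono/Uhat_Z => //; exact: Uhat_f.
apply: fps_UhatZ.
  apply/regularN/regularM; last exact: regular_qint.
  by apply: regularM => //; rewrite -exprVn; apply/regularX/regular_qV.
apply: fps_UhatM; first by apply/fps_Uhat_mono/Uhat_ug.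
apply: fps_UhatV; first by rewrite fcoefD fcoefN subr0.
by apply: fps_UhatD; [exact: fps_Uhat1|apply/fps_UhatN/fps_Uhat_mono/Uhat_uE].
Qed.

Lemma serZ_coef0 k : fcoef (serZ q k) 0 = 1.
Proof.
rewrite fcoefD fcoefD fcoefN fcoefZ fcoefM0 /= mul0r scaler0 subr0 addr0.
by [].
Qed.

(** Starts from the value 1 at m = 0; each step divides by [serZ], which is regular with constant
    term 1. *)
Lemma Uhat_serY m : fps_Uhat (serY q (p ^+ m)).
Proof.
elim: m => [|m IHm].
  by rewrite expr0 serY1 //; exact: fps_Uhat1.
have Zu := fps_unit_coef0 (serZ_coef0 (p ^+ m)).
have -> : serY q (p ^+ m.+1) = serY q (p ^+ m) * (serZ q (p ^+ m))^-1.
  have rec := serY_rec q0 p_free (expf_neq0 m p0).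
  have div (B : unitRingType) (x y z : B) : z \is a GRing.unit -> x = y * z -> y = x * z^-1.
    by move=> zu ->; rewrite mulrK.
  by rewrite exprS; exact: div Zu rec.
by apply: fps_UhatM => //; apply: fps_UhatV (serZ_coef0 _) (Uhat_serZ m).
Qed.

Lemma Uhat2_serF n : Uhat2 (fcoef (serF q) n).
Proof.
have lau := serF_laurent q0 p_free n.
apply: (laurent_interpolation (uKK' q) (uK'K q) p0 p_free _ _ _ _ _ lau).
- exact: Uhat0.
- exact: UhatB.
- by move=> k a; apply: Uhat_Z; apply/regularX/regularX/regular_q.
- by move=> j m a jm; apply: Uhat_Z; exact: regular_newton.
- exact: Uhat_newton.
- by move=> m; exact: Uhat_serY.
Qed.

End Regular.

Theorem proposition9 (R : realType) :
  let q : Cq R := qvar R in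
  let U := Uq q in
  let e1 : U := ue q i1 in
  let e2 : U := ue q i2 in
  let f2 : U := uf q i2 in
  let L1 : U := uL q i1 in
  let L2inv : U := uLinv q i2 in
  let Delta : fps U -> fps (tensor U U) := fps_map (@coproduct (Cq R) q) in
  let e12 : U := e1 * e2 - q *: (e2 * e1) in
  let W : fps U :=
    qexp (q ^- 2) (fps_mono 1 ((- (1 / (1 - q ^+ 2))) *: (e12 * L1))) in
  let J : fps (tensor U U) := (W ⊗t W) * Delta W^-1 in
  let DeltaJ : fps U -> fps (tensor U U) := fun a => J * Delta a * J^-1 in
  let V : fps U :=
    qexp (q ^- 2) (fps_mono 2
      ((- (q^-1 / (1 - q ^+ 2) ^+ 2)) *: (e1 * L1 ^+ 2 * L2inv ^+ 2))) *
    qexp (q ^+ 2) (fps_mono 1 ((1 / (1 - q ^+ 2)) *: f2)) in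
  let F : fps (tensor U U) :=
    ((W * V) ⊗t (W * V)) *
    qexp (q ^- 2) (fps_mono 3 ((q ^- 3 / (1 - q ^+ 2) ^+ 2) *: (f2 ⊗ e1))) *
    Delta V^-1 * (W^-1 ⊗t W^-1) in
  (forall n, Uhat2 (fcoef F n)) /\ is_twist DeltaJ (@counit (Cq R) q) F.
Proof.
move=> q U e1 e2 f2 L1 L2inv Delta e12 W J DeltaJ V F.
have WE : W = serW q by [].
(* [serA] at k = 1 carries the scalar 1 * cv, hence [mul1r]; [W] agrees by conversion. *)
have VE : V = serA q 1 * serB q by rewrite serAE mul1r.
have FE : F = serF q.
  rewrite /F VE WE /serF; reflexivity.
have DE : DeltaJ = twist_cop (cop_map (qvar_neq0 R))
    ((serW q ⊗t serW q) * fps_map (@coproduct _ q) (serW q)^-1).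
  by rewrite /DeltaJ /J WE.
split=> [n|]; first by rewrite FE; exact: Uhat2_serF.
rewrite FE DE.
exact: (serF_twist (qvar_neq0 R) (@q2_free R)).
Qed.
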